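(* Assume: (Smoothness) for each $i\in\{1,\dots,n\}$, $f_i$ is differentiable in $u$ and in $v_i$, $\nabla_u f_i(u,v_i)$ is $L_u$-Lipschitz in $u$ and $L_{uv}$-Lipschitz in $v_i$, $\nabla_v f_i(u,v_i)$ is $L_v$-Lipschitz in $v_i$ and $L_{vu}$-Lipschitz in $u$; put $L=\max\{L_u,L_v,L_{uv},L_{vu}\}$. (Stochastic gradients) for each $i$ and all $u,v_i$, $\mathbb{E}[\nabla_u F(u,v_i;\xi_i)]=\nabla_u f_i(u,v_i)$, $\mathbb{E}[\nabla_v F(u,v_i;\xi_i)]=\nabla_v f_i(u,v_i)$, $\mathbb{E}\|\nabla_u F(u,v_i;\xi_i)-\nabla_u f_i(u,v_i)\|^2\le\sigma_u^2$ and $\mathbb{E}\|\nabla_v F(u,v_i;\xi_i)-\nabla_v f_i(u,v_i)\|^2\le\sigma_v^2$. Run Scaffold-P for $T$ rounds with $\eta_u\ge\sqrt m$, $\eta_v\ge\sqrt{n/m}$ and $\gamma\le\frac1{72LK}\min\big(\frac{m}{n^{2/3}},1\big)$, where $\gamma=\gamma_u\eta_u=\gamma_v\eta_v$. Then $$\frac1T\sum_{t=0}^{T-1}\big(\mathcal G_u^t+\hat{\mathcal G}_{\mathbf v}^t\big)\le\frac{4F_0}{TK\gamma}+148\Big(\frac{\sigma_u^2}{m}+\frac{\sigma_v^2m}{n}\Big)L\gamma .$$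
   Context: Problem: $n$ clients, shared variable $u\in\mathbb R^{d_u}$, personal variables $\mathbf v=[v_1;\dots;v_n]$, $v_i\in\mathbb R^{d_v}$; $f_i(u,v_i)=\mathbb E_{\xi_i\sim\mathcal D_i}[F(u,v_i;\xi_i)]$ and $f(u,\mathbf v)=\frac1n\sum_{i=1}^n f_i(u,v_i)$. $\nabla_u,\nabla_v$ are the partial gradients in the first and second argument; $\|\cdot\|$ is Euclidean. Scaffold-P algorithm: parameters $T\ge1$ rounds, $K\ge1$ local steps, $1\le m\le n$, step sizes $\gamma_u,\gamma_v,\eta_u,\eta_v>0$ satisfying $\gamma_u\eta_u=\gamma_v\eta_v=:\gamma$; deterministic initial point $(u^0,\mathbf v^0)$; $c_i^0=\frac1K\sum_{k=0}^{K-1}\nabla_uF(u^0,v_i^0;\xi_{i,k}^{-1})$, $c^0=\frac1n\sum_{i=1}^nc_i^0$. In each round $t=0,\dots,T-1$: draw $\mathcal S^t\subset\{1,\dots,n\}$ uniformly at random among subsets of size $m$. Each $i\in\mathcal S^t$ sets $u_{i,0}^t=u^t$, $v_{i,0}^t=v_i^t$, and for $k=0,\dots,K-1$ performs $u_{i,k+1}^t=u_{i,k}^t-\gamma_u(\nabla_uF(u_{i,k}^t,v_{i,k}^t;\xi_{i,k}^t)-c_i^t+c^t)$, $v_{i,k+1}^t=v_{i,k}^t-\gamma_v\nabla_vF(u_{i,k}^t,v_{i,k}^t;\xi_{i,k}^t)$; then $v_i^{t+1}=(1-\eta_v)v_i^t+\eta_vv_{i,K}^t$ and $c_i^{t+1}=c_i^t-c^t+\frac1{K\gamma_u}(u^t-u_{i,K}^t)$.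 For $i\notin\mathcal S^t$, $v_i^{t+1}=v_i^t$ and $c_i^{t+1}=c_i^t$. Finally $u^{t+1}=(1-\eta_u)u^t+\frac{\eta_u}m\sum_{i\in\mathcal S^t}u_{i,K}^t$ and $c^{t+1}=c^t+\frac1n\sum_{i\in\mathcal S^t}(c_i^{t+1}-c_i^t)$. All samples $\xi_{i,k}^t\sim\mathcal D_i$ ($t\ge-1$) and all sets $\mathcal S^t$ are mutually independent. Notation: $\mathcal G_u^t=\mathbb E\|\nabla_uf(u^t,\mathbf v^t)\|^2$, $\hat{\mathcal G}_{\mathbf v}^t=\frac{m}{n^2}\sum_{i=1}^n\mathbb E\|\nabla_vf_i(u^t,v_i^t)\|^2$, $F_0=f(u^0,\mathbf v^0)-\inf_{u,\mathbf v}f(u,\mathbf v)$. Assume $L>0$. *)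

(* Defs.v *)
From mathcomp Require Import all_boot all_order all_algebra.
From mathcomp Require Import all_classical all_reals all_analysis.

Set Implicit Arguments.
Unset Strict Implicit.
Unset Printing Implicit Defensive.

Import Order.TTheory GRing.Theory Num.Theory.
Import numFieldNormedType.Exports.

Local Open Scope classical_set_scope.
Local Open Scope ring_scope.

Section EuclideanCalculus.
Context {R : realType}.

(* The library norm on 'rV[R]_d is the maximum norm. *)
Definition enorm d (x : 'rV[R]_d) : R := Num.sqrt (\sum_(j < d) x 0 j ^+ 2).

Definition elipschitz d e (k : R) (g : 'rV[R]_d -> 'rV[R]_e) : Prop :=
  forall x y, enorm (g x - g y) <= k * enorm (x - y).

Definition grad d (g : 'rV[R]_d -> R) (x : 'rV[R]_d) : 'rV[R]_d :=
  \row_(j < d) 'D_(delta_mx 0 j) g x.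

Definition grad_u du dv (g : 'rV[R]_du -> 'rV[R]_dv -> R) u v : 'rV[R]_du :=
  grad (g^~ v) u.

Definition grad_v du dv (g : 'rV[R]_du -> 'rV[R]_dv -> R) u v : 'rV[R]_dv :=
  grad (g u) v.

Definition partially_differentiable du dv
    (g : 'rV[R]_du -> 'rV[R]_dv -> R) : Prop :=
  forall u v, differentiable (g^~ v) u /\ differentiable (g u) v.

End EuclideanCalculus.

Section Independence.
Context {R : realType} {d : measure_display} {Omega : measurableType d}.
Variable P : probability Omega R.

Definition mutually_independent (I : finType) (G : I -> set_system Omega) :
    Prop :=
  forall (J : {set I}) (E : I -> set Omega),
    (forall i, i \in J -> G i (E i)) ->
    P (\bigcap_(i in [set` J]) E i) = (\prod_(i in J) P (E i))%E.

End Independence.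

Section Objective.
Context {R : realType} {dX : measure_display} {X : measurableType dX}.
Context {du dv n : nat}.
Variables (D : 'I_n -> probability X R) (F : X -> 'rV[R]_du -> 'rV[R]_dv -> R).

Definition client_loss (i : 'I_n) (u : 'rV[R]_du) (v : 'rV[R]_dv) : R :=
  fine 'E_(D i)[fun x => F x u v].

Definition loss (u : 'rV[R]_du) (v : 'I_n -> 'rV[R]_dv) : R :=
  n%:R^-1 * \sum_(i < n) client_loss i u (v i).

(* The value is +oo when the loss is not bounded below. *)
Definition initial_gap (u : 'rV[R]_du) (v : 'I_n -> 'rV[R]_dv) : \bar R :=
  ((loss u v)%:E - ereal_inf (range (fun p => (loss p.1 p.2)%:E)))%E.

End Objective.

Section ScaffoldP.
Context {R : realType} {X : Type} {du dv n : nat}.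

Record scaffold_state := ScaffoldState {
  shared : 'rV[R]_du;
  personal : 'I_n -> 'rV[R]_dv;
  control : 'I_n -> 'rV[R]_du;
  mean_control : 'rV[R]_du }.

Variables (F : X -> 'rV[R]_du -> 'rV[R]_dv -> R) (m K : nat).
Variables gamma_u gamma_v eta_u eta_v : R.

(* The iterates (u_{i,k}^t, v_{i,k}^t) of client i, where xi k is the sample
   used in the local step k. *)
Fixpoint local_iterate (st : scaffold_state) (i : 'I_n) (xi : nat -> X)
    (k : nat) : 'rV[R]_du * 'rV[R]_dv :=
  if k is k'.+1 then
    let: (u, v) := local_iterate st i xi k' in
    (u - gamma_u *: (grad_u (F (xi k')) u v - control st i + mean_control st),
     v - gamma_v *: grad_v (F (xi k')) u v)
  else (shared st, personal st i).

Definition scaffold_round (st : scaffold_state) (xi : 'I_n -> nat -> X)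
    (S : {set 'I_n}) : scaffold_state :=
  let uK i := (local_iterate st i (xi i) K).1 in
  let vK i := (local_iterate st i (xi i) K).2 in
  let c' i :=
    if i \in S then
      control st i - mean_control st
        + (K%:R * gamma_u)^-1 *: (shared st - uK i)
    else control st i in
  {| shared :=
       (1 - eta_u) *: shared st + (eta_u / m%:R) *: \sum_(i in S) uK i;
     personal := fun i =>
       if i \in S then (1 - eta_v) *: personal st i + eta_v *: vK i
       else personal st i;
     control := c';
     mean_control :=
       mean_control st + n%:R^-1 *: \sum_(i in S) (c' i - control st i) |}.

Definition scaffold_init (u0 : 'rV[R]_du) (v0 : 'I_n -> 'rV[R]_dv)
    (xi : 'I_n -> nat -> X) : scaffold_state :=
  let c0 i := K%:R^-1 *: \sum_(k < K) grad_u (F (xi i k)) u0 (v0 i) in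
  {| shared := u0;
     personal := v0;
     control := c0;
     mean_control := n%:R^-1 *: \sum_(i < n) c0 i |}.

(* Sampling times are shifted by one: xi 0 i k is the initialization sample
   xi_{i,k}^{-1}, and xi t.+1 i k is the sample xi_{i,k}^t of round t. *)
Fixpoint scaffold_run (u0 : 'rV[R]_du) (v0 : 'I_n -> 'rV[R]_dv)
    (xi : nat -> 'I_n -> nat -> X) (S : nat -> {set 'I_n}) (t : nat) :
    scaffold_state :=
  if t is t'.+1 then
    scaffold_round (scaffold_run u0 v0 xi S t') (xi t'.+1) (S t')
  else scaffold_init u0 v0 (xi 0%N).

End ScaffoldP.

Section Draws.
Context {R : realType} {d dX : measure_display}.
Context {Omega : measurableType d} {X : measurableType dX} {n : nat}.
Variable P : probability Omega R.

Definition uniform_subset (m : nat) (S : Omega -> {set 'I_n}) : Prop :=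
  forall A : {set 'I_n}, measurable (S @^-1` [set A]) /\
    P (S @^-1` [set A]) = (if #|A| == m then ('C(n, m)%:R^-1)%:E else 0)%E.

(* The sigma-algebras generated by the random inputs of a run of T rounds with
   K local steps: all the samples and all the client subsets, times of samples
   being shifted as in scaffold_run. *)
Definition draw_events (T K : nat) (xi : nat -> 'I_n -> nat -> {RV P >-> X})
    (S : nat -> Omega -> {set 'I_n})
    (j : ('I_T.+1 * 'I_n * 'I_K) + 'I_T) : set_system Omega :=
  match j with
  | inl (s, i, k) => preimage_set_system setT (xi s i k) measurable
  | inr t => preimage_set_system setT (S t) setT
  end.

End Draws.

(* Main.v *)
(* The argument follows the Lyapunov function
     f(u, v) + a * mean_i |u - alpha_i|^2 + b * mean_i |c'_i - grad_u f_i(alpha_i, v_i)|^2,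
   where alpha_i is the shared variable at client i's last participation and c'_i is
   its control variate with every stochastic gradient replaced by the true one, for
   a = 160 L^3 s^2 n/m^2, b = 20 L s^2 n/m^2 and s = gamma K.
   Conditionally on the gradient samples, the average over a uniform subset of
   size m is a finite computation (variance of sampling without replacement), so one
   round reduces to a deterministic inequality between finite means. The
   rate m/n^(2/3) comes from |u - alpha_i|^2: its cross term is expanded with the
   averaged step -s * mean_{i,k} grad_u f_i rather than bounded by |u^+ - u|,
   which keeps the sampling variance out of the term multiplied by n/m.
   The samples are integrated out one at a time: each draw is independent of the
   sigma-algebra generated by all the others, with respect to which the iterates it
   does not influence are measurable, since the gradients are limits of difference
   quotients, hence jointly measurable (Caratheodory). *)

Require Import Defs.
From HB Require Import structures.
From mathcomp Require Import all_boot all_order all_algebra.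
From mathcomp Require Import all_classical all_reals all_analysis.
From mathcomp Require Import measurable_realfun ring lra.

Set Implicit Arguments.
Unset Strict Implicit.
Unset Printing Implicit Defensive.

Import Order.TTheory GRing.Theory Num.Theory.
Import numFieldNormedType.Exports.

Local Open Scope ring_scope.

(** * Euclidean inner product and squared norm on row vectors *)

Section Euclid.
Context {R : realFieldType}.
Implicit Types d : nat.

(** Local runs are defined for every client, selected or not, so the local iterates of a round do
    not depend on the subset drawn in it; hence subsets can be averaged with all gradient samples
    fixed. The round inequality is pathwise: the gradient noise is carried along as six squared
    terms and three inner products, and expectations come afterwards. The inner products pair noise
    with quantities known before the round, so they vanish in mean. A control variate may be
    arbitrarily old. Its distance to c'_i has second moment at most sigma_u^2 / K at every time. As
    v_i changes only when client i takes part, the staleness mean_i |grad_u f_i(u, v_i) - c'_i|^2 is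
    at most 4 L^2 X + 2 Y, where X and Y are the two penalty means. The coefficients a and b are
    those for which the decrease of a X + b Y pays exactly 10 L s^2 / m times this bound: a / 4 = 10
    L s^2 (n/m^2) * 4 L^2 and b = 10 L s^2 (n/m^2) * 2. Both penalties vanish at the start, so the
    initial value is f(u^0, v^0). The constant 148 is 4 * 37, where 37 bounds the noise coefficients
    of one round. *)

Definition edot d (x y : 'rV[R]_d) : R := \sum_(j < d) x 0 j * y 0 j.
Definition sqn d (x : 'rV[R]_d) : R := edot x x.

Lemma edotC d (x y : 'rV[R]_d) : edot x y = edot y x.
Proof. by apply: eq_bigr => j _; rewrite mulrC. Qed.

Lemma edotDl d (x y z : 'rV[R]_d) : edot (x + y) z = edot x z + edot y z.
Proof. by rewrite -big_split; apply: eq_bigr => j _; rewrite mxE mulrDl. Qed.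

Lemma edotZl d a (x z : 'rV[R]_d) : edot (a *: x) z = a * edot x z.
Proof. by rewrite mulr_sumr; apply: eq_bigr => j _; rewrite mxE mulrA. Qed.

Lemma edotNl d (x z : 'rV[R]_d) : edot (- x) z = - edot x z.
Proof. by rewrite -scaleN1r edotZl mulN1r. Qed.

Lemma edotDr d (x y z : 'rV[R]_d) : edot z (x + y) = edot z x + edot z y.
Proof. by rewrite edotC edotDl !(edotC z). Qed.

Lemma edotZr d a (x z : 'rV[R]_d) : edot z (a *: x) = a * edot z x.
Proof. by rewrite edotC edotZl (edotC z). Qed.

Lemma edotNr d (x z : 'rV[R]_d) : edot z (- x) = - edot z x.
Proof. by rewrite edotC edotNl (edotC z). Qed.

Lemma edot0l d (z : 'rV[R]_d) : edot 0 z = 0.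
Proof. by rewrite -(scale0r 0) edotZl mul0r. Qed.

Lemma edot_suml d (I : Type) (r : seq I) (Q : pred I) (x : I -> 'rV[R]_d) z :
  edot (\sum_(i <- r | Q i) x i) z = \sum_(i <- r | Q i) edot (x i) z.
Proof.
by elim/big_rec2: _ => [|i y1 y2 _ <-]; rewrite ?edot0l // edotDl.
Qed.

Lemma edot_sumr d (I : Type) (r : seq I) (Q : pred I) (x : I -> 'rV[R]_d) z :
  edot z (\sum_(i <- r | Q i) x i) = \sum_(i <- r | Q i) edot z (x i).
Proof. by rewrite edotC edot_suml; apply: eq_bigr => i _; rewrite edotC. Qed.

Definition edotE := (edotDl, edotDr, edotNl, edotNr, edotZl, edotZr).

Lemma sqn_ge0 d (x : 'rV[R]_d) : 0 <= sqn x.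
Proof. by apply: sumr_ge0 => j _; rewrite -expr2 sqr_ge0. Qed.

Lemma sqn0 d : sqn (0 : 'rV[R]_d) = 0. Proof. exact: edot0l. Qed.

Lemma sqnZ d a (x : 'rV[R]_d) : sqn (a *: x) = a ^+ 2 * sqn x.
Proof. by rewrite /sqn edotZl edotZr mulrA. Qed.

Lemma sqnN d (x : 'rV[R]_d) : sqn (- x) = sqn x.
Proof. by rewrite /sqn edotNl edotNr opprK. Qed.

Lemma sqnD d (x y : 'rV[R]_d) : sqn (x + y) = sqn x + 2 * edot x y + sqn y.
Proof. rewrite /sqn !edotE (edotC y x); ring. Qed.

Lemma sqnB d (x y : 'rV[R]_d) : sqn (x - y) = sqn x - 2 * edot x y + sqn y.
Proof. by rewrite sqnD sqnN edotNr mulrN. Qed.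

Lemma sqnBC d (x y : 'rV[R]_d) : sqn (x - y) = sqn (y - x).
Proof. by rewrite -sqnN opprB. Qed.

Lemma edot_young d r (x y : 'rV[R]_d) : 0 < r ->
  2 * edot x y <= r * sqn x + r^-1 * sqn y.
Proof.
move=> r0; have := sqn_ge0 (r *: x - y).
rewrite sqnB sqnZ edotZl => h.
have {}h := mulr_ge0 (ltW (eq_ind_r (fun z => 0 < z) r0 (invrK r))) (sqn_ge0 (x - r^-1 *: y)).
move: h; rewrite invrK sqnB sqnZ edotZr => h.
have e : r * (r^-1 ^+ 2 * sqn y) = r^-1 * sqn y.
  by rewrite expr2 !mulrA divff ?mul1r // gt_eqF.
move: h; rewrite !mulrDr e mulrN (mulrCA r 2) (mulrA r r^-1) divff ?gt_eqF //.
by rewrite mul1r; lra.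
Qed.

(** Cauchy-Schwarz, from the identity sum_{i,j} |x_i - x_j|^2 = 2 (#|I| sum_i |x_i|^2 - |sum_i
    x_i|^2), whose left side is nonnegative. *)
Lemma sqn_sum d (I : finType) (x : I -> 'rV[R]_d) :
  sqn (\sum_i x i) <= #|I|%:R * \sum_i sqn (x i).
Proof.
have : 0 <= \sum_i \sum_j sqn (x i - x j).
  by apply: sumr_ge0 => i _; apply: sumr_ge0 => j _; exact: sqn_ge0.
have c (v : R) : \sum_(i : I) v = #|I|%:R * v by rewrite sumr_const mulr_natl.
have -> : \sum_i \sum_j sqn (x i - x j)
    = 2 * (#|I|%:R * \sum_i sqn (x i) - sqn (\sum_i x i)).
  under eq_bigr => i _.
    under eq_bigr do rewrite sqnB.
    rewrite big_split /= sumrB c -mulr_sumr -edot_sumr.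
    over.
  rewrite big_split /= sumrB -!mulr_sumr -edot_suml c -/(sqn _); ring.
by lra.
Qed.

Lemma sqnD_le d (x y : 'rV[R]_d) : sqn (x + y) <= 2 * (sqn x + sqn y).
Proof. by have := sqn_ge0 (x - y); rewrite sqnB sqnD; lra. Qed.

Lemma sqnD3_le d (x y z : 'rV[R]_d) :
  sqn (x + y + z) <= 3 * (sqn x + sqn y + sqn z).
Proof.
have := sqn_sum (fun i : 'I_3 => nth 0 [:: x; y; z] i).
by rewrite card_ord !big_ord_recl !big_ord0 /= !addr0 !addrA.
Qed.

Lemma sqnD4_le d (x y z t : 'rV[R]_d) :
  sqn (x + y + z + t) <= 4 * (sqn x + sqn y + sqn z + sqn t).
Proof.
have := sqn_sum (fun i : 'I_4 => nth 0 [:: x; y; z; t] i).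
by rewrite card_ord !big_ord_recl !big_ord0 /= !addr0 !addrA.
Qed.

Lemma sqnD5_le d (x y z t s : 'rV[R]_d) :
  sqn (x + y + z + t + s) <= 5 * (sqn x + sqn y + sqn z + sqn t + sqn s).
Proof.
have := sqn_sum (fun i : 'I_5 => nth 0 [:: x; y; z; t; s] i).
by rewrite card_ord !big_ord_recl !big_ord0 /= !addr0 !addrA.
Qed.

End Euclid.

(** * Finite means of scalars and of vectors *)

Section Means.
Context {R : realFieldType}.

Definition mean n (x : 'I_n -> R) : R := n%:R^-1 * \sum_i x i.
Definition vmean n d (x : 'I_n -> 'rV[R]_d) : 'rV[R]_d := n%:R^-1 *: \sum_i x i.

Lemma mean_ge0 n (x : 'I_n -> R) : (forall i, 0 <= x i) -> 0 <= mean x.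
Proof. by move=> x0; rewrite mulr_ge0 ?invr_ge0 // sumr_ge0. Qed.

Lemma ler_mean n (x y : 'I_n -> R) : (forall i, x i <= y i) -> mean x <= mean y.
Proof. by move=> xy; rewrite ler_wpM2l ?invr_ge0 // ler_sum. Qed.

Lemma eq_mean n (x y : 'I_n -> R) : x =1 y -> mean x = mean y.
Proof. by move=> xy; congr (_ * _); apply: eq_bigr. Qed.

Lemma meanD n (x y : 'I_n -> R) : mean (fun i => x i + y i) = mean x + mean y.
Proof. by rewrite /mean big_split mulrDr. Qed.

Lemma meanN n (x : 'I_n -> R) : mean (fun i => - x i) = - mean x.
Proof. by rewrite /mean sumrN mulrN. Qed.

Lemma meanB n (x y : 'I_n -> R) : mean (fun i => x i - y i) = mean x - mean y.
Proof. by rewrite meanD meanN. Qed.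

Lemma meanZ n a (x : 'I_n -> R) : mean (fun i => a * x i) = a * mean x.
Proof. by rewrite /mean -mulr_sumr mulrCA. Qed.

Lemma mean_cst n (v : R) : (0 < n)%N -> mean (fun _ : 'I_n => v) = v.
Proof.
move=> n0; rewrite /mean sumr_const card_ord -(mulr_natl v) mulrA mulVf ?mul1r //.
by rewrite pnatr_eq0 -lt0n.
Qed.

Lemma sum_mean n (x : 'I_n -> R) : (0 < n)%N -> \sum_i x i = n%:R * mean x.
Proof. by move=> n0; rewrite mulrA divff ?mul1r // pnatr_eq0 -lt0n. Qed.

Lemma eq_vmean n d (x y : 'I_n -> 'rV[R]_d) : x =1 y -> vmean x = vmean y.
Proof. by move=> xy; congr (_ *: _); apply: eq_bigr. Qed.

Lemma vmeanD n d (x y : 'I_n -> 'rV[R]_d) :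
  vmean (fun i => x i + y i) = vmean x + vmean y.
Proof. by rewrite /vmean big_split scalerDr. Qed.

Lemma vmeanN n d (x : 'I_n -> 'rV[R]_d) : vmean (fun i => - x i) = - vmean x.
Proof. by rewrite /vmean sumrN scalerN. Qed.

Lemma vmeanB n d (x y : 'I_n -> 'rV[R]_d) :
  vmean (fun i => x i - y i) = vmean x - vmean y.
Proof. by rewrite vmeanD vmeanN. Qed.

Lemma vmean_cst n d (v : 'rV[R]_d) : (0 < n)%N -> vmean (fun _ : 'I_n => v) = v.
Proof.
move=> n0; rewrite /vmean sumr_const card_ord -(scaler_nat n v) scalerA mulVf ?scale1r //.
by rewrite pnatr_eq0 -lt0n.
Qed.

Lemma sum_vmean n d (x : 'I_n -> 'rV[R]_d) : (0 < n)%N ->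
  \sum_i x i = n%:R *: vmean x.
Proof. by move=> n0; rewrite /vmean scalerA divff ?scale1r // pnatr_eq0 -lt0n. Qed.

Lemma edot_vmeanl n d (x : 'I_n -> 'rV[R]_d) z :
  edot (vmean x) z = mean (fun i => edot (x i) z).
Proof. by rewrite edotZl edot_suml. Qed.

Lemma edot_vmeanr n d (x : 'I_n -> 'rV[R]_d) z :
  edot z (vmean x) = mean (fun i => edot z (x i)).
Proof. by rewrite edotZr edot_sumr. Qed.

Lemma sqn_vmean n d (x : 'I_n -> 'rV[R]_d) : (0 < n)%N ->
  sqn (vmean x) <= mean (fun i => sqn (x i)).
Proof.
move=> n0; rewrite sqnZ /mean expr2 -mulrA.
rewrite ler_wpM2l ?invr_ge0 // ler_pdivrMl ?ltr0n //.
by rewrite -[X in X%:R](card_ord n); exact: sqn_sum.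
Qed.

Lemma sqn_vmean_center n d (x : 'I_n -> 'rV[R]_d) : (0 < n)%N ->
  mean (fun i => sqn (x i - vmean x)) = mean (fun i => sqn (x i)) - sqn (vmean x).
Proof.
move=> n0.
rewrite (eq_mean (y := fun i => sqn (x i) - 2 * edot (x i) (vmean x) + sqn (vmean x))).
  by rewrite meanD meanB meanZ -edot_vmeanl mean_cst // -/(sqn _); ring.
by move=> i; rewrite sqnB.
Qed.

Lemma sqn_vmean_center_le n d (x : 'I_n -> 'rV[R]_d) : (0 < n)%N ->
  mean (fun i => sqn (x i - vmean x)) <= mean (fun i => sqn (x i)).
Proof. by move=> n0; rewrite sqn_vmean_center // lerBlDr lerDl sqn_ge0. Qed.

End Means.

(** * Averages over the m-element subsets of clients: sampling without replacement *)

Section Sampling.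
Context {R : realFieldType} (n m : nat).
Hypothesis mn : (1 <= m <= n)%N.

Definition avg (Phi : {set 'I_n} -> R) : R :=
  'C(n, m)%:R^-1 * \sum_(A : {set 'I_n} | #|A| == m) Phi A.

Let n_gt0 : (0 < n)%N. Proof. by case/andP: mn => /leq_trans; apply. Qed.
Let bin0 : 'C(n, m)%:R != 0 :> R.
Proof. by rewrite pnatr_eq0 -lt0n bin_gt0; case/andP: mn. Qed.

Lemma avg_le Phi Psi : (forall A : {set 'I_n}, #|A| == m -> Phi A <= Psi A) -> avg Phi <= avg Psi.
Proof. by move=> h; rewrite ler_wpM2l ?invr_ge0 ?ler0n //; apply: ler_sum => A /h. Qed.

Lemma eq_avg Phi Psi : (forall A : {set 'I_n}, #|A| == m -> Phi A = Psi A) -> avg Phi = avg Psi.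
Proof. by move=> h; congr (_ * _); apply: eq_bigr => A /h. Qed.

Lemma avgD Phi Psi : avg (fun A => Phi A + Psi A) = avg Phi + avg Psi.
Proof. by rewrite /avg big_split mulrDr. Qed.

Lemma avgN Phi : avg (fun A => - Phi A) = - avg Phi.
Proof. by rewrite /avg sumrN mulrN. Qed.

Lemma avgB Phi Psi : avg (fun A => Phi A - Psi A) = avg Phi - avg Psi.
Proof. by rewrite avgD avgN. Qed.

Lemma avgZ a Phi : avg (fun A => a * Phi A) = a * avg Phi.
Proof. by rewrite /avg -mulr_sumr mulrCA. Qed.

Lemma avg_summ (I : finType) (Phi : I -> {set 'I_n} -> R) :
  avg (fun A => \sum_i Phi i A) = \sum_i avg (Phi i).
Proof. by rewrite /avg exchange_big mulr_sumr. Qed.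

Lemma avg_cst a : avg (fun=> a) = a.
Proof.
rewrite /avg sumr_const.
have -> : #|[pred A : {set 'I_n} | #|A| == m]| = 'C(n, m).
  by rewrite -[n in RHS](card_ord n) -card_draws cardsE.
by rewrite -(mulr_natl a) mulrA mulVf ?mul1r.
Qed.

Lemma avg_ge0 Phi : (forall A : {set 'I_n}, #|A| == m -> 0 <= Phi A) -> 0 <= avg Phi.
Proof. by move=> h; rewrite mulr_ge0 ?invr_ge0 ?ler0n //; apply: sumr_ge0 => A /h. Qed.

Lemma avg_subset (B : {set 'I_n}) :
  avg (fun A => (A \subset B)%:R) = 'C(#|B|, m)%:R / 'C(n, m)%:R.
Proof.
rewrite /avg mulrC; congr (_ * _); rewrite -natr_sum; congr _%:R.
rewrite -cards_draws cardsE -sum1_card big_mkcond [RHS]big_mkcond /=.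
apply: eq_bigr => A _; rewrite unfold_in /= andbC.
by case: (#|A| == m); case: (A \subset B).
Qed.

(** Inclusion probabilities of one client and of two distinct clients, obtained by
    inclusion-exclusion from the subsets that avoid them. For [pick2] the sign suffices later, and
    it is read off from [avg_in2]. *)
Definition pick1 : R := 1 - 'C(n.-1, m)%:R / 'C(n, m)%:R.
Definition pick2 : R := pick1 - ('C(n.-1, m)%:R - 'C(n.-2, m)%:R) / 'C(n, m)%:R.

Let in_subset (i : 'I_n) (A : {set 'I_n}) :
  (i \in A)%:R = 1 - (A \subset [set~ i])%:R :> R.
Proof.
by rewrite finset.subsetC finset.sub1set inE; case: (i \in A); rewrite /= ?subrr ?subr0.
Qed.

Lemma avg_in i : avg (fun A => (i \in A)%:R) = pick1.
Proof.
rewrite (@eq_avg _ (fun A : {set 'I_n} => 1 - (A \subset [set~ i])%:R)) => [|A _].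
  by rewrite avgB avg_cst avg_subset cardsC1 card_ord.
exact: in_subset.
Qed.

Lemma avg_in2 i j : i != j ->
  avg (fun A => (i \in A)%:R * (j \in A)%:R) = pick2.
Proof.
move=> ij; rewrite (@eq_avg _ (fun A : {set 'I_n} => 1 - (A \subset [set~ i])%:R
    - (A \subset [set~ j])%:R + (A \subset ~: [set i; j])%:R)) => [|A _].
  rewrite avgD !avgB avg_cst !avg_subset !cardsC1 card_ord.
  have -> : #|~: [set i; j]| = n.-2.
    have := cardsC [set i; j]; rewrite cards2 ij card_ord => h.
    by rewrite -[RHS](congr1 (fun k => k.-2) h).
  by rewrite /pick2 /pick1; ring.
rewrite !in_subset finset.setCU finset.subsetI.
by case: (A \subset _); case: (A \subset _); rewrite /=; ring.
Qed.

(** Double counting: by symmetry the memberships of the n clients sum to n times [pick1] on average,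
    and they always sum to m. *)
Lemma pick1E : pick1 = m%:R / n%:R.
Proof.
have n0 : n%:R != 0 :> R by rewrite pnatr_eq0 -lt0n.
apply: (mulIf n0); rewrite divfK //.
transitivity (avg (fun A => \sum_(i : 'I_n) (i \in A)%:R)).
  rewrite avg_summ (eq_bigr (fun=> pick1)) => [|i _]; last exact: avg_in.
  by rewrite sumr_const card_ord mulr_natr.
rewrite -[RHS]avg_cst; apply: eq_avg => A /eqP <-.
by rewrite -natr_sum -sum1_card [in RHS]big_mkcond; congr _%:R; apply: eq_bigr => i _; case: (i \in A).
Qed.

Lemma avg_sum (x : 'I_n -> R) : avg (fun A => \sum_(i in A) x i) = m%:R * mean x.
Proof.
rewrite (@eq_avg _ (fun A : {set 'I_n} => \sum_i x i * (i \in A)%:R)) => [|A _].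
  rewrite avg_summ /mean mulrA -pick1E mulr_sumr; apply: eq_bigr => i _.
  by rewrite avgZ avg_in mulrC.
rewrite big_mkcond; apply: eq_bigr => i _.
by case: ifP; rewrite ?mulr1 ?mulr0.
Qed.

(** After expanding the square, the off-diagonal inner products all carry the weight [pick2], and
    since the x_i sum to 0 they contribute -[pick2] |x_i|^2 for each i. The exact value is ([pick1]
    - [pick2]) sum_i |x_i|^2, and [pick2] is nonnegative. *)
Lemma avg_sqn_sum d (x : 'I_n -> 'rV[R]_d) : \sum_i x i = 0 ->
  avg (fun A => sqn (\sum_(i in A) x i)) <= m%:R * mean (fun i => sqn (x i)).
Proof.
move=> x0.
have e A : \sum_(i in A) x i = \sum_i (i \in A)%:R *: x i.
  rewrite big_mkcond; apply: eq_bigr => i _.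
  by case: ifP; rewrite ?scale1r ?scale0r.
rewrite (@eq_avg _ (fun A : {set 'I_n} => \sum_i \sum_j
    edot (x i) (x j) * ((i \in A)%:R * (j \in A)%:R))) => [|A _]; last first.
  rewrite e /sqn edot_suml; apply: eq_bigr => i _.
  rewrite edot_sumr; apply: eq_bigr => j _; rewrite edotZl edotZr; ring.
rewrite avg_summ.
have h i : avg (fun A => \sum_j edot (x i) (x j) * ((i \in A)%:R * (j \in A)%:R))
    = (pick1 - pick2) * sqn (x i) + pick2 * edot (x i) (\sum_j x j).
  rewrite avg_summ edot_sumr.
  rewrite (bigD1 i) //= [in RHS](bigD1 i) //= mulrDr.
  rewrite avgZ (@eq_avg _ (fun A : {set 'I_n} => (i \in A)%:R)) => [|A _]; last first.
    by case: (i \in A); rewrite ?mulr1 ?mulr0.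
  rewrite avg_in addrA -/(sqn _); congr (_ + _); first by ring.
  by rewrite mulr_sumr; apply: eq_bigr => j ji; rewrite avgZ avg_in2 1?eq_sym // mulrC.
under eq_bigr do rewrite h x0 edotC edot0l mulr0 addr0.
(* Two distinct indices are needed to see [pick2] as an average; with a single client, its vector
   equals the total sum 0. *)
case: (boolP [exists i : 'I_n, exists j : 'I_n, i != j]) => [|/existsPn h1].
  move=> /existsP[i /existsP[j ij]].
  rewrite -mulr_sumr /mean mulrA -pick1E ler_wpM2r ?sumr_ge0 // => [k _|].
    exact: sqn_ge0.
  rewrite lerBlDr lerDl -(avg_in2 ij); apply: avg_ge0 => A _.
  by rewrite mulr_ge0.
have xi0 i : x i = 0.
  rewrite -x0 (bigD1 i) //= big1 ?addr0 // => j; rewrite eq_sym.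
  by have /existsPn/(_ j)/negbTE-> := h1 i.
rewrite big1 => [|i _]; last by rewrite xi0 sqn0 mulr0.
by rewrite mulr_ge0 // mean_ge0 // => i; exact: sqn_ge0.
Qed.

End Sampling.

(** * The one-round inequality in scalar form *)

(* Instantiated with q = n / m^2, r = m / n and ri = n / m. *)
Lemma round_arith (R : realFieldType) (L s g q r ri : R)
    (f f' X X' b b' D E G Gv A B H dU N1 N2 N3 N4 N5 N6 M1 M2 M3 GA GB XA : R) :
  let al := 160 * L ^+ 3 * s ^+ 2 * q in
  let be := 20 * L * s ^+ 2 * q in
  0 < L -> 0 < s -> 0 < g -> 0 < q -> 0 < r -> 0 < ri -> r <= 1 -> q * r <= 1 ->
  72 * (L * s) <= 1 -> (72 * (L * s)) ^+ 2 * q <= 1 ->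
  (72 * (L * s)) ^+ 3 * (q * ri) <= 1 ->
  0 <= X -> 0 <= b -> 0 <= D -> 0 <= E -> 0 <= G -> 0 <= Gv -> 0 <= A ->
  0 <= B -> 0 <= N1 -> 0 <= N2 -> 0 <= N3 -> 0 <= N4 -> 0 <= N5 -> 0 <= N6 ->
  f' <= f - s * (GA + M1) - s * r * (GB + M2) + 2 * L * dU + 2 * L * s ^+ 2 * r * H ->
  H <= 2 * (B + N5) ->
  G + A - 2 * GA <= 2 * L ^+ 2 * D ->
  Gv + B - 2 * GB <= 2 * L ^+ 2 * D ->
  dU <= s ^+ 2 * (2 * (A + N1) + q * r * (4 * (2 * L ^+ 2 * D + E + N2 + N3))) ->
  X' <= (1 - r / 2) * X + 3 * dU - 2 * s * (XA + M3) ->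
  - 2 * s * XA <= r / 4 * X + 4 * ri * s ^+ 2 * A ->
  b' <= (1 - r) * b + r * (4 * L ^+ 2 * D + 4 * L ^+ 2 * s ^+ 2 * H) ->
  E <= 4 * L ^+ 2 * X + 2 * b ->
  D <= 5 * (q * r) * (2 * (L * s) ^+ 2 * D + g ^+ 2 * N4 + s ^+ 2 * (E + G + N3))
       + 3 * r * (s ^+ 2 * Gv + 2 * (L * s) ^+ 2 * D + g ^+ 2 * N6) ->
  f' + al * X' + be * b' <= f + al * X + be * b - s / 4 * (G + r * Gv)
    - s * M1 - s * r * M2 - 2 * al * s * M3
    + 5 * L * s ^+ 2 * N1 + 9 * L * s ^+ 2 * (q * r) * (N2 + N3)
    + L * g ^+ 2 * (q * r) * N4
    + r * (5 * L * s ^+ 2 * N5 + L * g ^+ 2 * N6).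
Proof.
move=> al be L0 s0 g0 q0 r0 ri0 r1 qr1 h1 h2 h3 X0 b0 D0 E0 G0 Gv0 A0 B0.
move=> N10 N20 N30 N40 N50 N60 hf hH hGA hGB hdU hX hXA hb hE hD.
have p0 : 0 < q * r by rewrite mulr_gt0.
have al0 : 0 <= al by rewrite !mulr_ge0 // ltW // exprn_gt0.
have be0 : 0 <= be by rewrite !mulr_ge0 // ltW // exprn_gt0.
have l0 : 0 < L * s by rewrite mulr_gt0.
(* Here 3 * 160 / 72^2 < 1/10, so the displacement [dU], with weight 2 L from smoothness and 3 [al]
   from the anchor penalty, costs at most 21/10 L. *)
have hal : 3 * al <= L / 10.
  have := ler_wpM2l (ltW L0) h2; rewrite /al; clear -L0; lra.
pose W := A + N1 + q * r * (2 * (2 * L ^+ 2 * D + E + N2 + N3)).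
have W0 : 0 <= W.
  rewrite /W !addr_ge0 //; apply: mulr_ge0; first exact: ltW.
  by have := mulr_ge0 (sqr_ge0 L) D0; clear -E0 N20 N30; lra.
have hdU' : (2 * L + 3 * al) * dU <= (21/10 * L) * (2 * s ^+ 2 * W).
  have e1 : dU <= 2 * s ^+ 2 * W by rewrite /W; clear -hdU N20 N30 N10 A0 hdU; lra.
  apply: (le_trans (y := (2 * L + 3 * al) * (2 * s ^+ 2 * W))).
    by rewrite ler_wpM2l // addr_ge0 ?mulr_ge0 // ltW.
  apply: ler_wpM2r; last by clear -hal; lra.
  by rewrite mulr_ge0 // mulr_ge0 ?sqr_ge0.
have hl Y : 0 <= Y -> 72 * ((L * s) * Y) <= Y.
  by move=> Y0; rewrite mulrA; exact: ler_piMl.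
have l2 : 1000 * (L * s) ^+ 2 <= 1.
  clear -h1 l0; have := ler_wpM2r (ltW l0) h1; have := sqr_ge0 (L * s); lra.
have hl2 Y : 0 <= Y -> 1000 * ((L * s) ^+ 2 * Y) <= Y.
  by move=> Y0; rewrite mulrA; exact: ler_piMl.
have hr Y : 0 <= Y -> r * Y <= Y by move=> Y0; exact: ler_piMl.
have hp Y : 0 <= Y -> q * r * Y <= Y by move=> Y0; exact: ler_piMl.
(* The drift occurs on both sides of [hD]; its total coefficient on the right is at most 16 (L s)^2
   <= 16/1000, and 1 / (1 - 16/1000) < 51/50. *)
have hD1 : D <= 51/50 * (5 * (q * r) * (g ^+ 2 * N4 + s ^+ 2 * (E + G + N3))
       + 3 * r * (s ^+ 2 * Gv + g ^+ 2 * N6)).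
  have a0 : 0 <= (L * s) ^+ 2 * D by rewrite mulr_ge0 ?sqr_ge0.
  have := hl2 _ D0; have := hr _ a0; have := hp _ a0; clear -hD D0; lra.
have sL0 : 0 <= s * L ^+ 2 by rewrite mulr_ge0 ?sqr_ge0 // ltW.
have SD0 : 0 <= s * L ^+ 2 * D by rewrite mulr_ge0.
have t1 := hl _ SD0.
have t2 := hp _ SD0.
have t3 := hr _ SD0.
have t4 := hl _ (mulr_ge0 (ltW p0) SD0).
have sL20 Y : 0 <= Y -> 0 <= L * s ^+ 2 * Y.
  by move=> Y0; rewrite !mulr_ge0 ?sqr_ge0 // ltW.
have Lp0 Y : 0 <= Y -> 0 <= q * r * Y by move=> Y0; rewrite mulr_ge0 // ltW.
have rp0 Y : 0 <= Y -> 0 <= r * Y by move=> Y0; rewrite mulr_ge0 // ltW.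
have gp0 Y : 0 <= Y -> 0 <= L * g ^+ 2 * Y.
  by move=> Y0; rewrite !mulr_ge0 ?sqr_ge0 // ltW.
have s0Y Y : 0 <= Y -> 0 <= s * Y by move=> Y0; rewrite mulr_ge0 // ltW.
(* All occurrences of the drift are collected here, so that it has to be eliminated only once,
   through [hD1]. *)
have Dtot : s * (2 * L ^+ 2 * D) / 2 + s * r * (2 * L ^+ 2 * D) / 2
    + (21/10 * L) * (2 * s ^+ 2 * (q * r * (2 * (2 * L ^+ 2 * D))))
    + be * (r * (4 * L ^+ 2 * D)) <= 4 * (s * L ^+ 2 * D).
  by rewrite /be; clear -t1 t2 t3 t4 SD0; lra.
have Dfin := ler_wpM2l sL0 hD1.
have E0' := sL20 _ (Lp0 _ E0).
have N30' := sL20 _ (Lp0 _ N30).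
have N20' := sL20 _ (Lp0 _ N20).
have N50' := sL20 _ (rp0 _ N50).
have N10' := sL20 _ N10.
have N60' := gp0 _ (rp0 _ N60).
have N40' := gp0 _ (Lp0 _ N40).
have B0' := s0Y _ (rp0 _ B0).
have A0' := s0Y _ A0.
have G0' := s0Y _ G0.
have Gv0' := s0Y _ (rp0 _ Gv0).
have e1 := hl _ (sL20 _ (Lp0 _ E0)).
have e2 := hl _ (sL20 _ (Lp0 _ N30)).
have e3 := hl _ (gp0 _ (Lp0 _ N40)).
have e4 := hl _ (gp0 _ (rp0 _ N60)).
have e5 := hl2 _ (s0Y _ (Lp0 _ G0)).
have e5' := hp _ (s0Y _ G0).
have e6 := hl2 _ (s0Y _ (rp0 _ Gv0)).
have Dfin' : 4 * (s * L ^+ 2 * D) <=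
   2/3 * (L * s ^+ 2 * (q * r) * E) + 1/3 * (L * s ^+ 2 * (q * r) * N3)
   + 2/3 * (L * g ^+ 2 * (q * r) * N4) + 2/3 * (L * g ^+ 2 * (r * N6))
   + 1/4 * (s * G) + 1/4 * (s * (r * Gv)).
  by clear -Dfin e1 e2 e3 e4 e5 e5' e6 E0' N30' N40' N60' G0' Gv0'; lra.
(* This is where the cubic step condition enters: the left side is 640 (L s)^3 (q ri) s A with q ri
   = n^2/m^3, which is what dictates n^(2/3). *)
have xA : al * (4 * ri * s ^+ 2 * A) <= s * A / 100.
  have := ler_wpM2r (s0Y _ A0) h3; have := s0Y _ A0; rewrite /al; clear; lra.
have a1 := hl _ (s0Y _ A0).
have b1 := hl _ (s0Y _ (rp0 _ B0)).
have b2 : be * (r * (4 * L ^+ 2 * s ^+ 2 * (2 * (B + N5)))) <=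
   s * r * B / 10 + L * s ^+ 2 * (r * N5) / 10.
  have := ler_wpM2r (sL20 _ (rp0 _ N50)) h2.
  have := ler_wpM2r (mulr_ge0 (ltW l0) (s0Y _ (rp0 _ B0))) h2.
  have := sL20 _ (rp0 _ N50); rewrite /be; have := s0Y _ (rp0 _ B0); clear -b1; lra.
(* The balance that fixes 160 and 20: after inserting [hE] both sides coincide. The staleness [E]
   has coefficient 42/5 from [dU] and 2/3 from the drift, which is below 10. *)
have eE : L * s ^+ 2 * (q * r) * (10 * E) <= al * (r / 4 * X) + be * (r * b).
  have := ler_wpM2l (mulr_ge0 (mulr_ge0 (ltW L0) (sqr_ge0 s)) (ltW p0)) hE.
  by rewrite /al /be; clear; lra.
have n1 := hl _ (sL20 _ N10).
have hX' := ler_wpM2l al0 hX.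
have hXA' := ler_wpM2l al0 hXA.
have hb' := ler_wpM2l be0 hb.
have hbH := ler_wpM2l (mulr_ge0 be0 (mulr_ge0 (ltW r0) (mulr_ge0 (mulr_ge0 (ler0n R 4) (sqr_ge0 L)) (sqr_ge0 s)))) hH.
have hfH := ler_wpM2l (mulr_ge0 (mulr_ge0 (mulr_ge0 (ler0n R 2) (ltW L0)) (sqr_ge0 s)) (ltW r0)) hH.
have hGA' := ler_wpM2l (ltW s0) hGA.
have hGB' := ler_wpM2l (mulr_ge0 (ltW s0) (ltW r0)) hGB.
rewrite /W in hdU'.
(* Every relation that depends on the values of [al] and [be] has been extracted; they are symbols
   from here on. *)
clearbody al be.
clear -hf hdU' hX' hXA' hb' hbH hfH hGA' hGB' Dtot Dfin' xA a1 b1 b2 eE n1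
  E0' N30' N20' N50' N10' N60' N40' B0' A0' G0' Gv0'.
lra.
Qed.

(** * One round with the gradient samples fixed, averaged over the client subset *)

Section OneRound.
Context {R : realFieldType} {du dv n m K : nat}.
Hypothesis mn : (1 <= m <= n)%N.
Hypothesis K_gt0 : (0 < K)%N.
Variables (f : 'I_n -> 'rV[R]_du -> 'rV[R]_dv -> R).
Variables (Gu : 'I_n -> 'rV[R]_du -> 'rV[R]_dv -> 'rV[R]_du).
Variables (Gv : 'I_n -> 'rV[R]_du -> 'rV[R]_dv -> 'rV[R]_dv).
Variables (L gamma_u gamma_v eta_u eta_v gamma : R).
Hypothesis f_le : forall i u v u' v', f i u' v' <= f i u v
  + edot (Gu i u v) (u' - u) + edot (Gv i u v) (v' - v)
  + 2 * L * (sqn (u' - u) + sqn (v' - v)).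
Hypothesis Gu_lip : forall i u v u' v',
  sqn (Gu i u' v' - Gu i u v) <= 2 * L ^+ 2 * (sqn (u' - u) + sqn (v' - v)).
Hypothesis Gv_lip : forall i u v u' v',
  sqn (Gv i u' v' - Gv i u v) <= 2 * L ^+ 2 * (sqn (u' - u) + sqn (v' - v)).
Hypothesis L_gt0 : 0 < L.
Hypothesis gamma_gt0 : 0 < gamma.
Hypothesis gu_eta : gamma_u * eta_u = gamma.
Hypothesis gv_eta : gamma_v * eta_v = gamma.
Hypothesis gu_le : gamma_u ^+ 2 <= gamma ^+ 2 / m%:R.
Hypothesis gv_le : gamma_v ^+ 2 <= gamma ^+ 2 * (m%:R / n%:R).

Definition potential (a b : R) u (v : 'I_n -> 'rV[R]_dv) (al cb : 'I_n -> 'rV[R]_du) : R :=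
  mean (fun i => f i u (v i)) + a * mean (fun i => sqn (u - al i))
  + b * mean (fun i => sqn (cb i - Gu i (al i) (v i))).

Variables (u : 'rV[R]_du) (v : 'I_n -> 'rV[R]_dv) (c al cb : 'I_n -> 'rV[R]_du).
Variables (g : 'I_n -> nat -> 'rV[R]_du) (h : 'I_n -> nat -> 'rV[R]_dv).
Variables (U : 'I_n -> nat -> 'rV[R]_du) (V : 'I_n -> nat -> 'rV[R]_dv).
Hypothesis UE : forall i k,
  U i k = u - gamma_u *: \sum_(l < k) (g i l - c i + vmean c).
Hypothesis VE : forall i k, V i k = v i - gamma_v *: \sum_(l < k) h i l.

Let s := gamma * K%:R.
Let a i k := Gu i (U i k) (V i k).
Let b i k := Gv i (U i k) (V i k).
Let nu i k : 'rV[R]_du := g i k - a i k.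
Let om i k : 'rV[R]_dv := h i k - b i k.
Let gu i := Gu i u (v i).
Let gv i := Gv i u (v i).
Let kmean d (x : 'I_n -> nat -> 'rV[R]_d) i := vmean (fun k : 'I_K => x i k).
Let gub := vmean gu.
Let gb := vmean (kmean g).
Let ab := vmean (kmean a).
Let nub := vmean (kmean nu).
Let y i : 'rV[R]_du := kmean g i - c i + vmean c.
Let X := mean (fun i => sqn (u - al i)).
Let bt := mean (fun i => sqn (cb i - Gu i (al i) (v i))).
Let Eb := mean (fun i => sqn (gu i - cb i)).
Let Ed i k := sqn (U i k - u) + sqn (V i k - v i).
Let D := mean (fun i => mean (fun k : 'I_K => Ed i k)).
(** The noise energies: [N1], [N2], [N4] come from the u-noise of this round, [N5], [N6] from its
    v-noise, and [N3] from the noise stored in the control variates at earlier participations or at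
    initialization. *)
Let N1 := sqn nub.
Let N2 := mean (fun i => sqn (kmean nu i)).
Let N3 := mean (fun i => sqn (c i - cb i)).
Let N4 := mean (fun i => mean (fun k : 'I_K => sqn (\sum_(l < k) nu i l))).
Let N5 := mean (fun i => sqn (kmean om i)).
Let N6 := mean (fun i => mean (fun k : 'I_K => sqn (\sum_(l < k) om i l))).

Let n_gt0 : (0 < n)%N. Proof. by case/andP: mn => /leq_trans; apply. Qed.
Let m_gt0 : (0 < m)%N. Proof. by case/andP: mn. Qed.
Let nR : n%:R != 0 :> R. Proof. by rewrite pnatr_eq0 -lt0n. Qed.
Let mR : m%:R != 0 :> R. Proof. by rewrite pnatr_eq0 -lt0n. Qed.
Let KR : K%:R != 0 :> R. Proof. by rewrite pnatr_eq0 -lt0n. Qed.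

Let kmeanD d (x x' : 'I_n -> nat -> 'rV[R]_d) i :
  kmean (fun i k => x i k + x' i k) i = kmean x i + kmean x' i.
Proof. exact: vmeanD. Qed.

Lemma round_g_split i : kmean g i = kmean a i + kmean nu i.
Proof. by rewrite -kmeanD; apply: eq_vmean => k; rewrite subrKC. Qed.

Lemma round_h_split i : kmean h i = kmean b i + kmean om i.
Proof. by rewrite -kmeanD; apply: eq_vmean => k; rewrite subrKC. Qed.

Lemma round_gb_split : gb = ab + nub.
Proof. by rewrite -vmeanD; apply: eq_vmean => i; exact: round_g_split. Qed.

Lemma round_UK i : U i K - u = - (gamma_u * K%:R) *: y i.
Proof.
rewrite UE addrC addKr -scaleNr; rewrite (_ : \sum_(l < K) _ = K%:R *: y i).
  by rewrite scalerA mulNr.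
by rewrite sum_vmean // vmeanD vmeanB !vmean_cst.
Qed.

Lemma round_VK i : V i K - v i = - (gamma_v * K%:R) *: kmean h i.
Proof. by rewrite VE addrC addKr -scaleNr sum_vmean // scalerA mulNr. Qed.

Let uP (S : {set 'I_n}) : 'rV[R]_du := (1 - eta_u) *: u + (eta_u / m%:R) *: \sum_(i in S) U i K.
Let vP (S : {set 'I_n}) i : 'rV[R]_dv :=
  if i \in S then (1 - eta_v) *: v i + eta_v *: V i K else v i.
Let alP (S : {set 'I_n}) i := if i \in S then u else al i.
Let cbP (S : {set 'I_n}) i := if i \in S then kmean a i else cb i.

Lemma round_duE (S : {set 'I_n}) : #|S| == m -> uP S - u = - (s / m%:R) *: \sum_(i in S) y i.
Proof.
move=> /eqP Sm.
have -> : uP S - u = (eta_u / m%:R) *: \sum_(i in S) (U i K - u).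
  rewrite sumrB sumr_const Sm scalerBr -(scaler_nat m u) scalerA divfK //.
  by apply/rowP => j; rewrite !mxE; ring.
under eq_bigr do rewrite round_UK.
by rewrite -scaler_sumr scalerA /s -gu_eta; congr (_ *: _); ring.
Qed.

Lemma round_dvE S i : vP S i - v i = if i \in S then - s *: kmean h i else 0.
Proof.
rewrite /vP; case: ifP => _; last by rewrite subrr.
have -> : (1 - eta_v) *: v i + eta_v *: V i K - v i = eta_v *: (V i K - v i).
  by apply/rowP => j; rewrite !mxE; ring.
by rewrite round_VK scalerA /s -gv_eta; congr (_ *: _); ring.
Qed.

(** The control corrections -c_i + [vmean c] cancel over all clients, so a uniform subset follows
    the mean gradient [gb] on average. *)
Lemma round_vmean_y : vmean y = gb.
Proof. by rewrite vmeanD vmeanB vmean_cst // subrK. Qed.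

Lemma avg_if i (x x' : R) :
  avg m (fun S : {set 'I_n} => if i \in S then x else x')
    = m%:R / n%:R * x + (1 - m%:R / n%:R) * x'.
Proof.
rewrite -pick1E // -(avg_in mn i).
rewrite (@eq_avg _ _ _ _ (fun S : {set 'I_n} => x' + (x - x') * (i \in S)%:R)) => [|S _].
  by rewrite avgD avgZ avg_cst //; ring.
by case: (i \in S); rewrite /=; ring.
Qed.

Lemma avg_mean (x : {set 'I_n} -> 'I_n -> R) :
  avg m (fun S => mean (x S)) = mean (fun i => avg m (x^~ i)).
Proof. by rewrite /mean avgZ avg_summ. Qed.

Lemma round_avg_du z : avg m (fun S : {set 'I_n} => edot z (uP S - u)) = - s * edot z gb.
Proof.
rewrite (@eq_avg _ _ _ _ (fun S : {set 'I_n} => - (s / m%:R) * \sum_(i in S) edot z (y i))) => [|S /round_duE ->].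
  rewrite avgZ avg_sum // -round_vmean_y edot_vmeanr mulrA; congr (_ * _).
  by rewrite mulNr divfK.
by rewrite edotZr edot_sumr.
Qed.

Lemma round_avg_sqn_du : avg m (fun S : {set 'I_n} => sqn (uP S - u)) <=
  s ^+ 2 * (sqn gb + m%:R^-1 * mean (fun i => sqn (kmean g i - c i))).
Proof.
have yE i : y i - gb = kmean g i - c i - vmean (fun i => kmean g i - c i).
  by rewrite -round_vmean_y /y vmeanD vmean_cst // opprD addrACA subrr addr0.
rewrite (@eq_avg _ _ _ _ (fun S : {set 'I_n} => s ^+ 2 / m%:R ^+ 2 *
   (m%:R ^+ 2 * sqn gb + 2 * m%:R * \sum_(i in S) edot gb (y i - gb)
    + sqn (\sum_(i in S) (y i - gb))))) => [|S Sm]; last first.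
  rewrite round_duE // sqnZ sqrrN expr_div_n; congr (_ * _).
  have -> : \sum_(i in S) y i = m%:R *: gb + \sum_(i in S) (y i - gb).
    by rewrite sumrB sumr_const (eqP Sm) -(scaler_nat m gb) subrKC.
  by rewrite sqnD sqnZ edotZl edot_sumr mulrA.
rewrite avgZ !avgD !avgZ avg_cst // avg_sum //.
have -> : mean (fun i => edot gb (y i - gb)) = 0.
  rewrite -edot_vmeanr vmeanB round_vmean_y vmean_cst // subrr edotC.
  exact: edot0l.
rewrite !mulr0 addr0.
have y0 : \sum_i (y i - gb) = 0.
  by rewrite sum_vmean // vmeanB round_vmean_y vmean_cst // subrr scaler0.
have h1 := avg_sqn_sum mn y0.
have h2 : mean (fun i => sqn (y i - gb)) <= mean (fun i => sqn (kmean g i - c i)).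
  under eq_mean do rewrite yE.
  exact: sqn_vmean_center_le.
rewrite -mulrA ler_wpM2l ?sqr_ge0 // mulrDr mulKf ?expf_neq0 // lerD2l.
rewrite ler_pdivrMl ?exprn_gt0 ?ltr0n // expr2 -mulrA mulVKf //.
by apply: le_trans h1 _; rewrite ler_wpM2l.
Qed.

(** Smoothness is applied client by client at the new point. The step of u averages to -s [gb],
    while v_i moves only with probability m/n, which gives the v-terms their factor. *)
Lemma round_avg_f :
  avg m (fun S : {set 'I_n} => mean (fun i => f i (uP S) (vP S i))) <=
  mean (fun i => f i u (v i)) - s * edot gub gb
  - s * (m%:R / n%:R) * mean (fun i => edot (gv i) (kmean h i))
  + 2 * L * avg m (fun S : {set 'I_n} => sqn (uP S - u))
  + 2 * L * s ^+ 2 * (m%:R / n%:R) * mean (fun i => sqn (kmean h i)).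
Proof.
apply: (@le_trans _ _ (avg m (fun S : {set 'I_n} => mean (fun i => f i u (v i))
   + edot gub (uP S - u) + mean (fun i => edot (gv i) (vP S i - v i))
   + 2 * L * (sqn (uP S - u) + mean (fun i => sqn (vP S i - v i)))))).
  apply: avg_le => // S _.
  rewrite /gub edot_vmeanl -meanD -meanD -(mean_cst (sqn (uP S - u)) n_gt0).
  by rewrite -meanD -meanZ -meanD; apply: ler_mean => i; exact: f_le.
rewrite !avgD avgZ !avgD avg_cst // round_avg_du.
have -> : avg m (fun S : {set 'I_n} => mean (fun i => edot (gv i) (vP S i - v i)))
   = - s * (m%:R / n%:R) * mean (fun i => edot (gv i) (kmean h i)).
  rewrite avg_mean -meanZ; apply: eq_mean => i.
  rewrite (@eq_avg _ _ _ _ (fun S : {set 'I_n} =>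
    if i \in S then - s * edot (gv i) (kmean h i) else 0)) => [|S _].
    by rewrite avg_if //; ring.
  by rewrite round_dvE; case: ifP => _; rewrite ?edotZr // edotC edot0l.
have -> : avg m (fun S : {set 'I_n} => mean (fun i => sqn (vP S i - v i)))
   = s ^+ 2 * (m%:R / n%:R) * mean (fun i => sqn (kmean h i)).
  rewrite avg_mean -meanZ; apply: eq_mean => i.
  rewrite (@eq_avg _ _ _ _ (fun S : {set 'I_n} =>
    if i \in S then s ^+ 2 * sqn (kmean h i) else 0)) => [|S _].
    by rewrite avg_if //; ring.
  by rewrite round_dvE; case: ifP => _; rewrite ?sqn0 // sqnZ sqrrN.
lra.
Qed.

(** A selected client has its anchor reset, so its distance becomes |u^+ - u|^2; for the others the
    square is expanded around u. The cross term is nevertheless inserted for all clients, so that it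
    depends on S only through u^+ - u and averages exactly to an inner product with [gb]. The price
    is a contraction 1 - m/(2n) instead of 1 - m/n. *)
Lemma round_avg_X :
  avg m (fun S : {set 'I_n} => mean (fun i => sqn (uP S - alP S i))) <=
  (1 - m%:R / n%:R / 2) * X + 3 * avg m (fun S : {set 'I_n} => sqn (uP S - u))
  - 2 * s * edot (vmean (fun i => u - al i)) gb.
Proof.
apply: (@le_trans _ _ (avg m (fun S : {set 'I_n} => 3 * sqn (uP S - u)
   + 2 * edot (vmean (fun i => u - al i)) (uP S - u)
   + mean (fun i => if i \in S then sqn (u - al i) / 2 else sqn (u - al i))))).
  apply: avg_le => // S _.
  rewrite edot_vmeanl -(mean_cst (3 * sqn (uP S - u)) n_gt0) -meanZ -!meanD.
  apply: ler_mean => i; rewrite /alP; case: ifP => _.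
    (* Inserting the cross term for a selected client costs |u - al_i|^2 / 2 + 2 |u^+ - u|^2, whence
       the factors 1/2 and 3. *)
    have := @edot_young _ _ 2^-1 (- (u - al i)) (uP S - u) ltac:(by rewrite invr_gt0).
    by rewrite invrK sqnN edotNl; lra.
  rewrite (_ : uP S - al i = (u - al i) + (uP S - u)); last first.
    by apply/rowP => j; rewrite !mxE; ring.
  by rewrite sqnD; have := sqn_ge0 (uP S - u); lra.
rewrite !avgD 2!avgZ round_avg_du.
have -> : avg m (fun S : {set 'I_n} =>
    mean (fun i => if i \in S then sqn (u - al i) / 2 else sqn (u - al i)))
   = (1 - m%:R / n%:R / 2) * X.
  rewrite /X avg_mean -meanZ; apply: eq_mean => i; rewrite avg_if //; lra.
lra.
Qed.

Lemma round_dist i k : sqn (a i k - gu i) <= 2 * L ^+ 2 * Ed i k.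
Proof. exact: Gu_lip. Qed.

Lemma round_dist_mean i : sqn (kmean a i - gu i) <= 2 * L ^+ 2 * mean (fun k : 'I_K => Ed i k).
Proof.
rewrite -meanZ (_ : _ - _ = vmean (fun k : 'I_K => a i k - gu i)).
  by apply: le_trans (sqn_vmean _ K_gt0) _; apply: ler_mean => k; exact: round_dist.
by rewrite vmeanB vmean_cst.
Qed.

Lemma round_dist_mean_v i : sqn (kmean b i - gv i) <= 2 * L ^+ 2 * mean (fun k : 'I_K => Ed i k).
Proof.
rewrite -meanZ (_ : _ - _ = vmean (fun k : 'I_K => b i k - gv i)).
  by apply: le_trans (sqn_vmean _ K_gt0) _; apply: ler_mean => k; exact: Gv_lip.
by rewrite vmeanB vmean_cst.
Qed.

(** For a selected client, the new clean control and the gradient at the new pair are both compared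
    with the gradient at the starting point: the first gap is local drift, the second is due to the
    move of v_i alone. For the others nothing in the term changes. *)
Lemma round_avg_beta :
  avg m (fun S : {set 'I_n} => mean (fun i => sqn (cbP S i - Gu i (alP S i) (vP S i)))) <=
  (1 - m%:R / n%:R) * bt
  + m%:R / n%:R * (4 * L ^+ 2 * D + 4 * L ^+ 2 * s ^+ 2 * mean (fun i => sqn (kmean h i))).
Proof.
apply: (@le_trans _ _ (avg m (fun S : {set 'I_n} => mean (fun i => if i \in S then
   4 * L ^+ 2 * mean (fun k : 'I_K => Ed i k) + 4 * L ^+ 2 * s ^+ 2 * sqn (kmean h i)
   else sqn (cb i - Gu i (al i) (v i)))))).
  apply: avg_le => // S _; apply: ler_mean => i; have := round_dvE S i.
  rewrite /cbP /alP; case: ifP => _; last by move=> /subr0_eq ->.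
  move: (vP S i) => v' v'E.
  rewrite (_ : kmean a i - _ = (kmean a i - gu i) + (gu i - Gu i u v')); last first.
    by rewrite addrA subrK.
  apply: le_trans (sqnD_le _ _) _; have h1 := round_dist_mean i.
  have := Gu_lip i u (v i) u v'; rewrite v'E subrr sqn0 sqnZ sqrrN sqnBC add0r -/(gu i).
  lra.
rewrite avg_mean (eq_mean (y := fun i => (1 - m%:R / n%:R) * sqn (cb i - Gu i (al i) (v i))
  + m%:R / n%:R * (4 * L ^+ 2 * mean (fun k : 'I_K => Ed i k)
    + 4 * L ^+ 2 * s ^+ 2 * sqn (kmean h i)))) => [|i]; last first.
  by rewrite avg_if // addrC.
by rewrite meanD meanZ meanZ meanD 2!meanZ.
Qed.

(** The two gradients compared share the same v_i, so their gap is controlled by |u - al_i|^2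
    alone. *)
Lemma round_Eb : Eb <= 4 * L ^+ 2 * X + 2 * bt.
Proof.
rewrite /X /bt -!meanZ -meanD; apply: ler_mean => i.
rewrite (_ : gu i - cb i = (gu i - Gu i (al i) (v i)) - (cb i - Gu i (al i) (v i))).
  have := Gu_lip i (al i) (v i) u (v i); rewrite subrr sqn0 addr0 -/(gu i).
  by have := sqnD_le (gu i - Gu i (al i) (v i)) (- (cb i - Gu i (al i) (v i))); rewrite sqnN; lra.
by rewrite opprB addrA subrK.
Qed.

Let Ed_ge0 i k : 0 <= Ed i k. Proof. by rewrite addr_ge0 // sqn_ge0. Qed.

(** Cauchy-Schwarz costs a factor k <= K, and the prefix of the bounds e is then extended to all K
    terms; the result is uniform in k. *)
Lemma sqn_prefix_sum d (x : nat -> 'rV[R]_d) (e : nat -> R) k : (k <= K)%N ->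
  (forall l, 0 <= e l) -> (forall l, sqn (x l) <= e l) ->
  sqn (\sum_(l < k) x l) <= K%:R ^+ 2 * mean (fun l : 'I_K => e l).
Proof.
move=> kK e0 xe; apply: le_trans (sqn_sum _) _; rewrite card_ord expr2 -mulrA -sum_mean //.
apply: ler_pM => //; first by apply: sumr_ge0 => l _; exact: sqn_ge0.
  by rewrite ler_nat.
rewrite (big_ord_widen K (fun l => sqn (x l)) kK) big_mkcond; apply: ler_sum => l _.
by case: ifP => _; rewrite ?xe ?e0.
Qed.

Lemma sqn_scale_nat_le d (x : 'rV[R]_d) k : (k <= K)%N ->
  sqn (k%:R *: x) <= K%:R ^+ 2 * sqn x.
Proof.
by move=> kK; rewrite sqnZ ler_wpM2r ?sqn_ge0 // ler_sqr ?nnegrE // ler_nat.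
Qed.

(** The corrected local direction is [gub] + [ec] - [zc] plus drift and fresh noise. Only centred
    errors of the control variates remain, of staleness for [ec] and of noise for [zc]; hence no
    bound on client heterogeneity appears. *)
Let ec i := gu i - cb i - vmean (fun i => gu i - cb i).
Let zc i := c i - cb i - vmean (fun i => c i - cb i).

Lemma round_drift_u i (k : 'I_K) : sqn (U i k - u) <=
  5 * gamma_u ^+ 2 * (2 * (L * K%:R) ^+ 2 * mean (fun k : 'I_K => Ed i k)
    + sqn (\sum_(l < k) nu i l) + K%:R ^+ 2 * (sqn (ec i) + sqn gub + sqn (zc i))).
Proof.
have kK := ltnW (ltn_ord k).
rewrite UE addrC addKr sqnN sqnZ.
have -> : \sum_(l < k) (g i l - c i + vmean c) = \sum_(l < k) (a i l - gu i)
  + \sum_(l < k) nu i l + k%:R *: ec i + k%:R *: gub + - (k%:R *: zc i).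
  have e : forall x : 'rV[R]_du, k%:R *: x = \sum_(l < k) x.
    by move=> x; rewrite sumr_const card_ord scaler_nat.
  rewrite !e -sumrN -!big_split /=; apply: eq_bigr => l _.
  rewrite /ec /zc !vmeanB -/gub /nu.
  by move: (vmean c) (vmean cb) gub => ? ? ?; apply/rowP => j; rewrite !mxE; ring.
rewrite (mulrC 5) -(mulrA _ 5) ler_wpM2l ?sqr_ge0 //.
apply: le_trans (sqnD5_le _ _ _ _ _) _; rewrite ler_pM2l // sqnN.
have h1 := @sqn_prefix_sum _ (fun l => a i l - gu i) (fun l => 2 * L ^+ 2 * Ed i l) k kK.
have {}h1 := h1 _ (round_dist i).
rewrite meanZ in h1.
have h2 := sqn_scale_nat_le (ec i) kK.
have h3 := sqn_scale_nat_le gub kK.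
have h4 := sqn_scale_nat_le (zc i) kK.
have {}h1 : sqn (\sum_(l < k) (a i l - gu i)) <=
    K%:R ^+ 2 * (2 * L ^+ 2 * mean (fun l : 'I_K => Ed i l)).
  by apply: h1 => l; rewrite mulr_ge0 ?Ed_ge0 // mulr_ge0 // sqr_ge0.
lra.
Qed.

Lemma round_drift_v i (k : 'I_K) : sqn (V i k - v i) <=
  3 * gamma_v ^+ 2 * (2 * (L * K%:R) ^+ 2 * mean (fun k : 'I_K => Ed i k)
    + sqn (\sum_(l < k) om i l) + K%:R ^+ 2 * sqn (gv i)).
Proof.
have kK := ltnW (ltn_ord k).
rewrite VE addrC addKr sqnN sqnZ.
have -> : \sum_(l < k) h i l = \sum_(l < k) (b i l - gv i)
  + \sum_(l < k) om i l + k%:R *: gv i.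
  have e : forall x : 'rV[R]_dv, k%:R *: x = \sum_(l < k) x.
    by move=> x; rewrite sumr_const card_ord scaler_nat.
  rewrite !e -!big_split /=; apply: eq_bigr => l _.
  by rewrite /om; apply/rowP => j; rewrite !mxE; ring.
rewrite (mulrC 3) -(mulrA _ 3) ler_wpM2l ?sqr_ge0 //.
apply: le_trans (sqnD3_le _ _ _) _; rewrite ler_pM2l //.
have h1 := @sqn_prefix_sum _ (fun l => b i l - gv i) (fun l => 2 * L ^+ 2 * Ed i l) k kK.
have {}h1 := h1 _ (fun l => Gv_lip i u (v i) (U i l) (V i l)).
rewrite meanZ in h1.
have h2 := sqn_scale_nat_le (gv i) kK.
have {}h1 : sqn (\sum_(l < k) (b i l - gv i)) <=
    K%:R ^+ 2 * (2 * L ^+ 2 * mean (fun l : 'I_K => Ed i l)).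
  by apply: h1 => l; rewrite mulr_ge0 ?Ed_ge0 // mulr_ge0 // sqr_ge0.
lra.
Qed.

Let mean_lin A A' B C z (x1 x2 x3 x4 x5 x6 : 'I_n -> R) :
  mean (fun i => A * (B * x1 i + x2 i + C * (x3 i + z + x4 i))
    + A' * (B * x1 i + x5 i + C * x6 i))
  = A * (B * mean x1 + mean x2 + C * (mean x3 + z + mean x4))
    + A' * (B * mean x1 + mean x5 + C * mean x6).
Proof. by rewrite meanD 2!meanZ !meanD !meanZ !meanD mean_cst. Qed.

(** Implicit in D, because the gradients along the local run differ from the starting ones by the
    drift itself; small steps make it explicit in [round_arith]. The factors 5 and 3 count the
    summands of the two local directions. *)
Lemma round_drift : D <=
  5 * gamma_u ^+ 2 * (2 * (L * K%:R) ^+ 2 * D + N4 + K%:R ^+ 2 * (Eb + sqn gub + N3))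
  + 3 * gamma_v ^+ 2 * (2 * (L * K%:R) ^+ 2 * D + N6
      + K%:R ^+ 2 * mean (fun i => sqn (gv i))).
Proof.
have hE : mean (fun i => sqn (ec i)) <= Eb by exact: sqn_vmean_center_le.
have hz : mean (fun i => sqn (zc i)) <= N3 by exact: sqn_vmean_center_le.
apply: (@le_trans _ _ (mean (fun i =>
  5 * gamma_u ^+ 2 * (2 * (L * K%:R) ^+ 2 * mean (fun k : 'I_K => Ed i k)
    + mean (fun k : 'I_K => sqn (\sum_(l < k) nu i l))
    + K%:R ^+ 2 * (sqn (ec i) + sqn gub + sqn (zc i)))
  + 3 * gamma_v ^+ 2 * (2 * (L * K%:R) ^+ 2 * mean (fun k : 'I_K => Ed i k)
    + mean (fun k : 'I_K => sqn (\sum_(l < k) om i l)) + K%:R ^+ 2 * sqn (gv i))))).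
  apply: ler_mean => i.
  apply: (@le_trans _ _ (mean (fun k : 'I_K =>
    5 * gamma_u ^+ 2 * (2 * (L * K%:R) ^+ 2 * mean (fun k : 'I_K => Ed i k)
    + sqn (\sum_(l < k) nu i l) + K%:R ^+ 2 * (sqn (ec i) + sqn gub + sqn (zc i)))
    + 3 * gamma_v ^+ 2 * (2 * (L * K%:R) ^+ 2 * mean (fun k : 'I_K => Ed i k)
    + sqn (\sum_(l < k) om i l) + K%:R ^+ 2 * sqn (gv i))))).
    by apply: ler_mean => k; rewrite lerD // ?round_drift_u ?round_drift_v.
  by rewrite meanD 2!meanZ !meanD !(mean_cst _ K_gt0).
rewrite (mean_lin _ _ _ _ _ (fun i => mean (fun k : 'I_K => Ed i k))
  (fun i => mean (fun k : 'I_K => sqn (\sum_(l < k) nu i l))) (fun i => sqn (ec i))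
  (fun i => sqn (zc i)) (fun i => mean (fun k : 'I_K => sqn (\sum_(l < k) om i l)))
  (fun i => sqn (gv i))).
rewrite lerD2r; apply: ler_wpM2l; first by rewrite mulr_ge0 // sqr_ge0.
rewrite lerD2l.
by rewrite ler_wpM2l ?sqr_ge0 // lerD // lerD2r.
Qed.

Hypothesis step1 : 72 * (L * s) <= 1.
Hypothesis step2 : (72 * (L * s)) ^+ 2 * n%:R <= m%:R ^+ 2.
Hypothesis step3 : (72 * (L * s)) ^+ 3 * n%:R ^+ 2 <= m%:R ^+ 3.

Let A : R := 160 * L ^+ 3 * s ^+ 2 * (n%:R / m%:R ^+ 2).
Let B : R := 20 * L * s ^+ 2 * (n%:R / m%:R ^+ 2).

(** The inner products with [nub] and [om] stay exact, since they disappear only in expectation; all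
    other noise enters through squares. *)
Lemma potential_round :
  avg m (fun S => potential A B (uP S) (vP S) (alP S) (cbP S)) <=
  potential A B u v al cb
  - s / 4 * (sqn gub + m%:R / n%:R * mean (fun i => sqn (gv i)))
  - s * edot gub nub - s * (m%:R / n%:R) * mean (fun i => edot (gv i) (kmean om i))
  - 2 * A * s * edot (vmean (fun i => u - al i)) nub
  + 5 * L * s ^+ 2 * N1 + 9 * L * s ^+ 2 * m%:R^-1 * (N2 + N3)
  + L * gamma ^+ 2 * m%:R^-1 * N4
  + m%:R / n%:R * (5 * L * s ^+ 2 * N5 + L * gamma ^+ 2 * N6).
Proof.
have n0 : 0 < n%:R :> R by rewrite ltr0n.
have m0 : 0 < m%:R :> R by rewrite ltr0n.
have s0 : 0 < s by rewrite mulr_gt0 // ltr0n.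
have mn' : m%:R <= n%:R :> R by rewrite ler_nat; case/andP: mn.
have mge1 : 1 <= m%:R :> R by rewrite ler1n.
have qr : n%:R / m%:R ^+ 2 * (m%:R / n%:R) = m%:R^-1 :> R.
  by field; rewrite nR mR.
have sqn0' : forall d' (I : finType) (x : I -> 'rV[R]_d'), 0 <= \sum_i sqn (x i).
  by move=> d' I x; apply: sumr_ge0 => i _; exact: sqn_ge0.
have mean0 : forall d' k' (x : 'I_k' -> 'rV[R]_d'), 0 <= mean (fun i => sqn (x i)).
  by move=> d' k' x; apply: mean_ge0 => i; exact: sqn_ge0.
rewrite /potential avgD avgD 2!avgZ -/X -/bt -qr.
apply: (@round_arith R L s gamma (n%:R / m%:R ^+ 2) (m%:R / n%:R) (n%:R / m%:R)
  (mean (fun i => f i u (v i))) _ X _ bt _ D Eb (sqn gub) (mean (fun i => sqn (gv i)))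
  (sqn ab) (mean (fun i => sqn (kmean b i))) (mean (fun i => sqn (kmean h i)))
  (avg m (fun S => sqn (uP S - u))) N1 N2 N3 N4 N5 N6 (edot gub nub)
  (mean (fun i => edot (gv i) (kmean om i))) (edot (vmean (fun i => u - al i)) nub)
  (edot gub ab) (mean (fun i => edot (gv i) (kmean b i)))
  (edot (vmean (fun i => u - al i)) ab)) => //.
- by rewrite divr_gt0 // exprn_gt0.
- by rewrite divr_gt0.
- by rewrite divr_gt0.
- by rewrite ler_pdivrMr // mul1r.
- by rewrite qr invf_le1.
- by rewrite (mulrA _ n%:R) ler_pdivrMr ?exprn_gt0 // mul1r.
- rewrite (_ : n%:R / m%:R ^+ 2 * (n%:R / m%:R) = n%:R ^+ 2 / m%:R ^+ 3); last first.
    by field; rewrite mR.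
  by rewrite (mulrA _ (n%:R ^+ 2)) ler_pdivrMr ?exprn_gt0 // mul1r.
- exact: mean0.
- exact: mean0.
- by apply: mean_ge0 => i; apply: mean_ge0 => k; exact: Ed_ge0.
- exact: mean0.
- exact: sqn_ge0.
- exact: sqn_ge0.
- exact: sqn_ge0.
- exact: mean0.
- exact: mean0.
- by apply: mean_ge0 => i; exact: mean0.
- exact: mean0.
- by apply: mean_ge0 => i; exact: mean0.
- have := round_avg_f; rewrite round_gb_split edotDr.
  have -> : mean (fun i => edot (gv i) (kmean h i)) =
      mean (fun i => edot (gv i) (kmean b i)) + mean (fun i => edot (gv i) (kmean om i)).
    by rewrite -meanD; apply: eq_mean => i; rewrite round_h_split edotDr.
  by [].
- rewrite -meanD -meanZ; apply: ler_mean => i; rewrite round_h_split; exact: sqnD_le.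
- have -> : sqn gub + sqn ab - 2 * edot gub ab = sqn (gub - ab) by rewrite sqnB; ring.
  rewrite -vmeanB; apply: le_trans (sqn_vmean _ n_gt0) _; rewrite /D -meanZ.
  by apply: ler_mean => i; rewrite sqnBC; exact: round_dist_mean.
- rewrite -meanZ -meanD -meanB /D -meanZ; apply: ler_mean => i.
  have -> : sqn (gv i) + sqn (kmean b i) - 2 * edot (gv i) (kmean b i)
     = sqn (gv i - kmean b i) by rewrite sqnB; ring.
  by rewrite sqnBC; exact: round_dist_mean_v.
- apply: le_trans round_avg_sqn_du _; rewrite qr ler_wpM2l ?sqr_ge0 // lerD //.
    by rewrite round_gb_split; exact: sqnD_le.
  rewrite ler_wpM2l ?invr_ge0 // /D -meanZ -!meanD -meanZ; apply: ler_mean => i.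
  (* Drift, staleness, fresh noise and stored noise; four summands give the factor 4. *)
  have -> : kmean g i - c i = (kmean a i - gu i) + (gu i - cb i) + kmean nu i
      + - (c i - cb i).
    rewrite round_g_split.
    by move: (kmean a i) (kmean nu i) => ? ?; apply/rowP => j; rewrite !mxE; ring.
  apply: le_trans (sqnD4_le _ _ _ _) _; rewrite ler_pM2l // sqnN.
  by have := round_dist_mean i; lra.
- have := round_avg_X; rewrite round_gb_split edotDr; exact.
- pose d := vmean (fun i => u - al i).
  have h1 : sqn d <= X by exact: sqn_vmean.
  (* The weight spends half of the contraction m/(2n) and leaves m/(4n) to pay for staleness; its
     inverse 4n/m then multiplies only |s [ab]|^2. *)
  have := @edot_young _ _ (m%:R / n%:R / 4) (- d) (s *: ab).
  rewrite edotNl edotZr sqnN sqnZ -/d !invf_div => /(_ _) h2.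
  have {}h2 := h2 (divr_gt0 (divr_gt0 m0 n0) (ltr0n R 4)).
  have h3 := ler_wpM2l (ltW (divr_gt0 (divr_gt0 m0 n0) (ltr0n R 4))) h1.
  lra.
- exact: round_avg_beta.
- exact: round_Eb.
- have D0 : 0 <= (L * K%:R) ^+ 2 * D.
    rewrite mulr_ge0 ?sqr_ge0 //.
    by apply: mean_ge0 => i; apply: mean_ge0 => k; exact: Ed_ge0.
  have K0 : 0 <= K%:R ^+ 2 :> R by exact: sqr_ge0.
  have E0 : 0 <= Eb + sqn gub + N3 by rewrite !addr_ge0 // ?sqn_ge0 ?mean0.
  have N40 : 0 <= N4 by apply: mean_ge0 => i; exact: mean0.
  have N60 : 0 <= N6 by apply: mean_ge0 => i; exact: mean0.
  have Gv0 : 0 <= mean (fun i => sqn (gv i)) by exact: mean0.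
  have h1 : 0 <= 2 * (L * K%:R) ^+ 2 * D + N4 + K%:R ^+ 2 * (Eb + sqn gub + N3).
    by have := mulr_ge0 K0 E0; lra.
  have h2 : 0 <= 2 * (L * K%:R) ^+ 2 * D + N6 + K%:R ^+ 2 * mean (fun i => sqn (gv i)).
    by have := mulr_ge0 K0 Gv0; lra.
  apply: le_trans round_drift _.
  have {}h1 := ler_wpM2r h1 gu_le; have {}h2 := ler_wpM2r h2 gv_le.
  rewrite qr /s; lra.
Qed.
End OneRound.

Local Open Scope classical_set_scope.
Local Open Scope ring_scope.

(** * Gradients, the mean value theorem and smoothness bounds *)

Section Calculus.
Context {R : realType}.

Lemma enorm_sqr d (x : 'rV[R]_d) : enorm x ^+ 2 = sqn x.
Proof.
rewrite sqr_sqrtr; first by apply: eq_bigr => j _; rewrite expr2.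
by apply: sumr_ge0 => j _; exact: sqr_ge0.
Qed.

Lemma elipschitz_sqn d e (k L : R) (g : 'rV[R]_d -> 'rV[R]_e) x y :
  0 <= L -> k <= L -> elipschitz k g -> sqn (g x - g y) <= L ^+ 2 * sqn (x - y).
Proof.
move=> L0 kL /(_ x y) h; rewrite -!enorm_sqr -exprMn ler_sqr ?nnegrE ?sqrtr_ge0 //.
  by apply: le_trans h _; rewrite ler_wpM2r // sqrtr_ge0.
by rewrite mulr_ge0 // sqrtr_ge0.
Qed.

Lemma deriveE_grad d (g : 'rV[R]_d -> R) x v : differentiable g x ->
  'D_v g x = edot (grad g x) v.
Proof.
move=> dg; rewrite deriveE // [in LHS](row_sum_delta v) linear_sum.
by apply: eq_bigr => j _; rewrite linearZ /= mxE deriveE // mulrC.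
Qed.

Lemma grad_MVT d (g : 'rV[R]_d -> R) x y : (forall z, differentiable g z) ->
  exists2 c : R, 0 <= c <= 1 & g y - g x = edot (grad g (x + c *: (y - x))) (y - x).
Proof.
move=> dg; pose phi (t : R) := g (x + t *: (y - x)).
have dphi (t : R) : is_derive t 1 phi (edot (grad g (x + t *: (y - x))) (y - x)).
  have e : (fun h : R => h^-1 *: (phi (h *: 1 + t) - phi t)) =
      (fun h : R => h^-1 *: (g (h *: (y - x) + (x + t *: (y - x))) - g (x + t *: (y - x)))).
    apply/funext => h; congr (_ *: (g _ - _)).
    by rewrite [h *: 1]mulr1 scalerDl addrCA.
  have dd : derivable phi t 1.
    rewrite /derivable; have := @diff_derivable _ _ _ _ _ (y - x) (dg (x + t *: (y - x))).
    by rewrite /derivable => h; move: h; rewrite -e.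
  apply: DeriveDef => //.
  by rewrite -deriveE_grad // /derive -e.
have cphi : {within `[0, 1], continuous phi}.
  apply: continuous_subspaceT => t; apply: differentiable_continuous.
  by apply/derivable1_diffP; case: (dphi t).
have [c c01] := MVT (ltr01 : 0 < 1 :> R) (fun t _ => dphi t) cphi.
rewrite /phi scale1r scale0r addr0 subr0 mulr1 subrKC => h; exists c => //.
by move: c01; rewrite in_itv /= => /andP[/ltW -> /ltW ->].
Qed.

(** The mean value theorem followed by Young's inequality of weight 1/L; compared with integrating
    the gradient along the segment, this gives L in place of the sharp L/2. *)
Lemma lipschitz_grad_upper d (g : 'rV[R]_d -> R) (k L : R) x y : 0 < L -> k <= L ->
  (forall z, differentiable g z) -> elipschitz k (grad g) ->
  g y <= g x + edot (grad g x) (y - x) + L * sqn (y - x).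
Proof.
move=> L0 kL dg lg; have [c /andP[c0 c1] e] := grad_MVT x y dg.
have h := @elipschitz_sqn _ _ _ _ _ (x + c *: (y - x)) x (ltW L0) kL lg.
rewrite [x + _ - x]addrAC subrr add0r sqnZ in h.
have := @edot_young _ _ L^-1 (grad g (x + c *: (y - x)) - grad g x) (y - x).
rewrite invrK invr_gt0 => /(_ L0).
rewrite edotDl edotNl -e => h2.
have {}h : L^-1 * sqn (grad g (x + c *: (y - x)) - grad g x) <= L * sqn (y - x).
  rewrite ler_pdivrMl // (le_trans h) // expr2 -mulrA; do 2!rewrite ler_wpM2l ?(ltW L0) //.
  by rewrite ler_piMl ?sqn_ge0 // exprn_ile1.
lra.
Qed.

Section TwoBlocks.
Context {du dv : nat}.
Variables (f : 'rV[R]_du -> 'rV[R]_dv -> R) (Lu Lv Luv Lvu L : R).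
Hypothesis df : partially_differentiable f.
Hypothesis lu : forall v, elipschitz Lu (fun u => grad_u f u v).
Hypothesis luv : forall u, elipschitz Luv (fun v => grad_u f u v).
Hypothesis lv : forall u, elipschitz Lv (fun v => grad_v f u v).
Hypothesis lvu : forall v, elipschitz Lvu (fun u => grad_v f u v).
Hypotheses (L0 : 0 < L) (Lu_le : Lu <= L) (Lv_le : Lv <= L) (Luv_le : Luv <= L)
  (Lvu_le : Lvu <= L).

Lemma grad_u_lipschitz u v u' v' :
  sqn (grad_u f u' v' - grad_u f u v) <= 2 * L ^+ 2 * (sqn (u' - u) + sqn (v' - v)).
Proof.
have h1 := @elipschitz_sqn _ _ _ _ _ u' u (ltW L0) Lu_le (lu v').
have h2 := @elipschitz_sqn _ _ _ _ _ v' v (ltW L0) Luv_le (luv u).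
have := sqnD_le (grad_u f u' v' - grad_u f u v') (grad_u f u v' - grad_u f u v).
by rewrite addrA subrK; lra.
Qed.

Lemma grad_v_lipschitz u v u' v' :
  sqn (grad_v f u' v' - grad_v f u v) <= 2 * L ^+ 2 * (sqn (u' - u) + sqn (v' - v)).
Proof.
have h1 := @elipschitz_sqn _ _ _ _ _ u' u (ltW L0) Lvu_le (lvu v').
have h2 := @elipschitz_sqn _ _ _ _ _ v' v (ltW L0) Lv_le (lv u).
have := sqnD_le (grad_v f u' v' - grad_v f u v') (grad_v f u v' - grad_v f u v).
by rewrite addrA subrK; lra.
Qed.

(** First u moves with v' fixed, then v moves. The u-gradient is thus taken at v', and replacing v'
    by v costs L/2 on each block through [luv]; with the two descent steps this makes 3L/2 <= 2L. *)
Lemma two_block_upper u v u' v' :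
  f u' v' <= f u v + edot (grad_u f u v) (u' - u) + edot (grad_v f u v) (v' - v)
    + 2 * L * (sqn (u' - u) + sqn (v' - v)).
Proof.
have h1 : f u' v' <= f u v' + edot (grad_u f u v') (u' - u) + L * sqn (u' - u).
  by apply: (@lipschitz_grad_upper _ (f^~ v')) Lu_le _ (lu v') => // z; case: (df z v').
have h2 : f u v' <= f u v + edot (grad_v f u v) (v' - v) + L * sqn (v' - v).
  by apply: (@lipschitz_grad_upper _ (f u)) Lv_le _ (lv u) => // z; case: (df u z).
have h3 := @elipschitz_sqn _ _ _ _ _ v' v (ltW L0) Luv_le (luv u).
have := @edot_young _ _ L^-1 (grad_u f u v' - grad_u f u v) (u' - u).
rewrite invrK invr_gt0 => /(_ L0).
rewrite edotDl edotNl => h4.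
have {}h3 : L^-1 * sqn (grad_u f u v' - grad_u f u v) <= L * sqn (v' - v).
  by rewrite ler_pdivrMl // (le_trans h3) // expr2 -mulrA.
have := mulr_ge0 (ltW L0) (sqn_ge0 (u' - u)).
have := mulr_ge0 (ltW L0) (sqn_ge0 (v' - v)).
lra.
Qed.

End TwoBlocks.
End Calculus.

(** * Joint measurability of the iterates and of their gradients *)

Section Measurability.
Context {R : realType}.

Definition vmeasurable dW (W : measurableType dW) d (Y : W -> 'rV[R]_d) : Prop :=
  forall j, measurable_fun setT (fun w => Y w 0 j).

(** The rounded argument takes countably many values, and on each level set the map is a section
    [H^~ a], measurable by hypothesis. *)
Lemma measurable_fun_floor_grid dW (W : measurableType dW) d (Y : W -> 'rV[R]_d)
    (H : W -> 'rV[R]_d -> R) (c : R) :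
  (forall a, measurable_fun setT (H^~ a)) -> vmeasurable Y ->
  measurable_fun setT (fun w => H w (\row_j ((Num.floor (c * Y w 0 j))%:~R / c))).
Proof.
move=> mH mY _ B mB; rewrite setTI.
pose z w : {ffun 'I_d -> int} := [ffun j => Num.floor (c * Y w 0 j)].
pose v (q : {ffun 'I_d -> int}) : 'rV[R]_d := \row_j ((q j)%:~R / c).
have -> : (fun w => H w (\row_j ((Num.floor (c * Y w 0 j))%:~R / c))) @^-1` B
    = \bigcup_q ([set w | z w = q] `&` (H^~ (v q)) @^-1` B).
  apply/seteqP; split => [w /= Bw|w [q _ [/= zq]]].
    exists (z w) => //; split => //=; congr (B (H w _)): Bw.
    by apply/rowP => j; rewrite !mxE ffunE.
  by rewrite /= -zq; congr (B (H w _)); apply/rowP => j; rewrite !mxE ffunE.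
apply: countable_bigcupT_measurable => [|q]; first exact: countableP.
apply: measurableI; last by rewrite -[X in measurable X]setTI; exact: mH.
have -> : [set w | z w = q] = \bigcap_(j in [set: 'I_d])
    [set w | c * Y w 0 j \in `[(q j)%:~R, (q j + 1)%:~R[ ].
  apply/seteqP; split => [w /= <- j _|w h].
    by rewrite /= in_itv /= ffunE floor_itv.
  apply/ffunP => j; rewrite ffunE; apply: floor_def.
  by have := h j I; rewrite /= in_itv.
apply: fin_bigcap_measurable => [|j _]; first exact: finite_finset.
have := @measurable_funM _ _ _ _ (cst c) _ (measurable_cst _) (mY j).
move=> /(_ measurableT _ (measurable_itv `[(q j)%:~R, (q j + 1)%:~R[)).
by rewrite setTI; congr (measurable _); apply/seteqP; split.
Qed.

Lemma floor_grid_cvg d (y : 'rV[R]_d) :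
  (fun k => \row_j ((Num.floor (k.+1%:R * y 0 j))%:~R / k.+1%:R) : 'rV[R]_d) @ \oo --> y.
Proof.
apply/cvg_ballP => e e0; near=> k; split => // i j; rewrite !ord1 mxE.
have k0 : 0 < k.+1%:R :> R by rewrite ltr0n.
have /andP[h1 h2] := floor_itv (k.+1%:R * y 0 j).
have ke : k.+1%:R^-1 < e by near: k; exact: (near_infty_natSinv_lt (PosNum e0)).
rewrite /ball /= ger0_norm.
  rewrite ltrBlDr -ltrBlDl ltr_pdivlMr //.
  have : 1 < e * k.+1%:R by rewrite -ltr_pdivrMr // div1r.
  by move: h2; rewrite intrD; lra.
by rewrite subr_ge0 ler_pdivrMr // (mulrC (y 0 j)).
Unshelve. all: by end_near. Qed.

(** Pointwise limit of the maps with argument rounded to the grid of mesh 1/(k+1), by continuity of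
    [H w]. *)
Lemma measurable_fun_caratheodory dW (W : measurableType dW) d (Y : W -> 'rV[R]_d)
    (H : W -> 'rV[R]_d -> R) :
  (forall a, measurable_fun setT (H^~ a)) -> (forall w, continuous (H w)) ->
  vmeasurable Y -> measurable_fun setT (fun w => H w (Y w)).
Proof.
move=> mH cH mY.
apply: (measurable_fun_cvg (h := fun k w =>
  H w (\row_j ((Num.floor (k.+1%:R * Y w 0 j))%:~R / k.+1%:R)))) => [k|w _].
  exact: measurable_fun_floor_grid.
by apply: continuous_cvg; [exact: cH | exact: floor_grid_cvg].
Qed.

(** The derivative along the countable sequence of increments 1/(k+1), since measurability passes to
    limits of sequences. *)
Lemma derive_seq_cvg d (g : 'rV[R]_d -> R) x e : derivable g x e ->
  (fun k => k.+1%:R * (g (k.+1%:R^-1 *: e + x) - g x)) @ \oo --> 'D_e g x.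
Proof.
move=> dg; have h0 : @harmonic R @ \oo --> (0 : R)^'.
  move=> A A0; have /(_ _ A0) := @cvg_harmonic R.
  by rewrite /nbhs/=; apply: filterS => k; apply; rewrite /harmonic /= invr_neq0 ?pnatr_eq0.
have := cvg_comp _ _ h0 dg; rewrite (_ : _ \o _ = fun k =>
    k.+1%:R * (g (k.+1%:R^-1 *: e + x) - g x)) //.
by apply/funext => k /=; rewrite /harmonic /= invrK.
Qed.

Section TwoArguments.
Context {dW : measure_display} {W : measurableType dW} {X : Type} {du dv : nat}.
Variables (F : X -> 'rV[R]_du -> 'rV[R]_dv -> R) (x : W -> X).
Hypothesis mF : forall u v, measurable_fun setT (fun w => F (x w) u v).
Hypothesis dF : forall y, partially_differentiable (F y).
Variables (U : W -> 'rV[R]_du) (V : W -> 'rV[R]_dv).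
Hypotheses (mU : vmeasurable U) (mV : vmeasurable V).

(** Partial differentiability gives continuity in each block separately, so the Caratheodory
    argument is run once per block. *)
Lemma measurable_fun_joint : measurable_fun setT (fun w => F (x w) (U w) (V w)).
Proof.
apply: (@measurable_fun_caratheodory _ _ _ _ (fun w b => F (x w) (U w) b)) => // [b|w].
  apply: (@measurable_fun_caratheodory _ _ _ _ (fun w a => F (x w) a b)) => // w a.
  by apply: differentiable_continuous; case: (dF (x w) a b).
by move=> b; apply: differentiable_continuous; case: (dF (x w) (U w) b).
Qed.

End TwoArguments.

Lemma vmeasurableD dW (W : measurableType dW) d (Y Z : W -> 'rV[R]_d) :
  vmeasurable Y -> vmeasurable Z -> vmeasurable (fun w => Y w + Z w).
Proof.
by move=> mY mZ j; under eq_fun do rewrite mxE; exact: measurable_funD.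
Qed.

Lemma vmeasurableZ dW (W : measurableType dW) d (c : R) (Y : W -> 'rV[R]_d) :
  vmeasurable Y -> vmeasurable (fun w => c *: Y w).
Proof.
by move=> mY j; under eq_fun do rewrite mxE; exact: measurable_funM.
Qed.

Lemma vmeasurable_cst dW (W : measurableType dW) d (a : 'rV[R]_d) :
  vmeasurable (fun _ : W => a).
Proof. by move=> j; exact: measurable_cst. Qed.

Lemma vmeasurableN dW (W : measurableType dW) d (Y : W -> 'rV[R]_d) :
  vmeasurable Y -> vmeasurable (fun w => - Y w).
Proof. by move=> mY; under eq_fun do rewrite -scaleN1r; exact: vmeasurableZ. Qed.

Lemma vmeasurableB dW (W : measurableType dW) d (Y Z : W -> 'rV[R]_d) :
  vmeasurable Y -> vmeasurable Z -> vmeasurable (fun w => Y w - Z w).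
Proof. by move=> mY mZ; apply: vmeasurableD => //; exact: vmeasurableN. Qed.

Lemma vmeasurable_sum dW (W : measurableType dW) d (I : Type) (r : seq I)
    (Y : I -> W -> 'rV[R]_d) :
  (forall i, vmeasurable (Y i)) -> vmeasurable (fun w => \sum_(i <- r) Y i w).
Proof.
move=> mY; elim: r => [|i r IH].
  by under eq_fun do rewrite big_nil; exact: vmeasurable_cst.
by under eq_fun do rewrite big_cons; exact: vmeasurableD.
Qed.

Lemma vmeasurable_if dW (W : measurableType dW) d (b : W -> bool) (Y Z : W -> 'rV[R]_d) :
  measurable_fun setT b ->
  vmeasurable Y -> vmeasurable Z -> vmeasurable (fun w => if b w then Y w else Z w).
Proof.
move=> mb mY mZ j.
rewrite (_ : (fun w => _) = (fun w => if b w then Y w 0 j else Z w 0 j)).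
  exact: measurable_fun_ifT.
by apply/funext => w; case: ifP.
Qed.

Lemma measurable_edot dW (W : measurableType dW) d (Y Z : W -> 'rV[R]_d) :
  vmeasurable Y -> vmeasurable Z -> measurable_fun setT (fun w => edot (Y w) (Z w)).
Proof.
by move=> mY mZ; apply: measurable_sum => j; exact: measurable_funM.
Qed.

Section Gradients.
Context {dW : measure_display} {W : measurableType dW} {X : Type} {du dv : nat}.
Variables (F : X -> 'rV[R]_du -> 'rV[R]_dv -> R) (x : W -> X).
Hypothesis mF : forall u v, measurable_fun setT (fun w => F (x w) u v).
Hypothesis dF : forall y, partially_differentiable (F y).
Variables (U : W -> 'rV[R]_du) (V : W -> 'rV[R]_dv).
Hypotheses (mU : vmeasurable U) (mV : vmeasurable V).

Lemma vmeasurable_grad_u : vmeasurable (fun w => grad_u (F (x w)) (U w) (V w)).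
Proof.
move=> j; under eq_fun do rewrite mxE.
apply: (measurable_fun_cvg (h := fun k w => k.+1%:R *
  (F (x w) (k.+1%:R^-1 *: delta_mx 0 j + U w) (V w) - F (x w) (U w) (V w)))) => [k|w _].
  apply: measurable_funM => //; apply: measurable_funB; apply: measurable_fun_joint => //.
  by apply: vmeasurableD => //; exact: vmeasurable_cst.
apply: (@derive_seq_cvg _ (fun u => F (x w) u (V w))).
by apply: diff_derivable; case: (dF (x w) (U w) (V w)).
Qed.

Lemma vmeasurable_grad_v : vmeasurable (fun w => grad_v (F (x w)) (U w) (V w)).
Proof.
move=> j; under eq_fun do rewrite mxE.
apply: (measurable_fun_cvg (h := fun k w => k.+1%:R *
  (F (x w) (U w) (k.+1%:R^-1 *: delta_mx 0 j + V w) - F (x w) (U w) (V w)))) => [k|w _].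
  apply: measurable_funM => //; apply: measurable_funB; apply: measurable_fun_joint => //.
  by apply: vmeasurableD => //; exact: vmeasurable_cst.
apply: (@derive_seq_cvg _ (fun v => F (x w) (U w) v)).
by apply: diff_derivable; case: (dF (x w) (U w) (V w)).
Qed.

End Gradients.
End Measurability.

(** * Tonelli and Fubini for an independent pair *)

Section IndependentPair.
Context {R : realType} {d dW dX : measure_display}.
Context {Omega : measurableType d} {W : measurableType dW} {X : measurableType dX}.
Variables (P : probability Omega R) (D : probability X R).
Variables (phi : Omega -> W) (xi : Omega -> X).
Hypotheses (mphi : measurable_fun setT phi) (mxi : measurable_fun setT xi).
Hypothesis indep : forall A B, measurable A -> measurable B ->
  P (phi @^-1` A `&` xi @^-1` B) = (P (phi @^-1` A) * D B)%E.

Let phiM : {mfun Omega >-> W} := HB.pack phi (isMeasurableFun.Build _ _ _ _ _ mphi).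
Let mpair : measurable_fun setT (fun w => (phi w, xi w)).
Proof. exact: measurable_fun_pair. Qed.
Let pairM : {mfun Omega >-> (W * X)%type} :=
  HB.pack (fun w => (phi w, xi w)) (isMeasurableFun.Build _ _ _ _ _ mpair).

(** [indep] states equality on rectangles, which determines the product measure. *)
Let pair_law (A : set (W * X)) : measurable A ->
  (distribution P phiM \x D)%E A = distribution P pairM A.
Proof.
by move=> mA; apply: product_measure_unique.
Qed.

Lemma ge0_integral_indep (h : W * X -> \bar R) : measurable_fun setT h ->
  (forall z, 0 <= h z)%E ->
  (\int[P]_w h (phi w, xi w) = \int[P]_w \int[D]_x h (phi w, x))%E.
Proof.
move=> mh h0.
have -> : (\int[P]_w h (phi w, xi w) = \int[distribution P pairM]_z h z)%E.
  by rewrite ge0_integral_distribution.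
rewrite -(eq_measure_integral _ (fun A mA _ => pair_law mA)).
rewrite fubini_tonelli1 // ge0_integral_distribution //.
  exact: measurable_fun_fubini_tonelli_F.
by move=> y; exact: integral_ge0.
Qed.

Lemma integral_indep0 (h : W * X -> R) : measurable_fun setT h ->
  P.-integrable setT (fun w => (h (phi w, xi w))%:E) ->
  (forall w, \int[D]_x (h (phi w, x))%:E = 0)%E ->
  (\int[P]_w (h (phi w, xi w))%:E = 0)%E.
Proof.
move=> mh ih h0.
have mh' : measurable_fun setT (EFin \o h) by exact/measurable_EFinP.
have -> : (\int[P]_w (h (phi w, xi w))%:E = \int[distribution P pairM]_z (h z)%:E)%E.
  by rewrite integral_distribution.
(* Integrability is known on Omega only; it is carried to the joint law, which is the product,
   before Fubini is applied. *)
have ih' : (distribution P phiM \x D)%E.-integrable setT (EFin \o h).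
  apply/integrableP; split => //.
  rewrite (eq_measure_integral _ (fun A mA _ => pair_law mA)).
  have /integrableP[_] := ih.
  rewrite ge0_integral_distribution //; exact: measurableT_comp.
rewrite -(eq_measure_integral _ (fun A mA _ => pair_law mA)).
rewrite -integral12_prod_meas1 //= integral_distribution //.
- by rewrite integral0_eq // => w _; rewrite /= /fubini_F /= h0.
- exact: (measurable_fubini_F ih').
- apply/integrableP; split.
    by apply: measurableT_comp mphi; exact: (measurable_fubini_F ih').
  rewrite integral0_eq ?ltry// => w _ /=.
  by rewrite /fubini_F h0 abse0.
Qed.

End IndependentPair.

(** * Independence of one draw from the sigma-algebra of all the others *)

Section OtherDraws.
Context {R : realType} {d : measure_display} {Omega : measurableType d}.
Variables (P : probability Omega R) (I : finType) (G : I -> set_system Omega).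
Hypothesis GT : forall i, G i setT.
Hypothesis GI : forall i, setI_closed (G i).
Hypothesis Gm : forall i, G i `<=` measurable.
Hypothesis indG : mutually_independent P G.

(** Finite intersections of one event per draw: a pi-system that generates the sigma-algebra of the
    draws other than q and on which mutual independence applies directly. *)
Definition others (q : I) : set_system Omega :=
  [set A | exists E : I -> set Omega, (forall i, G i (E i)) /\
     A = \bigcap_(i in [set` [set~ q]%SET]) E i].

Lemma others_setI q : setI_closed (others q).
Proof.
move=> A B [E [GE ->]] [E' [GE' ->]]; exists (fun i => E i `&` E' i); split.
  by move=> i; exact: GI.
by rewrite bigcapI.
Qed.

Lemma others_T q : others q setT.
Proof. by exists (fun=> setT); split => //; rewrite bigcapT. Qed.

Lemma others_measurable q : others q `<=` measurable.
Proof.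
move=> A [E [GE ->]]; apply: fin_bigcap_measurable; first exact: finite_finset.
by move=> i _; exact: Gm.
Qed.

Lemma others_gen q i A : i != q -> G i A -> others q A.
Proof.
move=> iq GA; exists (fun j => if j == i then A else setT); split.
  by move=> j; case: eqP => [->|].
apply/seteqP; split=> [w Aw j _|w /(_ i)]; first by case: eqP.
by rewrite eqxx; apply; rewrite /= !inE.
Qed.

Lemma others_indep0 q A B : others q A -> G q B -> P (A `&` B) = (P A * P B)%E.
Proof.
move=> [E [GE ->]] GB.
pose E' i := if i == q then B else E i.
have GE' i : G i (E' i) by rewrite /E'; case: eqP => [->|].
have e : \bigcap_(i in [set` [set~ q]%SET]) E i `&` B = \bigcap_(i in [set` [set: I]%SET]) E' i.
  apply/seteqP; split=> [w [h Bw] i _|w h]; rewrite /E'.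
    by case: eqP => // /eqP iq; apply: h; rewrite /= !inE.
  split=> [i|]; last by have := h q; rewrite /E' eqxx; apply; rewrite /= inE.
  by rewrite /= !inE => iq; have := h i; rewrite /E' (negbTE iq); apply; rewrite /= inE.
rewrite e (indG (J := [set: I]%SET)) // (indG (J := [set~ q]%SET)) //.
rewrite (bigD1 q) ?inE //= /E' eqxx muleC; congr (_ * _)%E.
by apply: eq_big => [i|i /andP[_ iq]]; rewrite ?inE // (negbTE iq).
Qed.

(** For fixed B, the finite measures A -> P(A and B) and A -> P(B) P(A) agree on the pi-system
    [others q], hence on the sigma-algebra it generates. *)
Lemma others_indep q A B : <<s others q >> A -> G q B -> P (A `&` B) = (P A * P B)%E.
Proof.
move=> sA GB; have mB := Gm GB.
have p0 : 0 <= fine (P B) by rewrite fine_ge0.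
have PB : ((fine (P B))%:E = P B)%E by rewrite fineK ?fin_num_measure.
have : mrestr P mB A = mscale (NngNum p0) P A.
  apply: (g_sigma_algebra_measure_unique (others q) (@others_measurable q)
    (fun=> setT) (fun=> others_T q)) => //.
  - by rewrite bigcup_const.
  - exact: others_setI.
  - move=> C oC; change (P (C `&` B) = (fine (P B))%:E * P C)%E.
    by rewrite PB muleC; have := (others_indep0 oC GB).
  - move=> _; change (P (setT `&` B) < +oo)%E.
    by rewrite setTI; apply: le_lt_trans (probability_le1 _ mB) _; rewrite ltry.
change (P (A `&` B) = (fine (P B))%:E * P A -> P (A `&` B) = P A * P B)%E.
by move=> ->; rewrite PB muleC.
Qed.

End OtherDraws.

(** * Real expectations and square-integrable random vectors *)

Section Moments.
Context {R : realType} {d : measure_display} {Omega : measurableType d}.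
Variable P : probability Omega R.
Implicit Types (X Y : Omega -> R).

Definition rintegrable Y : Prop := P.-integrable setT (EFin \o Y).
Definition Ex Y : R := \int[P]_w Y w.

Lemma ExE Y : rintegrable Y -> (\int[P]_w (Y w)%:E = (Ex Y)%:E)%E.
Proof. by move=> iY; rewrite /Ex /Rintegral fineK //; exact: integrable_fin_num. Qed.

Lemma rintegrable_cst c : rintegrable (fun=> c).
Proof. exact: finite_measure_integrable_cst. Qed.

Lemma rintegrableD X Y : rintegrable X -> rintegrable Y -> rintegrable (fun w => X w + Y w).
Proof. exact: integrableD. Qed.

Lemma rintegrableB X Y : rintegrable X -> rintegrable Y -> rintegrable (fun w => X w - Y w).
Proof. exact: integrableB. Qed.

Lemma rintegrableZ c Y : rintegrable Y -> rintegrable (fun w => c * Y w).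
Proof. exact: integrableZl. Qed.

Lemma rintegrable_sum (I : Type) (r : seq I) (Q : pred I) (Y : I -> Omega -> R) :
  (forall i, Q i -> rintegrable (Y i)) -> rintegrable (fun w => \sum_(i <- r | Q i) Y i w).
Proof.
move=> iY; rewrite /rintegrable (_ : EFin \o _ = fun w => (\sum_(i <- r | Q i) (Y i w)%:E)%E).
  by apply: integrable_sum => // i /iY.
by apply/funext => w; rewrite /= sumEFin.
Qed.

Lemma rintegrable_mean n (Y : 'I_n -> Omega -> R) :
  (forall i, rintegrable (Y i)) -> rintegrable (fun w => mean (Y^~ w)).
Proof. by move=> iY; apply: rintegrableZ; apply: rintegrable_sum => i _. Qed.

Lemma rintegrable_le X Y : measurable_fun setT X -> rintegrable Y ->
  (forall w, `|X w| <= Y w) -> rintegrable X.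
Proof.
move=> mX iY XY; apply: le_integrable iY => //; first exact/measurable_EFinP.
by move=> w _; rewrite /= lee_fin (le_trans (XY w)) // ler_norm.
Qed.

Lemma ExD X Y : rintegrable X -> rintegrable Y -> Ex (fun w => X w + Y w) = Ex X + Ex Y.
Proof. exact: RintegralD. Qed.

Lemma ExB X Y : rintegrable X -> rintegrable Y -> Ex (fun w => X w - Y w) = Ex X - Ex Y.
Proof. exact: RintegralB. Qed.

Lemma ExZ c Y : rintegrable Y -> Ex (fun w => c * Y w) = c * Ex Y.
Proof. exact: RintegralZl. Qed.

Lemma Ex_cst c : Ex (fun=> c) = c.
Proof. by rewrite /Ex Rintegral_cst // [X in fine X]probability_setT mulr1. Qed.

Lemma eq_Ex X Y : X =1 Y -> Ex X = Ex Y.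
Proof. by move=> XY; congr (Ex _); apply/funext. Qed.

Lemma Ex_sum (I : Type) (r : seq I) (Q : pred I) (Y : I -> Omega -> R) :
  (forall i, rintegrable (Y i)) ->
  Ex (fun w => \sum_(i <- r | Q i) Y i w) = \sum_(i <- r | Q i) Ex (Y i).
Proof.
move=> iY; elim: r => [|i r IH].
  by rewrite big_nil -[RHS](Ex_cst 0); apply: eq_Ex => w; rewrite big_nil.
rewrite big_cons -IH; case: ifP => Qi; last by apply: eq_Ex => w; rewrite big_cons Qi.
rewrite -ExD //; last by apply: rintegrable_sum.
by apply: eq_Ex => w; rewrite big_cons Qi.
Qed.

Lemma Ex_mean n (Y : 'I_n -> Omega -> R) : (forall i, rintegrable (Y i)) ->
  Ex (fun w => mean (Y^~ w)) = mean (fun i => Ex (Y i)).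
Proof. by move=> iY; rewrite ExZ ?Ex_sum //; apply: rintegrable_sum. Qed.

Lemma le_Ex X Y : rintegrable X -> rintegrable Y -> (forall w, X w <= Y w) -> Ex X <= Ex Y.
Proof. by move=> iX iY XY; apply: le_Rintegral. Qed.

Definition vL2 e (Y : Omega -> 'rV[R]_e) : Prop :=
  vmeasurable Y /\ rintegrable (fun w => sqn (Y w)).

Lemma vL2_le e (Y : Omega -> 'rV[R]_e) X : vmeasurable Y -> rintegrable X ->
  (forall w, sqn (Y w) <= X w) -> vL2 Y.
Proof.
move=> mY iX YX; split => //; apply: rintegrable_le iX _; first exact: measurable_edot.
by move=> w; rewrite ger0_norm ?sqn_ge0.
Qed.

Lemma vL2_cst e (a : 'rV[R]_e) : vL2 (fun=> a).
Proof. by split; [exact: vmeasurable_cst | exact: rintegrable_cst]. Qed.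

Lemma vL2D e (Y Z : Omega -> 'rV[R]_e) : vL2 Y -> vL2 Z -> vL2 (fun w => Y w + Z w).
Proof.
move=> [mY iY] [mZ iZ].
apply: (vL2_le (vmeasurableD mY mZ) (rintegrableZ 2 (rintegrableD iY iZ))) => w.
exact: sqnD_le.
Qed.

Lemma vL2Z e c (Y : Omega -> 'rV[R]_e) : vL2 Y -> vL2 (fun w => c *: Y w).
Proof.
move=> [mY iY]; split; first exact: vmeasurableZ.
by under eq_fun do rewrite sqnZ; exact: rintegrableZ.
Qed.

Lemma vL2N e (Y : Omega -> 'rV[R]_e) : vL2 Y -> vL2 (fun w => - Y w).
Proof. by move=> lY; under eq_fun do rewrite -scaleN1r; exact: vL2Z. Qed.

Lemma vL2B e (Y Z : Omega -> 'rV[R]_e) : vL2 Y -> vL2 Z -> vL2 (fun w => Y w - Z w).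
Proof. by move=> lY lZ; apply: vL2D => //; exact: vL2N. Qed.

Lemma vL2_sum e (I : Type) (r : seq I) (Q : pred I) (Y : I -> Omega -> 'rV[R]_e) :
  (forall i, vL2 (Y i)) -> vL2 (fun w => \sum_(i <- r | Q i) Y i w).
Proof.
move=> lY; elim: r => [|i r IH].
  by under eq_fun do rewrite big_nil; exact: vL2_cst.
by under eq_fun do rewrite big_cons; case: (Q i); [exact: vL2D | exact: IH].
Qed.

Lemma vL2_vmean e n (Y : 'I_n -> Omega -> 'rV[R]_e) :
  (forall i, vL2 (Y i)) -> vL2 (fun w => vmean (Y^~ w)).
Proof. by move=> lY; apply: vL2Z; exact: vL2_sum. Qed.

Lemma vL2_if e (b : Omega -> bool) (Y Z : Omega -> 'rV[R]_e) : measurable_fun setT b ->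
  vL2 Y -> vL2 Z -> vL2 (fun w => if b w then Y w else Z w).
Proof.
move=> mb [mY iY] [mZ iZ].
apply: (vL2_le (vmeasurable_if mb mY mZ) (rintegrableD iY iZ)) => w.
by case: (b w); rewrite ?lerDl ?lerDr sqn_ge0.
Qed.

Lemma rintegrable_edot e (Y Z : Omega -> 'rV[R]_e) : vL2 Y -> vL2 Z ->
  rintegrable (fun w => edot (Y w) (Z w)).
Proof.
move=> [mY iY] [mZ iZ].
apply: (rintegrable_le (measurable_edot mY mZ) (rintegrableD iY iZ)) => w.
have h1 := edot_young (Y w) (Z w) (ltr01 : 0 < 1 :> R).
have := edot_young (- Y w) (Z w) (ltr01 : 0 < 1 :> R).
rewrite sqnN edotNl => h2; rewrite invr1 !mul1r in h1 h2.
have := sqn_ge0 (Y w); have := sqn_ge0 (Z w).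
by rewrite ler_norml; lra.
Qed.

Lemma vL2_coord e (Y : Omega -> 'rV[R]_e) j : vL2 Y -> rintegrable (fun w => Y w 0 j).
Proof.
move=> lY; have := rintegrable_edot lY (vL2_cst (delta_mx 0 j)).
congr (rintegrable _); apply/funext => w; rewrite /edot (bigD1 j) //= big1.
  by rewrite mxE !eqxx mulr1 addr0.
by move=> i /negbTE ij; rewrite mxE ij andbF mulr0.
Qed.

Lemma Ex_sqn_sum_orthogonal e (J : finType) (Q : pred J) (Z : J -> Omega -> 'rV[R]_e) (s : R) :
  (forall j, vL2 (Z j)) ->
  (forall j j', j != j' -> Ex (fun w => edot (Z j w) (Z j' w)) = 0) ->
  (forall j, Ex (fun w => sqn (Z j w)) <= s) ->
  Ex (fun w => sqn (\sum_(j | Q j) Z j w)) <= #|Q|%:R * s.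
Proof.
move=> lZ oZ sZ.
rewrite (eq_Ex (Y := fun w => \sum_(j | Q j) \sum_(j' | Q j') edot (Z j w) (Z j' w))).
  rewrite Ex_sum => [|j]; last by apply: rintegrable_sum => j' _; exact: rintegrable_edot.
  rewrite -sum1_card natr_sum mulr_suml; apply: ler_sum => j Qj; rewrite mul1r.
  rewrite Ex_sum => [|j']; last exact: rintegrable_edot.
  rewrite (bigD1 j) //= big1 ?addr0 => [|j' /andP[_ jj']]; first exact: sZ.
  by rewrite oZ // eq_sym.
by move=> w; rewrite /sqn edot_suml; apply: eq_bigr => j _; rewrite edot_sumr.
Qed.

End Moments.

(** * Centred noise produced by a fresh sample *)

Section Noise.
Context {R : realType} {d dW dX : measure_display}.
Context {Omega : measurableType d} {W : measurableType dW} {X : measurableType dX}.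
Variables (P : probability Omega R) (D : probability X R).
Variables (phi : Omega -> W) (xi : Omega -> X).
Hypotheses (mphi : measurable_fun setT phi) (mxi : measurable_fun setT xi).
Hypothesis indep : forall A B, measurable A -> measurable B ->
  P (phi @^-1` A `&` xi @^-1` B) = (P (phi @^-1` A) * D B)%E.
Variables (e : nat) (g : W * X -> 'rV[R]_e) (s2 : R).
Hypothesis mg : vmeasurable g.
Hypothesis g_mean : forall w j, (\int[D]_x (g (phi w, x) 0 j)%:E = 0)%E.
Hypothesis g_var : forall w, (\int[D]_x (sqn (g (phi w, x)))%:E <= s2%:E)%E.

Lemma rintegrable_ge0_le d' (T : measurableType d') (Q : probability T R) (Y : T -> R) c :
  measurable_fun setT Y -> (forall w, 0 <= Y w) -> (\int[Q]_w (Y w)%:E <= c%:E)%E ->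
  rintegrable Q Y.
Proof.
move=> mY Y0 Yc; apply/integrableP; split; first exact/measurable_EFinP.
rewrite (eq_integral (fun w => (Y w)%:E)) => [|w _]; last by rewrite /= ger0_norm.
by apply: le_lt_trans Yc _; rewrite ltry.
Qed.

(** Tonelli: the inner integral is at most s2 whatever phi is. Square integrability is a conclusion
    here, obtained from the bound itself. *)
Lemma noise_sqn : vL2 P (fun w => g (phi w, xi w)) /\
  Ex P (fun w => sqn (g (phi w, xi w))) <= s2.
Proof.
have mpair : measurable_fun setT (fun w => (phi w, xi w)) by exact: measurable_fun_pair.
have mgw : vmeasurable (fun w => g (phi w, xi w)).
  by move=> j; exact: (measurableT_comp (mg j) mpair).
have le : (\int[P]_w (sqn (g (phi w, xi w)))%:E <= s2%:E)%E.
  rewrite (@ge0_integral_indep _ _ _ _ _ _ _ P D phi xi mphi mxi indep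
    (fun z => (sqn (g z))%:E)).
  - have -> : s2%:E = (\int[P]_w s2%:E)%E.
      by rewrite integral_cst // [X in (_ * X)%E]probability_setT mule1.
    apply: ge0_le_integral => //.
    + by move=> w _; apply: integral_ge0 => x _; rewrite lee_fin sqn_ge0.
    + have mF : measurable_fun setT (fun w => \int[D]_x (sqn (g (w, x)))%:E)%E.
        apply: (@measurable_fun_fubini_tonelli_F _ _ _ _ _ D (fun z => (sqn (g z))%:E)).
          exact/measurable_EFinP/measurable_edot.
        by move=> z; rewrite lee_fin sqn_ge0.
      exact: (measurableT_comp mF mphi).
  - exact/measurable_EFinP/measurable_edot.
  - by move=> z; rewrite lee_fin sqn_ge0.
have i2 : rintegrable P (fun w => sqn (g (phi w, xi w))).
  apply: rintegrable_ge0_le le => [|w]; first exact: measurable_edot.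
  exact: sqn_ge0.
split; first by split.
by rewrite -lee_fin -ExE.
Qed.

(** With phi frozen, the inner integral is the product of the mean noise, 0, with a fixed vector;
    the variance bound makes each coordinate integrable. *)
Lemma noise_orthogonal (Y : W -> 'rV[R]_e) : vmeasurable Y -> vL2 P (fun w => Y (phi w)) ->
  Ex P (fun w => edot (g (phi w, xi w)) (Y (phi w))) = 0.
Proof.
move=> mY lY; have [lg _] := noise_sqn.
have h0 : (\int[P]_w (edot (g (phi w, xi w)) (Y (phi w)))%:E = 0)%E.
  apply: (@integral_indep0 _ _ _ _ _ _ _ P D phi xi mphi mxi indep
    (fun z => edot (g z) (Y z.1))).
  - apply: measurable_edot => // j; exact: (measurableT_comp (mY j) measurable_fst).
  - exact: rintegrable_edot.
  - move=> w; rewrite /=.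
    have mgx : vmeasurable (fun x => g (phi w, x)).
      by move=> j; exact: (measurableT_comp (mg j) (pair1_measurable (phi w))).
    have lgx : vL2 D (fun x => g (phi w, x)).
      split => //; apply: rintegrable_ge0_le (g_var w); first exact: measurable_edot.
      by move=> x; exact: sqn_ge0.
    have ig j : rintegrable D (fun x => g (phi w, x) 0 j) by exact: vL2_coord.
    rewrite ExE; last exact: rintegrable_edot lgx (vL2_cst _ _).
    rewrite /edot Ex_sum => [|j]; last first.
      by under eq_fun do rewrite mulrC; exact: rintegrableZ.
    rewrite big1 // => j _.
    rewrite (eq_Ex D (Y := fun x => Y (phi w) 0 j * g (phi w, x) 0 j)) => [|x]; last exact: mulrC.
    by rewrite ExZ // /Ex /Rintegral g_mean mulr0.
by rewrite /Ex /Rintegral h0.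
Qed.

End Noise.

(** * Expectation restricted to an independent event *)

Section IndependentEvent.
Context {R : realType} {d dW : measure_display}.
Context {Omega : measurableType d} {W : measurableType dW}.
Variables (P : probability Omega R) (phi : Omega -> W).
Hypothesis mphi : measurable_fun setT phi.

(** [integral_indep0] is applied to (1_B - p) Y, whose integral over B vanishes when phi is
    frozen. *)
Lemma Ex_indep_event (B : Omega -> bool) (Y : W -> R) (p : R) :
  measurable_fun setT B -> P (B @^-1` [set true]) = p%:E ->
  (forall A C, measurable A ->
    P (phi @^-1` A `&` B @^-1` C) = (P (phi @^-1` A) * P (B @^-1` C))%E) ->
  measurable_fun setT Y -> rintegrable P (fun w => Y (phi w)) ->
  rintegrable P (fun w => (B w)%:R * Y (phi w)) /\
  Ex P (fun w => (B w)%:R * Y (phi w)) = p * Ex P (fun w => Y (phi w)).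
Proof.
move=> mB PB indB mY iY.
have mB1 : measurable (B @^-1` [set true]).
  by rewrite -[X in measurable X]setTI; exact: (mB measurableT).
pose BM : {mfun Omega >-> bool} := HB.pack B (isMeasurableFun.Build _ _ _ _ _ mB).
have mnat : measurable_fun setT (fun b : bool => b%:R : R) by [].
have mBR : measurable_fun setT (fun w => (B w)%:R : R).
  exact: (measurableT_comp mnat mB).
have iBY : rintegrable P (fun w => (B w)%:R * Y (phi w)).
  apply: le_integrable iY => //.
    apply/measurable_EFinP; apply: measurable_funM => //.
    exact: (measurableT_comp mY mphi).
  by move=> w _; rewrite /= lee_fin normrM; case: (B w); rewrite /= ?normr1 ?normr0 ?mul1r ?mul0r.
split => //.
have h0 : (\int[P]_w (((B w)%:R - p) * Y (phi w))%:E = 0)%E.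
  apply: (@integral_indep0 _ _ _ _ _ _ _ P (distribution P BM) phi B mphi mB _
    (fun z => (z.2%:R - p) * Y z.1)).
  - by move=> A C mA mC; exact: indB.
  - apply: measurable_funM; last exact: (measurableT_comp mY measurable_fst).
    apply: measurable_funB => //.
    exact: (measurableT_comp mnat measurable_snd).
  - under eq_fun do rewrite mulrBl.
    by apply: rintegrableB => //; exact: rintegrableZ.
  - move=> w /=; have mc : measurable_fun setT (fun b : bool => (b%:R - p) * Y (phi w)).
      by apply: measurable_funM => //; apply: measurable_funB.
    have iB : rintegrable P (fun w => (B w)%:R : R).
      apply: rintegrable_le (rintegrable_cst P 1) _ => // w'.
      by case: (B w'); rewrite /= ?normr1 ?normr0.
    have iBp : rintegrable P (fun w' => (B w')%:R - p).
      by apply: rintegrableB iB (rintegrable_cst P p).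
    have iBc : rintegrable P (fun w' => ((B w')%:R - p) * Y (phi w)).
      by under eq_fun do rewrite mulrC; exact: rintegrableZ.
    rewrite (integral_distribution (f := fun b : bool => ((b%:R - p) * Y (phi w))%:E)) //.
    rewrite [LHS](ExE iBc) (eq_Ex P (Y := fun w' => Y (phi w) * ((B w')%:R - p))) => [|w']; last exact: mulrC.
    rewrite ExZ // ExB //; last exact: rintegrable_cst.
    rewrite Ex_cst (_ : Ex P _ = p) ?subrr ?mulr0 //.
    rewrite /Ex /Rintegral (eq_integral (fun w => (\1_(B @^-1` [set true]) w)%:E)) => [|w' _].
      by rewrite integral_indic // setIT [X in fine X]PB.
    rewrite indicE; congr (_%:R%:E); case Bw : (B w'); first by rewrite mem_set.
    by rewrite memNset //= Bw.
have : Ex P (fun w => (B w)%:R * Y (phi w) - p * Y (phi w)) = 0.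
  by rewrite /Ex /Rintegral; under eq_integral do rewrite -mulrBl; rewrite h0.
rewrite ExB // ?ExZ //; last exact: rintegrableZ.
by move/subr0_eq.
Qed.

End IndependentEvent.

(** * The trajectory, its anchors and its clean controls *)

Section Trajectory.
Context {R : realType} {X W : Type} {du dv n : nat}.
Variables (F : X -> 'rV[R]_du -> 'rV[R]_dv -> R) (m K : nat).
Variables gamma_u gamma_v eta_u eta_v : R.
Variables (u0 : 'rV[R]_du) (v0 : 'I_n -> 'rV[R]_dv).
Variables (f : 'I_n -> 'rV[R]_du -> 'rV[R]_dv -> R).
Variables (x : nat -> 'I_n -> nat -> W -> X) (Sg : nat -> W -> {set 'I_n}).

(** The index type W is arbitrary, so the same trajectory can be read on Omega or on Omega with a
    smaller sigma-algebra. *)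
Definition state t w := scaffold_run F m K gamma_u gamma_v eta_u eta_v u0 v0
  (fun s i k => x s i k w) (fun t => Sg t w) t.

Definition local_u t i k w :=
  (local_iterate F gamma_u gamma_v (state t w) i (fun l => x t.+1 i l w) k).1.
Definition local_v t i k w :=
  (local_iterate F gamma_u gamma_v (state t w) i (fun l => x t.+1 i l w) k).2.

Definition sgrad_u t i k w := grad_u (F (x t.+1 i k w)) (local_u t i k w) (local_v t i k w).
Definition sgrad_v t i k w := grad_v (F (x t.+1 i k w)) (local_u t i k w) (local_v t i k w).
Definition lgrad_u t i k w := grad_u (f i) (local_u t i k w) (local_v t i k w).
Definition lgrad_v t i k w := grad_v (f i) (local_u t i k w) (local_v t i k w).

(* The shared variable at the start of the last round in which client i took
   part, and the control variate of client i freed of its sampling noise. *)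
Fixpoint anchor t i w : 'rV[R]_du :=
  if t is t'.+1 then
    if i \in Sg t' w then shared (state t' w) else anchor t' i w
  else u0.

Fixpoint clean_control t i w : 'rV[R]_du :=
  if t is t'.+1 then
    if i \in Sg t' w then vmean (fun k : 'I_K => lgrad_u t' i k w)
    else clean_control t' i w
  else grad_u (f i) u0 (v0 i).

Lemma local_uS t i k w : local_u t i k.+1 w = local_u t i k w - gamma_u *:
  (sgrad_u t i k w - control (state t w) i + mean_control (state t w)).
Proof. by rewrite /sgrad_u /local_u /local_v /=; case: (local_iterate _ _ _ _ _ _ k). Qed.

Lemma local_vS t i k w :
  local_v t i k.+1 w = local_v t i k w - gamma_v *: sgrad_v t i k w.
Proof. by rewrite /sgrad_v /local_u /local_v /=; case: (local_iterate _ _ _ _ _ _ k). Qed.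

Lemma local_iterate_sum t i k w :
  local_u t i k w = shared (state t w) - gamma_u *: \sum_(l < k)
    (sgrad_u t i l w - control (state t w) i + mean_control (state t w)) /\
  local_v t i k w = personal (state t w) i - gamma_v *: \sum_(l < k) sgrad_v t i l w.
Proof.
elim: k => [|k [IHu IHv]]; first by rewrite !big_ord0 !scaler0 !subr0.
by rewrite !big_ord_recr /= !scalerDr !opprD !addrA -IHu -IHv local_uS local_vS !scalerDr !opprD !addrA.
Qed.

(** An invariant of the algorithm: a round adds to the shared control exactly 1/n times the
    increments of the individual ones. *)
Lemma mean_control_vmean t w : mean_control (state t w) = vmean (control (state t w)).
Proof.
elim: t => [|t IH] //.
rewrite /state /= -/(state t w) IH -scalerDr; congr (_ *: _).
rewrite [X in _ + X]big_mkcond -big_split /=; apply: eq_bigr => i _.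
by case: (i \in Sg t w); rewrite ?addr0 // subrKC.
Qed.

(** In u - U_K the correction -c_i + c is summed K times; after division by K [gamma_u] it cancels
    against c_i - c and leaves the mean stochastic gradient. *)
Lemma control_round t i w : (0 < K)%N -> gamma_u != 0 -> i \in Sg t w ->
  control (state t.+1 w) i = vmean (fun k : 'I_K => sgrad_u t i k w).
Proof.
move=> K0 g0 iS; rewrite /state /= -/(state t w) iS.
have [uE _] := local_iterate_sum t i K w.
rewrite -/(local_u t i K w) uE subKr scalerA invfM -mulrA mulVf // mulr1.
rewrite -/(vmean _) vmeanD vmeanB !vmean_cst //.
by rewrite addrC addrACA subrK subrr addr0.
Qed.

End Trajectory.

(** * Which draws each iterate depends on *)

Section TrajectoryMeasurable.
Context {R : realType} {dW dX : measure_display}.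
Context {W : measurableType dW} {X : measurableType dX} {du dv n : nat}.
Variables (F : X -> 'rV[R]_du -> 'rV[R]_dv -> R) (m K : nat).
Variables gamma_u gamma_v eta_u eta_v : R.
Variables (u0 : 'rV[R]_du) (v0 : 'I_n -> 'rV[R]_dv).
Variables (f : 'I_n -> 'rV[R]_du -> 'rV[R]_dv -> R).
Variables (x : nat -> 'I_n -> nat -> W -> X) (Sg : nat -> W -> {set 'I_n}).
Hypothesis mF : forall u v, measurable_fun setT (fun y => F y u v).
Hypothesis dF : forall y, partially_differentiable (F y).
Hypothesis df : forall i, partially_differentiable (f i).

Notation st := (state F m K gamma_u gamma_v eta_u eta_v u0 v0 x Sg).
Notation lu := (local_u F m K gamma_u gamma_v eta_u eta_v u0 v0 x Sg).
Notation lv := (local_v F m K gamma_u gamma_v eta_u eta_v u0 v0 x Sg).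
Notation gru := (sgrad_u F m K gamma_u gamma_v eta_u eta_v u0 v0 x Sg).
Notation grv := (sgrad_v F m K gamma_u gamma_v eta_u eta_v u0 v0 x Sg).
Notation lgu := (lgrad_u F m K gamma_u gamma_v eta_u eta_v u0 v0 f x Sg).
Notation lgv := (lgrad_v F m K gamma_u gamma_v eta_u eta_v u0 v0 f x Sg).
Notation anc := (anchor F m K gamma_u gamma_v eta_u eta_v u0 v0 x Sg).
Notation cln := (clean_control F m K gamma_u gamma_v eta_u eta_v u0 v0 f x Sg).

Definition state_measurable (s : W -> @scaffold_state R du dv n) : Prop :=
  [/\ vmeasurable (fun w => shared (s w)),
      forall i, vmeasurable (fun w => personal (s w) i),
      forall i, vmeasurable (fun w => control (s w) i) &
      vmeasurable (fun w => mean_control (s w))].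

Lemma vmeasurable_sgrad (y : W -> X) (U : W -> 'rV[R]_du) (V : W -> 'rV[R]_dv) :
  measurable_fun setT y -> vmeasurable U -> vmeasurable V ->
  vmeasurable (fun w => grad_u (F (y w)) (U w) (V w)) /\
  vmeasurable (fun w => grad_v (F (y w)) (U w) (V w)).
Proof.
move=> my mU mV; have mFy u v : measurable_fun setT (fun w => F (y w) u v).
  exact: (measurableT_comp (mF u v) my).
by split; [exact: vmeasurable_grad_u | exact: vmeasurable_grad_v].
Qed.

Lemma vmeasurable_lgrad i (U : W -> 'rV[R]_du) (V : W -> 'rV[R]_dv) :
  vmeasurable U -> vmeasurable V ->
  vmeasurable (fun w => grad_u (f i) (U w) (V w)) /\
  vmeasurable (fun w => grad_v (f i) (U w) (V w)).
Proof.
move=> mU mV.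
have mfi u v : measurable_fun setT (fun _ : W => f i u v) by exact: measurable_cst.
split.
  exact: (@vmeasurable_grad_u _ _ _ _ _ _ (fun=> f i) id).
exact: (@vmeasurable_grad_v _ _ _ _ _ _ (fun=> f i) id).
Qed.

(** The strict bound l < k is the point: iterate k does not involve sample k, so that sample is
    fresh for it. *)
Lemma local_measurable t i k : state_measurable (st t) ->
  (forall l, (l < k)%N -> measurable_fun setT (x t.+1 i l)) ->
  vmeasurable (lu t i k) /\ vmeasurable (lv t i k).
Proof.
move=> [mu mv mc mm]; rewrite /local_u /local_v; elim: k => [|k IH] mx //=.
have [IHu IHv] := IH (fun l lk => mx l (ltnW lk)).
have [gu gv] := vmeasurable_sgrad (mx k (ltnSn k)) IHu IHv.
split.
  rewrite (_ : (fun w => _) = fun w => lu t i k w -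
    gamma_u *: (gru t i k w - control (st t w) i + mean_control (st t w))).
    by apply: vmeasurableB => //; apply: vmeasurableZ; apply: vmeasurableD => //; apply: vmeasurableB.
  by apply/funext => w; exact: local_uS.
rewrite (_ : (fun w => _) = fun w => lv t i k w - gamma_v *: grv t i k w).
  by apply: vmeasurableB => //; apply: vmeasurableZ.
by apply/funext => w; exact: local_vS.
Qed.

Lemma measurable_mem t i : (forall C, measurable (Sg t @^-1` C)) ->
  measurable_fun setT (fun w => i \in Sg t w).
Proof.
move=> mS _ C _; rewrite setTI; have := mS [set A : {set 'I_n} | C (i \in A)].
by congr (measurable _).
Qed.

Lemma round_measurable t : state_measurable (st t) ->
  (forall i k, (k < K)%N -> measurable_fun setT (x t.+1 i k)) ->
  (forall C, measurable (Sg t @^-1` C)) -> state_measurable (st t.+1).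
Proof.
move=> mst mx mS; have [mu mv mc mm] := mst.
have mlu i : vmeasurable (lu t i K) by case: (local_measurable mst (mx i)).
have mlv i : vmeasurable (lv t i K) by case: (local_measurable mst (mx i)).
have mC i : vmeasurable (fun w => if i \in Sg t w then control (st t w) i - mean_control (st t w)
    + (K%:R * gamma_u)^-1 *: (shared (st t w) - lu t i K w) else control (st t w) i).
  apply: vmeasurable_if => //; first exact: measurable_mem.
  apply: vmeasurableD; first exact: vmeasurableB.
  by apply: vmeasurableZ; exact: vmeasurableB.
split => /=.
- apply: vmeasurableD; first exact: vmeasurableZ.
  apply: vmeasurableZ; under eq_fun do rewrite big_mkcond.
  apply: vmeasurable_sum => i; apply: vmeasurable_if; [exact: measurable_mem | exact: mlu |].
  exact: vmeasurable_cst.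
- move=> i; apply: vmeasurable_if => //; first exact: measurable_mem.
  by apply: vmeasurableD; apply: vmeasurableZ => //; exact: mlv.
- exact: mC.
- apply: vmeasurableD => //; apply: vmeasurableZ; under eq_fun do rewrite big_mkcond.
  apply: vmeasurable_sum => i; apply: vmeasurable_if; first exact: measurable_mem.
    by apply: vmeasurableB => //; exact: mC.
  exact: vmeasurable_cst.
Qed.

(** Because sampling times are shifted by one, the state t involves samples of times s <= t but
    subsets of times s < t. *)
Lemma run_measurable t :
  (forall s i k, (s <= t)%N -> (k < K)%N -> measurable_fun setT (x s i k)) ->
  (forall s, (s < t)%N -> forall C, measurable (Sg s @^-1` C)) ->
  state_measurable (st t).
Proof.
elim: t => [|t IH] mx mS.
  have mc i : vmeasurable (fun w => K%:R^-1 *: \sum_(k < K) grad_u (F (x 0%N i k w)) u0 (v0 i)).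
    apply: vmeasurableZ; apply: vmeasurable_sum => k.
    by apply: (vmeasurable_sgrad _ _ _).1; [exact: mx | |]; exact: vmeasurable_cst.
  split => [|i||] /=; try exact: vmeasurable_cst.
    exact: mc.
  by apply: vmeasurableZ; apply: vmeasurable_sum.
apply: round_measurable.
- apply: IH => [s i k st kK|s st]; first by apply: mx; rewrite // leqW.
  by apply: mS; rewrite ltnW // ltnS.
- by move=> i k kK; exact: mx.
- exact: mS.
Qed.

Lemma anchor_measurable t :
  (forall s i k, (s <= t)%N -> (k < K)%N -> measurable_fun setT (x s i k)) ->
  (forall s, (s < t)%N -> forall C, measurable (Sg s @^-1` C)) ->
  forall i, vmeasurable (anc t i) /\ vmeasurable (cln t i).
Proof.
elim: t => [|t IH] mx mS i; first by split; exact: vmeasurable_cst.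
have mst : state_measurable (st t).
  apply: run_measurable => [s j k st kK|s st]; first by apply: mx; rewrite // leqW.
  by apply: mS; rewrite ltnW // ltnS.
have [ma mc] : vmeasurable (anc t i) /\ vmeasurable (cln t i).
  apply: IH => [s j k st kK|s st]; first by apply: mx; rewrite // leqW.
  by apply: mS; rewrite ltnW // ltnS.
have mm : measurable_fun setT (fun w => i \in Sg t w) by apply: measurable_mem; exact: mS.
split; apply: vmeasurable_if => //; first by case: mst.
apply: vmeasurableZ; apply: vmeasurable_sum => k.
have [h1 h2] : vmeasurable (lu t i k) /\ vmeasurable (lv t i k).
  apply: local_measurable => // l lk; apply: mx => //.
  exact: ltn_trans lk (ltn_ord k).
exact: (vmeasurable_lgrad i h1 h2).1.
Qed.

End TrajectoryMeasurable.

(** The coefficients add up to 5 + 9 + 9 + 1 = 24 for the u-noise and 5 + 1 = 6 for the v-noise;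
    both are below 37 = 148/4. *)
Lemma noise_budget (R : realFieldType) (L s g k q r x y e1 e2 e3 e4 e5 e6 : R) :
  L * s ^+ 2 * e1 <= L * g ^+ 2 * k * (x * q) ->
  L * s ^+ 2 * q * e2 <= L * g ^+ 2 * k * (x * q) ->
  L * s ^+ 2 * q * e3 <= L * g ^+ 2 * k * (x * q) ->
  L * g ^+ 2 * q * e4 <= L * g ^+ 2 * k * (x * q) ->
  r * (L * s ^+ 2 * e5) <= L * g ^+ 2 * k * (y * r) ->
  r * (L * g ^+ 2 * e6) <= L * g ^+ 2 * k * (y * r) ->
  0 <= L * g ^+ 2 * k * (x * q) -> 0 <= L * g ^+ 2 * k * (y * r) ->
  5 * L * s ^+ 2 * e1 + (9 * L * s ^+ 2 * q * (e2 + e3) + (L * g ^+ 2 * q * e4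
    + r * (5 * L * s ^+ 2 * e5 + L * g ^+ 2 * e6)))
  <= 37 * (L * g ^+ 2 * k) * (x * q + y * r).
Proof. lra. Qed.

Lemma telescope_step (R : realFieldType) (a x g p0 p p' k c : R) :
  p' <= p - a * g + c -> a * x <= p0 - p + k * c -> a * (x + g) <= p0 - p' + (k + 1) * c.
Proof. lra. Qed.

(** * The random run: independence, moments and expected descent *)

Section Stochastic.
Context {R : realType} {d dX : measure_display} {Omega : measurableType d}.
Context {X : measurableType dX} {du dv n m T K : nat}.
Variables (P : probability Omega R) (D : 'I_n -> probability X R).
Variables (F : X -> 'rV[R]_du -> 'rV[R]_dv -> R) (f : 'I_n -> 'rV[R]_du -> 'rV[R]_dv -> R).
Variables (L sigma_u sigma_v gamma_u gamma_v eta_u eta_v gamma : R).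
Variables (u0 : 'rV[R]_du) (v0 : 'I_n -> 'rV[R]_dv).
Variables (xi : nat -> 'I_n -> nat -> {RV P >-> X}) (S : nat -> Omega -> {set 'I_n}).
Hypothesis mn : (1 <= m <= n)%N.
Hypothesis K_gt0 : (0 < K)%N.
Hypothesis mF : forall u v, measurable_fun setT (fun y => F y u v).
Hypothesis dF : forall y, partially_differentiable (F y).
Hypothesis df : forall i, partially_differentiable (f i).
Hypothesis f_le : forall i u v u' v', f i u' v' <= f i u v
  + edot (grad_u (f i) u v) (u' - u) + edot (grad_v (f i) u v) (v' - v)
  + 2 * L * (sqn (u' - u) + sqn (v' - v)).
Hypothesis Gu_lip : forall i u v u' v', sqn (grad_u (f i) u' v' - grad_u (f i) u v)
  <= 2 * L ^+ 2 * (sqn (u' - u) + sqn (v' - v)).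
Hypothesis Gv_lip : forall i u v u' v', sqn (grad_v (f i) u' v' - grad_v (f i) u v)
  <= 2 * L ^+ 2 * (sqn (u' - u) + sqn (v' - v)).
Hypothesis mean_u : forall i u v j,
  (\int[D i]_x ((grad_u (F x) u v - grad_u (f i) u v) 0 j)%:E = 0)%E.
Hypothesis mean_v : forall i u v j,
  (\int[D i]_x ((grad_v (F x) u v - grad_v (f i) u v) 0 j)%:E = 0)%E.
Hypothesis var_u : forall i u v,
  (\int[D i]_x (sqn (grad_u (F x) u v - grad_u (f i) u v))%:E <= (sigma_u ^+ 2)%:E)%E.
Hypothesis var_v : forall i u v,
  (\int[D i]_x (sqn (grad_v (F x) u v - grad_v (f i) u v))%:E <= (sigma_v ^+ 2)%:E)%E.
Hypothesis law : forall (s : 'I_T.+1) i (k : 'I_K) A, measurable A ->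
  distribution P (xi s i k) A = D i A.
Hypothesis unif : forall t : 'I_T, uniform_subset P m (S t).
Hypothesis ind : mutually_independent P (@draw_events R d dX Omega X n P T K xi S).

Notation G := (@draw_events R d dX Omega X n P T K xi S).
(** Omega itself, equipped with the sigma-algebra of all draws other than q. The role of phi in the
    independent-pair lemmas is played by the identity from Omega to [W q]. *)
Notation W q := (g_sigma_algebraType (others G q)).

Let GT q : G q setT.
Proof. by case: q => [[[s i] k]|t]; exists setT; rewrite ?preimage_setT ?setTI. Qed.

Let GI q : setI_closed (G q).
Proof.
case: q => [[[s i] k]|t] A B [A' mA <-] [B' mB <-].
  by exists (A' `&` B'); [exact: measurableI | rewrite preimage_setI !setTI].
by exists (A' `&` B'); [| rewrite preimage_setI !setTI].
Qed.

Let mS (t : 'I_T) C : measurable (S t @^-1` C).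
Proof.
have -> : S t @^-1` C = \bigcup_(A in C) (S t @^-1` [set A]).
  by apply/seteqP; split => [w Cw|w [A CA /= ->]//]; exists (S t w).
by apply: fin_bigcup_measurable => [|A _]; [exact: finite_finset | case: (unif t A)].
Qed.

Let Gm q : G q `<=` measurable.
Proof.
case: q => [[[s i] k]|t] A [B mB <-]; rewrite setTI.
  by rewrite -[X in measurable X]setTI; exact: measurable_funP.
exact: mS.
Qed.

Let mid q : measurable_fun setT (id : Omega -> W q).
Proof.
move=> _ A mA; rewrite setTI.
by apply: (smallest_sub (@sigma_algebra_measurable _ Omega) (others_measurable Gm (q := q)) mA).
Qed.

Let others_mem q i A : i != q -> G i A -> measurable (A : set (W q)).
Proof.
by move=> iq GA; apply: sub_sigma_algebra; exact: others_gen GA.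
Qed.

Let mxi q (s : 'I_T.+1) i (k : 'I_K) : inl (s, i, k) != q ->
  measurable_fun setT (xi s i k : W q -> X).
Proof.
move=> iq _ A mA; apply: others_mem iq _.
by exists A.
Qed.

Let mSq q (t : 'I_T) C : inr t != q -> measurable (S t @^-1` C : set (W q)).
Proof.
move=> iq; apply: others_mem iq _; exists C => //.
by rewrite setTI.
Qed.

Let indepq q A B : measurable (A : set (W q)) -> G q B ->
  P ((id : Omega -> W q) @^-1` A `&` B) = (P ((id : Omega -> W q) @^-1` A) * P B)%E.
Proof. by move=> mA GB; apply: (others_indep GT GI Gm ind mA GB). Qed.

(** Measurability of U and V in [W q] says that they do not use the draw q, so the noise lemmas
    apply at the random point (U, V). The last clause of each half serves for the cross terms and
    for pairs of noises. *)
Lemma sample_noise (s : 'I_T.+1) i (k : 'I_K) (U : Omega -> 'rV[R]_du) (V : Omega -> 'rV[R]_dv) :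
  let q := inl (s, i, k) in
  let nu w := grad_u (F (xi s i k w)) (U w) (V w) - grad_u (f i) (U w) (V w) in
  let om w := grad_v (F (xi s i k w)) (U w) (V w) - grad_v (f i) (U w) (V w) in
  @vmeasurable R _ (W q) _ U -> @vmeasurable R _ (W q) _ V ->
  [/\ vL2 P nu, Ex P (fun w => sqn (nu w)) <= sigma_u ^+ 2 &
    forall Y, @vmeasurable R _ (W q) _ Y -> vL2 P Y -> Ex P (fun w => edot (nu w) (Y w)) = 0]
  /\ [/\ vL2 P om, Ex P (fun w => sqn (om w)) <= sigma_v ^+ 2 &
    forall Y, @vmeasurable R _ (W q) _ Y -> vL2 P Y -> Ex P (fun w => edot (om w) (Y w)) = 0].
Proof.
move=> q nu om mU mV.
have mU1 : vmeasurable (fun z : W q * X => U z.1).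
  by move=> j; exact: (measurableT_comp (mU j) measurable_fst).
have mV1 : vmeasurable (fun z : W q * X => V z.1).
  by move=> j; exact: (measurableT_comp (mV j) measurable_fst).
have [gu gv] := vmeasurable_sgrad mF dF (measurable_snd : measurable_fun setT (@snd (W q) X)) mU1 mV1.
have [hu hv] := vmeasurable_lgrad df i mU1 mV1.
have ind' A B : measurable (A : set (W q)) -> measurable B ->
    P ((id : Omega -> W q) @^-1` A `&` xi s i k @^-1` B)
    = (P ((id : Omega -> W q) @^-1` A) * D i B)%E.
  move=> mA mB; rewrite indepq //; last by exists B; rewrite ?setTI.
  by rewrite -(law s i k mB).
have mxi0 : measurable_fun setT (xi s i k) by exact: measurable_funP.
have Nu := @noise_sqn R _ _ _ Omega (W q) X P (D i) id (xi s i k) (@mid q) mxi0 ind' _ _ _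
  (vmeasurableB gu hu) (fun w => var_u i (U w) (V w)).
have Nu0 := @noise_orthogonal R _ _ _ Omega (W q) X P (D i) id (xi s i k) (@mid q) mxi0 ind' _ _ _
  (vmeasurableB gu hu) (fun w => mean_u i (U w) (V w)) (fun w => var_u i (U w) (V w)).
have Nv := @noise_sqn R _ _ _ Omega (W q) X P (D i) id (xi s i k) (@mid q) mxi0 ind' _ _ _
  (vmeasurableB gv hv) (fun w => var_v i (U w) (V w)).
have Nv0 := @noise_orthogonal R _ _ _ Omega (W q) X P (D i) id (xi s i k) (@mid q) mxi0 ind' _ _ _
  (vmeasurableB gv hv) (fun w => mean_v i (U w) (V w)) (fun w => var_v i (U w) (V w)).
by split; [case: Nu | case: Nv].
Qed.

(** The value at the random subset is the finite sum over A of 1{S_t = A} Phi(., A), and each Phi(.,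
    A) is independent of the event S_t = A. *)
Lemma client_sampling (t : 'I_T) (Phi : Omega -> {set 'I_n} -> R) :
  (forall A, measurable_fun setT (Phi^~ A : W (inr t) -> R)) ->
  (forall A, rintegrable P (Phi^~ A)) ->
  rintegrable P (fun w => Phi w (S t w)) /\
  Ex P (fun w => Phi w (S t w)) = Ex P (fun w => avg m (Phi w)).
Proof.
move=> mPhi iPhi.
pose p (A : {set 'I_n}) : R := if #|A| == m then 'C(n, m)%:R^-1 else 0.
have ev A : rintegrable P (fun w => (S t w == A)%:R * Phi w A) /\
    Ex P (fun w => (S t w == A)%:R * Phi w A) = p A * Ex P (Phi^~ A).
  apply: (@Ex_indep_event R _ _ Omega (W (inr t)) P id (@mid (inr t)) (fun w => S t w == A) (Phi^~ A)) => //.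
  - move=> _ C _; rewrite setTI; have := @mS t [set B : {set 'I_n} | C (B == A)].
    by congr (measurable _).
  - have -> : (fun w => S t w == A) @^-1` [set true] = S t @^-1` [set A].
      by apply/seteqP; split => w /eqP.
    by case: (unif t A) => _ ->; rewrite /p; case: ifP.
  - move=> B C mB; apply: indepq => //; exists [set A' : {set 'I_n} | C (A' == A)] => //.
    by rewrite setTI.
have e : (fun w => Phi w (S t w)) = fun w => \sum_(A : {set 'I_n}) (S t w == A)%:R * Phi w A.
  apply/funext => w; rewrite (bigD1 (S t w)) //= eqxx mul1r big1 ?addr0 // => A.
  by rewrite eq_sym => /negbTE ->; rewrite mul0r.
rewrite e; split; first by apply: rintegrable_sum => A _; case: (ev A).
rewrite Ex_sum => [|A]; last by case: (ev A).
rewrite /avg ExZ; last by apply: rintegrable_sum.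
rewrite Ex_sum // mulr_sumr [RHS]big_mkcond; apply: eq_bigr => A _.
by have [_ ->] := ev A; rewrite /p; case: ifP; rewrite ?mul0r.
Qed.

Notation xiX := (fun s i k => xi s i k : Omega -> X).
Notation st := (state F m K gamma_u gamma_v eta_u eta_v u0 v0 xiX S).
Notation lu := (local_u F m K gamma_u gamma_v eta_u eta_v u0 v0 xiX S).
Notation lv := (local_v F m K gamma_u gamma_v eta_u eta_v u0 v0 xiX S).
Notation gru := (sgrad_u F m K gamma_u gamma_v eta_u eta_v u0 v0 xiX S).
Notation grv := (sgrad_v F m K gamma_u gamma_v eta_u eta_v u0 v0 xiX S).
Notation lgu := (lgrad_u F m K gamma_u gamma_v eta_u eta_v u0 v0 f xiX S).
Notation lgv := (lgrad_v F m K gamma_u gamma_v eta_u eta_v u0 v0 f xiX S).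
Notation anc := (anchor F m K gamma_u gamma_v eta_u eta_v u0 v0 xiX S).
Notation cln := (clean_control F m K gamma_u gamma_v eta_u eta_v u0 v0 f xiX S).

Definition sample_time (t : 'I_T) : 'I_T.+1 := Ordinal (ltn_ord t : (t.+1 < T.+1)%N).

(** The draws that have no influence on the state t. The inequality is strict for samples and weak
    for subsets, since sample time s belongs to round s - 1. *)
Definition draw_after (t : nat) (q : ('I_T.+1 * 'I_n * 'I_K) + 'I_T) : bool :=
  match q with inl (s, _, _) => (t < s)%N | inr t' => (t <= t')%N end.

Lemma run_others t q : draw_after t q ->
  @state_measurable R _ (W q) _ _ _ (st t) /\
  forall i, @vmeasurable R _ (W q) _ (anc t i) /\ @vmeasurable R _ (W q) _ (cln t i).
Proof.
move=> tq.
have tT : (t <= T)%N.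
  by case: q tq => [[[s i] k]|t'] /= h; rewrite -1?ltnS; apply: leq_trans h _;
    rewrite 1?ltnW // -ltnS.
have mx s i k : (s <= t)%N -> (k < K)%N -> measurable_fun setT (xi s i k : W q -> X).
  move=> st kK; apply: (@mxi q (Ordinal (leq_ltn_trans st (tT : (t < T.+1)%N))) i (Ordinal kK)).
  apply: contraTneq tq => <- /=; by rewrite -leqNgt.
have mC s : (s < t)%N -> forall C, measurable (S s @^-1` C : set (W q)).
  move=> st C; apply: (@mSq q (Ordinal (leq_trans st tT))).
  by apply: contraTneq tq => <- /=; rewrite -ltnNge.
split; first exact: (@run_measurable _ _ _ (W q)).
exact: (@anchor_measurable _ _ _ (W q)).
Qed.

Lemma local_others (t : 'I_T) q i k : draw_after t q -> (k <= K)%N ->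
  (forall l : 'I_K, (l < k)%N -> inl (sample_time t, i, l) != q) ->
  @vmeasurable R _ (W q) _ (lu t i k) /\ @vmeasurable R _ (W q) _ (lv t i k).
Proof.
move=> tq kK hq; apply: (@local_measurable _ _ _ (W q)) => //.
  by case: (run_others tq).
by move=> l lk; apply: (@mxi q (sample_time t) i (Ordinal (leq_trans lk kK))); exact: hq.
Qed.

Lemma round_noise (t : 'I_T) i (k : 'I_K) :
  let q := inl (sample_time t, i, k) in
  let nu w := gru t i k w - lgu t i k w in
  let om w := grv t i k w - lgv t i k w in
  [/\ vL2 P nu, Ex P (fun w => sqn (nu w)) <= sigma_u ^+ 2 &
    forall Y, @vmeasurable R _ (W q) _ Y -> vL2 P Y -> Ex P (fun w => edot (nu w) (Y w)) = 0]
  /\ [/\ vL2 P om, Ex P (fun w => sqn (om w)) <= sigma_v ^+ 2 &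
    forall Y, @vmeasurable R _ (W q) _ Y -> vL2 P Y -> Ex P (fun w => edot (om w) (Y w)) = 0].
Proof.
move=> q nu om.
have [mu mv] : @vmeasurable R _ (W q) _ (lu t i k) /\ @vmeasurable R _ (W q) _ (lv t i k).
  apply: local_others => [||l lk]; [exact: ltnSn | exact: ltnW |].
  by apply/eqP => -[] e; rewrite e ltnn in lk.
exact: (sample_noise mu mv).
Qed.

(** A Lipschitz gradient grows at most linearly, by comparison with its value at the origin. *)
Lemma vL2_grad i (U : Omega -> 'rV[R]_du) (V : Omega -> 'rV[R]_dv) : vL2 P U -> vL2 P V ->
  vL2 P (fun w => grad_u (f i) (U w) (V w)) /\ vL2 P (fun w => grad_v (f i) (U w) (V w)).
Proof.
move=> [mU iU] [mV iV]; have [mu mv] := vmeasurable_lgrad df i mU mV.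
pose b w := 4 * L ^+ 2 * (sqn (U w) + sqn (V w)).
have ib : rintegrable P b by apply: rintegrableZ; exact: rintegrableD.
have bound d' (z z0 : 'rV[R]_d') w :
    sqn (z - z0) <= 2 * L ^+ 2 * (sqn (U w - 0) + sqn (V w - 0)) ->
    sqn z <= b w + 2 * sqn z0.
  rewrite !subr0 /b => h; have := sqnD_le (z - z0) z0; rewrite subrK; lra.
split.
  apply: (vL2_le mu (rintegrableD ib (rintegrable_cst P (2 * sqn (grad_u (f i) 0 0))))) => w.
  by apply: bound; exact: Gu_lip.
apply: (vL2_le mv (rintegrableD ib (rintegrable_cst P (2 * sqn (grad_v (f i) 0 0))))) => w.
by apply: bound; exact: Gv_lip.
Qed.

(** The smoothness inequality from (0, 0) to (U, V) bounds the loss above, and from (U, V) to (0, 0)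
    it bounds the loss below, both by integrable quadratic expressions. *)
Lemma rintegrable_loss i (U : Omega -> 'rV[R]_du) (V : Omega -> 'rV[R]_dv) :
  vL2 P U -> vL2 P V -> rintegrable P (fun w => f i (U w) (V w)).
Proof.
move=> lU lV; have [gU gV] := vL2_grad i lU lV.
have [mU iU] := lU; have [mV iV] := lV.
have mf : measurable_fun setT (fun w => f i (U w) (V w)).
  apply: (@measurable_fun_joint _ _ _ _ _ _ (fun=> f i) id) => //.
pose hi w := f i 0 0 + edot (grad_u (f i) 0 0) (U w) + edot (grad_v (f i) 0 0) (V w)
  + 2 * L * (sqn (U w) + sqn (V w)).
pose lo w := f i 0 0 + edot (grad_u (f i) (U w) (V w)) (U w)
  + edot (grad_v (f i) (U w) (V w)) (V w) - 2 * L * (sqn (U w) + sqn (V w)).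
have isq : rintegrable P (fun w => 2 * L * (sqn (U w) + sqn (V w))).
  by apply: rintegrableZ; exact: rintegrableD.
have ihi : rintegrable P hi.
  apply: rintegrableD isq; apply: rintegrableD; first apply: rintegrableD.
  - exact: rintegrable_cst.
  - by apply: rintegrable_edot => //; exact: vL2_cst.
  - by apply: rintegrable_edot => //; exact: vL2_cst.
have ilo : rintegrable P lo.
  apply: rintegrableB isq; apply: rintegrableD; first apply: rintegrableD.
  - exact: rintegrable_cst.
  - exact: rintegrable_edot.
  - exact: rintegrable_edot.
have inorm Y : rintegrable P Y -> rintegrable P (fun w => `|Y w|).
  move=> iY; exact: integrable_abse iY.
apply: (rintegrable_le mf (rintegrableD (inorm _ ihi) (inorm _ ilo))) => w.
have h1 : f i (U w) (V w) <= hi w by have := f_le i 0 0 (U w) (V w); rewrite !subr0.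
have h2 : lo w <= f i (U w) (V w).
  have := f_le i (U w) (V w) 0 0; rewrite !sub0r !sqnN !edotNr /lo; lra.
have := ler_norm (hi w); have := ler_norm (- lo w); rewrite normrN.
have := normr_ge0 (hi w); have := normr_ge0 (lo w).
by rewrite ler_norml; lra.
Qed.

Definition state_L2 t := [/\ vL2 P (fun w => shared (st t w)),
  forall i, vL2 P (fun w => personal (st t w) i),
  forall i, vL2 P (fun w => control (st t w) i),
  forall i, vL2 P (anc t i) & forall i, vL2 P (cln t i)].

Lemma mean_control_L2 t : state_L2 t -> vL2 P (fun w => mean_control (st t w)).
Proof.
by move=> [_ _ lc _ _]; under eq_fun do rewrite mean_control_vmean; exact: vL2_vmean.
Qed.

(** Induction on k, writing each stochastic gradient as noise of bounded variance plus the true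
    gradient at a square-integrable point. *)
Lemma local_L2 (t : 'I_T) i k : state_L2 t -> (k <= K)%N ->
  vL2 P (lu t i k) /\ vL2 P (lv t i k).
Proof.
move=> lt; have lm := mean_control_L2 lt; have [ls lp lc _ _] := lt.
elim: k => [|k IH] kK; first by split; rewrite /local_u /local_v /=.
have [lu' lv'] := IH (ltnW kK).
have [[nu _ _] [om _ _]] := round_noise t i (Ordinal kK).
have [hu hv] := vL2_grad i lu' lv'.
have gu : vL2 P (gru t i k).
  rewrite (_ : gru t i k = fun w => (gru t i k w - lgu t i k w) + lgu t i k w).
    exact: vL2D.
  by apply/funext => w; rewrite subrK.
have gv : vL2 P (grv t i k).
  rewrite (_ : grv t i k = fun w => (grv t i k w - lgv t i k w) + lgv t i k w).
    exact: vL2D.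
  by apply/funext => w; rewrite subrK.
split.
  rewrite (_ : lu t i k.+1 = fun w => lu t i k w -
    gamma_u *: (gru t i k w - control (st t w) i + mean_control (st t w))).
    by apply: vL2B => //; apply: vL2Z; apply: vL2D => //; exact: vL2B.
  by apply/funext => w; exact: local_uS.
rewrite (_ : lv t i k.+1 = fun w => lv t i k w - gamma_v *: grv t i k w).
  by apply: vL2B => //; exact: vL2Z.
by apply/funext => w; exact: local_vS.
Qed.

Lemma nu_L2 (t : 'I_T) i (k : 'I_K) :
  vL2 P (fun w => gru t i k w - lgu t i k w) /\ vL2 P (fun w => grv t i k w - lgv t i k w).
Proof. by have [[nu _ _] [om _ _]] := round_noise t i k. Qed.

Lemma measurable_mem_S (t : 'I_T) i : measurable_fun setT (fun w => i \in S t w).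
Proof. by apply: measurable_mem; exact: mS. Qed.

Lemma init_noise i (k : 'I_K) :
  let q := inl (ord0, i, k) in
  let nu w := grad_u (F (xi 0%N i k w)) u0 (v0 i) - grad_u (f i) u0 (v0 i) in
  [/\ vL2 P nu, Ex P (fun w => sqn (nu w)) <= sigma_u ^+ 2 &
    forall Y, @vmeasurable R _ (W q) _ Y -> vL2 P Y -> Ex P (fun w => edot (nu w) (Y w)) = 0].
Proof.
move=> q nu.
have mu : @vmeasurable R _ (W q) _ (fun=> u0) by exact: vmeasurable_cst.
have mv : @vmeasurable R _ (W q) _ (fun=> v0 i) by exact: vmeasurable_cst.
exact: (sample_noise mu mv).1.
Qed.

Lemma run_L2 t : (t <= T)%N -> state_L2 t.
Proof.
elim: t => [_|t IH tT].
  split => [|i|i|i|i] /=; try exact: vL2_cst.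
  apply: vL2Z; apply: vL2_sum => k; have [nu _ _] := init_noise i k.
  rewrite (_ : (fun w => _) = fun w => (grad_u (F (xi 0%N i k w)) u0 (v0 i)
    - grad_u (f i) u0 (v0 i)) + grad_u (f i) u0 (v0 i)).
    by apply: vL2D nu _; exact: vL2_cst.
  by apply/funext => w; rewrite subrK.
have lt := IH (ltnW tT); have lm := mean_control_L2 lt; have [ls lp lc la lk] := lt.
pose o := Ordinal tT.
have lK i : vL2 P (lu o i K) /\ vL2 P (lv o i K) by exact: local_L2.
split.
- apply: vL2D; first exact: vL2Z.
  apply: vL2Z; under eq_fun do rewrite big_mkcond.
  apply: vL2_sum => i; apply: vL2_if; [exact: (measurable_mem_S o) | exact: (lK i).1 |].
  exact: vL2_cst.
- move=> i; apply: vL2_if => //; first exact: (measurable_mem_S o).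
  by apply: vL2D; apply: vL2Z => //; exact: (lK i).2.
- move=> i; apply: vL2_if => //; first exact: (measurable_mem_S o).
  apply: vL2D; first exact: vL2B.
  by apply: vL2Z; apply: vL2B => //; exact: (lK i).1.
- move=> i; apply: vL2_if => //; exact: (measurable_mem_S o).
- move=> i; apply: vL2_if => //; first exact: (measurable_mem_S o).
  apply: vL2Z; apply: vL2_sum => k.
  have [hu hv] := local_L2 (t := o) i lt (ltnW (ltn_ord k)).
  exact: (vL2_grad i hu hv).1.
Qed.

(** The noise (j, l) involves only the samples of client j up to step l, so (i, k) is not among
    them. *)
Lemma noise_others (t : 'I_T) i (k : 'I_K) j (l : 'I_K) : (i != j) || (l < k)%N ->
  let q := inl (sample_time t, i, k) in
  @vmeasurable R _ (W q) _ (fun w => gru t j l w - lgu t j l w) /\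
  @vmeasurable R _ (W q) _ (fun w => grv t j l w - lgv t j l w).
Proof.
move=> ijkl q.
have neq (l' : 'I_K) : (l' <= l)%N -> inl (sample_time t, j, l') != q.
  move=> l'l; apply/eqP => -[] ji l'k; move: ijkl; rewrite ji eqxx /= -l'k.
  by rewrite ltnNge l'l.
have [mu mv] : @vmeasurable R _ (W q) _ (lu t j l) /\ @vmeasurable R _ (W q) _ (lv t j l).
  apply: local_others => [||l' l'l]; [exact: ltnSn | exact: ltnW |].
  by apply: neq; exact: ltnW.
have mx : measurable_fun setT (xi t.+1 j l : W q -> X).
  by apply: (@mxi q (sample_time t) j l); exact: neq.
have [gu gv] := vmeasurable_sgrad mF dF mx mu mv.
have [hu hv] := vmeasurable_lgrad df j mu mv.
by split; exact: vmeasurableB.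
Qed.

(** For one client the later of the two samples is integrated out first, the earlier noise being
    independent of it; for two clients either order works. Symmetry of the inner product covers the
    remaining case. *)
Lemma noise_pairs_orthogonal (t : 'I_T) (p p' : 'I_n * 'I_K) : p != p' ->
  Ex P (fun w => edot (gru t p.1 p.2 w - lgu t p.1 p.2 w)
                      (gru t p'.1 p'.2 w - lgu t p'.1 p'.2 w)) = 0 /\
  Ex P (fun w => edot (grv t p.1 p.2 w - lgv t p.1 p.2 w)
                      (grv t p'.1 p'.2 w - lgv t p'.1 p'.2 w)) = 0.
Proof.
have main (i : 'I_n) (k : 'I_K) j (l : 'I_K) : (i != j) || (l < k)%N ->
    Ex P (fun w => edot (gru t i k w - lgu t i k w) (gru t j l w - lgu t j l w)) = 0 /\
    Ex P (fun w => edot (grv t i k w - lgv t i k w) (grv t j l w - lgv t j l w)) = 0.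
  move=> h; have [mu mv] := noise_others t h; have [lnu lom] := nu_L2 t j l.
  by have [[_ _ hu] [_ _ hv]] := round_noise t i k; split; [exact: hu | exact: hv].
case: p p' => [i k] [j l] /= ne.
case: (boolP ((i != j) || (l < k)%N)) => [/main//|].
rewrite negb_or negbK -leqNgt => /andP[/eqP ij kl].
have kl' : (j != i) || (k < l)%N.
  rewrite ij eqxx /= ltn_neqAle kl andbT; apply: contra ne => /eqP e.
  by rewrite ij; apply/eqP; congr (_, _); exact: val_inj.
have [h1 h2] := main j l i k kl'.
by split; [rewrite -h1 | rewrite -h2]; apply: eq_Ex => w; exact: edotC.
Qed.

(** Every local run of the round is independent of S_t, since it is defined for all clients. *)
Lemma round_others (t : 'I_T) : let q := inr t in
  (forall i k, (k <= K)%N ->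
    @vmeasurable R _ (W q) _ (lu t i k) /\ @vmeasurable R _ (W q) _ (lv t i k)) /\
  (forall i (k : 'I_K),
    [/\ @vmeasurable R _ (W q) _ (gru t i k), @vmeasurable R _ (W q) _ (grv t i k),
      @vmeasurable R _ (W q) _ (lgu t i k) & @vmeasurable R _ (W q) _ (lgv t i k)]).
Proof.
move=> q; have loc i k : (k <= K)%N ->
    @vmeasurable R _ (W q) _ (lu t i k) /\ @vmeasurable R _ (W q) _ (lv t i k).
  by move=> kK; apply: local_others => //; exact: leqnn.
split => // i k; have [mu mv] := loc i k (ltnW (ltn_ord k)).
have mx : measurable_fun setT (xi t.+1 i k : W q -> X) by apply: (@mxi q (sample_time t) i k).
have [gu gv] := vmeasurable_sgrad mF dF mx mu mv.
have [hu hv] := vmeasurable_lgrad df i mu mv.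
by split.
Qed.

Lemma noise_sum_le (t : 'I_T) (Q : pred ('I_n * 'I_K)) :
  Ex P (fun w => sqn (\sum_(p | Q p) (gru t p.1 p.2 w - lgu t p.1 p.2 w)))
    <= #|Q|%:R * sigma_u ^+ 2 /\
  Ex P (fun w => sqn (\sum_(p | Q p) (grv t p.1 p.2 w - lgv t p.1 p.2 w)))
    <= #|Q|%:R * sigma_v ^+ 2.
Proof.
split.
- apply: (@Ex_sqn_sum_orthogonal _ _ _ P _ _ _ (fun (p : 'I_n * 'I_K) w => gru t p.1 p.2 w - lgu t p.1 p.2 w)) => [p|p p' pp'|p].
  + exact: (nu_L2 t p.1 p.2).1.
  + exact: (noise_pairs_orthogonal t pp').1.
  + by have [[_ ? _] _] := round_noise t p.1 p.2.
- apply: (@Ex_sqn_sum_orthogonal _ _ _ P _ _ _ (fun (p : 'I_n * 'I_K) w => grv t p.1 p.2 w - lgv t p.1 p.2 w)) => [p|p p' pp'|p].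
  + exact: (nu_L2 t p.1 p.2).2.
  + exact: (noise_pairs_orthogonal t pp').2.
  + by have [_ [_ ? _]] := round_noise t p.1 p.2.
Qed.

(** The prefix is indexed by a set of k pairs (i, l), to which the bound for orthogonal noises
    applies. *)
Lemma noise_prefix_le (t : 'I_T) i k : (k <= K)%N ->
  Ex P (fun w => sqn (\sum_(l < k) (gru t i l w - lgu t i l w))) <= k%:R * sigma_u ^+ 2 /\
  Ex P (fun w => sqn (\sum_(l < k) (grv t i l w - lgv t i l w))) <= k%:R * sigma_v ^+ 2.
Proof.
move=> kK; pose Q (p : 'I_n * 'I_K) := (p.1 == i) && (p.2 < k)%N.
have sumQ e (Z : 'I_n -> nat -> 'rV[R]_e) :
    \sum_(l < k) Z i l = \sum_(p | Q p) Z p.1 p.2.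
  rewrite (big_ord_widen K (Z i) kK) -(pair_big_dep (fun j => j == i) (fun _ (l : 'I_K) => (l < k)%N)
    (fun j (l : 'I_K) => Z j l)) /=.
  by rewrite big_pred1_eq.
have cQ : #|Q| = k.
  have : (\sum_(p | Q p) 1 = \sum_(l < k) 1)%N.
    rewrite (big_ord_widen K (fun=> 1%N) kK) -(pair_big_dep (fun j => j == i)
      (fun _ (l : 'I_K) => (l < k)%N) (fun _ _ => 1%N)) /=.
    by rewrite big_pred1_eq.
  by rewrite sum1_card sum1_card card_ord.
have [h1 h2] := noise_sum_le t Q; rewrite cQ in h1 h2.
split.
  rewrite (eq_Ex _ (Y := fun w => sqn (\sum_(p | Q p) (gru t p.1 p.2 w - lgu t p.1 p.2 w)))) //.
  by move=> w; rewrite (sumQ _ (fun i l => gru t i l w - lgu t i l w)).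
rewrite (eq_Ex _ (Y := fun w => sqn (\sum_(p | Q p) (grv t p.1 p.2 w - lgv t p.1 p.2 w)))) //.
by move=> w; rewrite (sumQ _ (fun i l => grv t i l w - lgv t i l w)).
Qed.

Lemma sqn_vmean_scale e k (z : 'I_k -> 'rV[R]_e) :
  sqn (vmean z) = k%:R ^- 2 * sqn (\sum_l z l).
Proof. by rewrite /vmean sqnZ exprVn. Qed.

Let KR : K%:R != 0 :> R. Proof. by rewrite pnatr_eq0 -lt0n. Qed.
Let n_gt0 : (0 < n)%N. Proof. by case/andP: mn => /leq_trans; apply. Qed.

Let K_avg (a : R) : K%:R ^- 2 * (K%:R * a) = a / K%:R.
Proof. by field; rewrite KR. Qed.

Lemma noise_mean_le (t : 'I_T) i :
  Ex P (fun w => sqn (vmean (fun k : 'I_K => gru t i k w - lgu t i k w)))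
    <= sigma_u ^+ 2 / K%:R /\
  Ex P (fun w => sqn (vmean (fun k : 'I_K => grv t i k w - lgv t i k w)))
    <= sigma_v ^+ 2 / K%:R.
Proof.
have [h1 h2] := noise_prefix_le t i (leqnn K).
split.
  under eq_Ex do rewrite sqn_vmean_scale.
  rewrite ExZ; last first.
    by apply: rintegrable_edot; apply: vL2_sum => k; exact: (nu_L2 t i k).1.
  have K2 : 0 <= K%:R ^- 2 :> R by rewrite invr_ge0 sqr_ge0.
  apply: le_trans (ler_wpM2l K2 h1) _; by rewrite K_avg.
under eq_Ex do rewrite sqn_vmean_scale.
rewrite ExZ; last first.
  by apply: rintegrable_edot; apply: vL2_sum => k; exact: (nu_L2 t i k).2.
have K2 : 0 <= K%:R ^- 2 :> R by rewrite invr_ge0 sqr_ge0.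
apply: le_trans (ler_wpM2l K2 h2) _; by rewrite K_avg.
Qed.

Lemma noise_total_mean_le (t : 'I_T) :
  Ex P (fun w => sqn (vmean (fun i => vmean (fun k : 'I_K => gru t i k w - lgu t i k w))))
    <= sigma_u ^+ 2 / (n%:R * K%:R).
Proof.
have [h1 _] := noise_sum_le t xpredT.
have nR : n%:R != 0 :> R by rewrite pnatr_eq0 -lt0n.
have e w : sqn (vmean (fun i => vmean (fun k : 'I_K => gru t i k w - lgu t i k w)))
   = (n%:R * K%:R) ^- 2 * sqn (\sum_(p : 'I_n * 'I_K) (gru t p.1 p.2 w - lgu t p.1 p.2 w)).
  rewrite -(pair_bigA _ (fun i (k : 'I_K) => gru t i k w - lgu t i k w)) /=.
  by rewrite /vmean -scaler_sumr scalerA sqnZ -invfM exprVn.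
under eq_Ex do rewrite e.
rewrite ExZ; last first.
  by apply: rintegrable_edot; apply: vL2_sum => p; exact: (nu_L2 t p.1 p.2).1.
have nK2 : 0 <= (n%:R * K%:R) ^- 2 :> R by rewrite invr_ge0 sqr_ge0.
apply: le_trans (ler_wpM2l nK2 h1) _.
have -> : #|(xpredT : pred ('I_n * 'I_K))| = (n * K)%N.
  by rewrite -[LHS]/#|{: 'I_n * 'I_K}| card_prod !card_ord.
by rewrite natrM le_eqVlt; apply/orP; left; apply/eqP; field; rewrite nR KR.
Qed.

(** Induction on t after averaging over S_t: a selected client gets a fresh mean of K noises, the
    others keep an earlier one, and both have second moment at most sigma_u^2 / K. The bound is
    therefore insensitive to the age of the control variate. At time 0 the K initialization samples
    give the same bound. *)
Lemma control_noise_le t i : (t <= T)%N -> gamma_u != 0 ->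
  Ex P (fun w => sqn (control (st t w) i - cln t i w)) <= sigma_u ^+ 2 / K%:R.
Proof.
move=> + g0; elim: t => [_|t IH tT].
  have e w : control (st 0%N w) i - cln 0%N i w = vmean (fun k : 'I_K =>
      grad_u (F (xi 0%N i k w)) u0 (v0 i) - grad_u (f i) u0 (v0 i)).
    by rewrite vmeanB vmean_cst.
  under eq_Ex do rewrite e sqn_vmean_scale.
  pose Z (k : 'I_K) w := grad_u (F (xi 0%N i k w)) u0 (v0 i) - grad_u (f i) u0 (v0 i).
  have lZ k : vL2 P (Z k) by have [] := init_noise i k.
  have h1 : Ex P (fun w => sqn (\sum_k Z k w)) <= #|'I_K|%:R * sigma_u ^+ 2.
    apply: Ex_sqn_sum_orthogonal => // [k k' kk'|k]; last by have [] := init_noise i k.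
    have [_ _ h] := init_noise i k; apply: h => //.
    have mx : measurable_fun setT (xi 0%N i k' : W (inl (ord0, i, k)) -> X).
      apply: (@mxi _ ord0 i k'); apply: contra kk' => /eqP[->] //.
    apply: vmeasurableB; last exact: vmeasurable_cst.
    by apply: (vmeasurable_sgrad mF dF mx _ _).1; exact: vmeasurable_cst.
  rewrite ExZ; last by apply: rintegrable_edot; exact: vL2_sum.
  have K2 : 0 <= K%:R ^- 2 :> R by rewrite invr_ge0 sqr_ge0.
  apply: le_trans (ler_wpM2l K2 h1) _; by rewrite card_ord K_avg.
pose o := Ordinal tT; have {}IH := IH (ltnW tT).
pose Phi w (A : {set 'I_n}) := if i \in A then
    sqn (vmean (fun k : 'I_K => gru o i k w - lgu o i k w))
  else sqn (control (st t w) i - cln t i w).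
have e w : sqn (control (st t.+1 w) i - cln t.+1 i w) = Phi w (S o w).
  have -> : control (st t.+1 w) i = if i \in S t w
      then vmean (fun k : 'I_K => gru t i k w) else control (st t w) i.
    by case: ifP => iS; [exact: control_round | rewrite /state /= iS].
  by rewrite /Phi [cln _ _ _]/=; case: ifP => // _; rewrite -vmeanB.
under eq_Ex do rewrite e.
have [ls lp lc la lk] := run_L2 (ltnW tT).
have [h1 _] := noise_mean_le o i.
have i1 : rintegrable P (fun w => sqn (vmean (fun k : 'I_K => gru o i k w - lgu o i k w))).
  by apply: rintegrable_edot; apply: vL2_vmean => k; exact: (nu_L2 o i k).1.
have i2 : rintegrable P (fun w => sqn (control (st t w) i - cln t i w)).
  by apply: rintegrable_edot; apply: vL2B.
have bq : draw_after t (inr o) by exact: leqnn.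
have [[_ _ mc _] mac] := run_others bq.
have mPhi A : measurable_fun setT (Phi^~ A : W (inr o) -> R).
  rewrite /Phi; case: (i \in A).
    by apply: measurable_edot; apply: vmeasurableZ; apply: vmeasurable_sum => k;
      have [gu _ hu _] := (round_others o).2 i k; exact: vmeasurableB.
  by apply: measurable_edot; apply: vmeasurableB; [exact: mc | exact: (mac i).2 | exact: mc | exact: (mac i).2].
have iPhi A : rintegrable P (Phi^~ A) by rewrite /Phi; case: (i \in A).
have [_ ->] := client_sampling mPhi iPhi.
rewrite (eq_Ex _ (Y := fun w => m%:R / n%:R * sqn (vmean (fun k : 'I_K => gru o i k w - lgu o i k w))
    + (1 - m%:R / n%:R) * sqn (control (st t w) i - cln t i w))); last first.
  by move=> w; rewrite /Phi avg_if.
rewrite ExD ?ExZ //; try exact: rintegrableZ.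
have r0 : 0 <= m%:R / n%:R :> R by rewrite divr_ge0.
have r1 : 0 <= 1 - m%:R / n%:R :> R.
  by rewrite subr_ge0 ler_pdivrMr ?ltr0n // mul1r ler_nat; case/andP: mn.
have := ler_wpM2l r0 h1; have := ler_wpM2l r1 IH; lra.
Qed.

(** Here x and y are known before the round, hence independent of every sample in it, and the noises
    can be integrated out one by one. *)
Lemma Ex_edot_noise (t : 'I_T) i (x : Omega -> 'rV[R]_du) (y : Omega -> 'rV[R]_dv) :
  (forall q, draw_after t q -> @vmeasurable R _ (W q) _ x /\ @vmeasurable R _ (W q) _ y) ->
  vL2 P x -> vL2 P y ->
  Ex P (fun w => edot (x w) (vmean (fun k : 'I_K => gru t i k w - lgu t i k w))) = 0 /\
  Ex P (fun w => edot (y w) (vmean (fun k : 'I_K => grv t i k w - lgv t i k w))) = 0.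
Proof.
move=> mxy lx ly.
split.
  rewrite (eq_Ex _ (Y := fun w => mean (fun k : 'I_K => edot (gru t i k w - lgu t i k w) (x w)))).
    rewrite (Ex_mean (Y := fun (k : 'I_K) w => edot (gru t i k w - lgu t i k w) (x w))).
      rewrite /mean big1 ?mulr0 // => k _.
      have [[_ _ h] _] := round_noise t i k; apply: h => //.
      by apply: (mxy _ _).1; exact: ltnSn.
    by move=> k; apply: rintegrable_edot => //; exact: (nu_L2 t i k).1.
  by move=> w; rewrite edot_vmeanr; apply: eq_mean => k; exact: edotC.
rewrite (eq_Ex _ (Y := fun w => mean (fun k : 'I_K => edot (grv t i k w - lgv t i k w) (y w)))).
  rewrite (Ex_mean (Y := fun (k : 'I_K) w => edot (grv t i k w - lgv t i k w) (y w))).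
    rewrite /mean big1 ?mulr0 // => k _.
    have [_ [_ _ h]] := round_noise t i k; apply: h => //.
    by apply: (mxy _ _).2; exact: ltnSn.
  by move=> k; apply: rintegrable_edot => //; exact: (nu_L2 t i k).2.
by move=> w; rewrite edot_vmeanr; apply: eq_mean => k; exact: edotC.
Qed.

Lemma measurable_mean dT (Z : measurableType dT) k (Y : 'I_k -> Z -> R) :
  (forall i, measurable_fun setT (Y i)) -> measurable_fun setT (fun z => mean (Y^~ z)).
Proof. by move=> mY; apply: measurable_funM => //; exact: measurable_sum. Qed.

Lemma potential_measurable dT (Z : measurableType dT) a b (U : Z -> 'rV[R]_du)
    (V : 'I_n -> Z -> 'rV[R]_dv) (al cb : 'I_n -> Z -> 'rV[R]_du) :
  vmeasurable U -> (forall i, vmeasurable (V i)) -> (forall i, vmeasurable (al i)) ->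
  (forall i, vmeasurable (cb i)) ->
  measurable_fun setT (fun z => potential f (fun i => grad_u (f i)) a b (U z) (V^~ z) (al^~ z) (cb^~ z)).
Proof.
move=> mU mV mal mcb; apply: measurable_funD; first apply: measurable_funD.
- apply: (measurable_mean (Y := fun i z => f i (U z) (V i z))) => i.
  by apply: (@measurable_fun_joint _ _ _ _ _ _ (fun=> f i) id).
- apply: measurable_funM => //; apply: (measurable_mean (Y := fun i z => sqn (U z - al i z))) => i.
  by apply: measurable_edot; exact: vmeasurableB.
- apply: measurable_funM => //.
  apply: (measurable_mean (Y := fun i z => sqn (cb i z - grad_u (f i) (al i z) (V i z)))) => i.
  have h := (vmeasurable_lgrad df i (mal i) (mV i)).1.
  by apply: measurable_edot; exact: vmeasurableB.
Qed.

Lemma potential_integrable a b (U : Omega -> 'rV[R]_du)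
    (V : 'I_n -> Omega -> 'rV[R]_dv) (al cb : 'I_n -> Omega -> 'rV[R]_du) :
  vL2 P U -> (forall i, vL2 P (V i)) -> (forall i, vL2 P (al i)) ->
  (forall i, vL2 P (cb i)) ->
  rintegrable P (fun z => potential f (fun i => grad_u (f i)) a b (U z) (V^~ z) (al^~ z) (cb^~ z)).
Proof.
move=> lU lV lal lcb; apply: rintegrableD; first apply: rintegrableD.
- by apply: (rintegrable_mean (Y := fun i z => f i (U z) (V i z))) => i; exact: rintegrable_loss.
- apply: rintegrableZ; apply: (rintegrable_mean (Y := fun i z => sqn (U z - al i z))) => i.
  by apply: rintegrable_edot; exact: vL2B.
- apply: rintegrableZ.
  apply: (rintegrable_mean (Y := fun i z => sqn (cb i z - grad_u (f i) (al i z) (V i z)))) => i.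
  have h := (vL2_grad i (lal i) (lV i)).1.
  by apply: rintegrable_edot; exact: vL2B.
Qed.

Hypothesis L_gt0 : 0 < L.
Hypothesis gamma_gt0 : 0 < gamma.
Hypothesis gu_eta : gamma_u * eta_u = gamma.
Hypothesis gv_eta : gamma_v * eta_v = gamma.
Hypothesis gu_le : gamma_u ^+ 2 <= gamma ^+ 2 / m%:R.
Hypothesis gv_le : gamma_v ^+ 2 <= gamma ^+ 2 * (m%:R / n%:R).
Hypothesis step1 : 72 * (L * (gamma * K%:R)) <= 1.
Hypothesis step2 : (72 * (L * (gamma * K%:R))) ^+ 2 * n%:R <= m%:R ^+ 2.
Hypothesis step3 : (72 * (L * (gamma * K%:R))) ^+ 3 * n%:R ^+ 2 <= m%:R ^+ 3.

Let s := gamma * K%:R.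
Let A0 : R := 160 * L ^+ 3 * s ^+ 2 * (n%:R / m%:R ^+ 2).
Let B0 : R := 20 * L * s ^+ 2 * (n%:R / m%:R ^+ 2).

Definition lyapunov t w := potential f (fun i => grad_u (f i)) A0 B0
  (shared (st t w)) (personal (st t w)) (anc t ^~ w) (cln t ^~ w).

Definition grad_sqn t w :=
  sqn (vmean (fun i => grad_u (f i) (shared (st t w)) (personal (st t w) i)))
  + m%:R / n%:R * mean (fun i => sqn (grad_v (f i) (shared (st t w)) (personal (st t w) i))).

Let gu_neq0 : gamma_u != 0.
Proof. by apply/eqP => g0; move: gamma_gt0; rewrite -gu_eta g0 mul0r ltxx. Qed.

Lemma lyapunov_integrable t : (t <= T)%N -> rintegrable P (lyapunov t).
Proof. by move=> /run_L2[ls lp lc la lk]; exact: potential_integrable. Qed.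

Lemma grad_sqn_integrable t : (t <= T)%N -> rintegrable P (grad_sqn t).
Proof.
move=> /run_L2[ls lp lc la lk]; apply: rintegrableD.
  by apply: rintegrable_edot; apply: vL2_vmean => i; exact: (vL2_grad i ls (lp i)).1.
apply: rintegrableZ; apply: (rintegrable_mean (Y := fun i w =>
  sqn (grad_v (f i) (shared (st t w)) (personal (st t w) i)))) => i.
by apply: rintegrable_edot; exact: (vL2_grad i ls (lp i)).2.
Qed.

Let nu t i k w : 'rV[R]_du := gru t i k w - lgu t i k w.
Let om t i k w : 'rV[R]_dv := grv t i k w - lgv t i k w.

(** The value after the round if A were the subset drawn; this separates S_t from the samples so
    that [client_sampling] applies. *)
Definition next_lyapunov t w (A : {set 'I_n}) := potential f (fun i => grad_u (f i)) A0 B0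
  ((1 - eta_u) *: shared (st t w) + (eta_u / m%:R) *: \sum_(i in A) lu t i K w)
  (fun i => if i \in A then (1 - eta_v) *: personal (st t w) i + eta_v *: lv t i K w
            else personal (st t w) i)
  (fun i => if i \in A then shared (st t w) else anc t i w)
  (fun i => if i \in A then vmean (fun k : 'I_K => lgu t i k w) else cln t i w).

Lemma lyapunovS t w : lyapunov t.+1 w = next_lyapunov t w (S t w).
Proof. by []. Qed.

Lemma lyapunov_round_le t w : avg m (next_lyapunov t w) <= lyapunov t w
  - s / 4 * grad_sqn t w
  - s * edot (vmean (fun i => grad_u (f i) (shared (st t w)) (personal (st t w) i)))
        (vmean (fun i => vmean (fun k : 'I_K => nu t i k w)))
  - s * (m%:R / n%:R) * mean (fun i => edot (grad_v (f i) (shared (st t w)) (personal (st t w) i))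
        (vmean (fun k : 'I_K => om t i k w)))
  - 2 * A0 * s * edot (vmean (fun i => shared (st t w) - anc t i w))
        (vmean (fun i => vmean (fun k : 'I_K => nu t i k w)))
  + 5 * L * s ^+ 2 * sqn (vmean (fun i => vmean (fun k : 'I_K => nu t i k w)))
  + 9 * L * s ^+ 2 * m%:R^-1 * (mean (fun i => sqn (vmean (fun k : 'I_K => nu t i k w)))
      + mean (fun i => sqn (control (st t w) i - cln t i w)))
  + L * gamma ^+ 2 * m%:R^-1
      * mean (fun i => mean (fun k : 'I_K => sqn (\sum_(l < k) nu t i l w)))
  + m%:R / n%:R * (5 * L * s ^+ 2 * mean (fun i => sqn (vmean (fun k : 'I_K => om t i k w)))
      + L * gamma ^+ 2
        * mean (fun i => mean (fun k : 'I_K => sqn (\sum_(l < k) om t i l w)))).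
Proof.
apply: (@potential_round R du dv n m K mn K_gt0 f (fun i => grad_u (f i)) (fun i => grad_v (f i))
  L gamma_u gamma_v eta_u eta_v gamma f_le Gu_lip Gv_lip L_gt0 gamma_gt0 gu_eta gv_eta
  gu_le gv_le (shared (st t w)) (personal (st t w)) (control (st t w)) (anc t ^~ w) (cln t ^~ w)
  (fun i k => gru t i k w) (fun i k => grv t i k w) (fun i k => lu t i k w) (fun i k => lv t i k w)
  _ _ step1 step2 step3) => i k.
  by have [-> _] := local_iterate_sum F m K gamma_u gamma_v eta_u eta_v u0 v0 xiX S t i k w;
    rewrite mean_control_vmean.
by have [_ ->] := local_iterate_sum F m K gamma_u gamma_v eta_u eta_v u0 v0 xiX S t i k w.
Qed.

(** Linearity for the exact shape of the right side of [lyapunov_round_le], stated with abstract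
    summands. *)
Let Ex_combination (c0 c1 c2 c3 c4 c5 c6 c7 c8 c9 : R)
    (X0 X1 X2 X3 X4 N1 N2 N3 N4 N5 N6 : Omega -> R) :
  rintegrable P X0 -> rintegrable P X1 -> rintegrable P X2 -> rintegrable P X3 ->
  rintegrable P X4 -> rintegrable P N1 -> rintegrable P N2 -> rintegrable P N3 ->
  rintegrable P N4 -> rintegrable P N5 -> rintegrable P N6 ->
  let Y w := X0 w - c1 * X1 w - c2 * X2 w - c3 * X3 w - c4 * X4 w + c5 * N1 w
    + c6 * (N2 w + N3 w) + c7 * N4 w + c0 * (c8 * N5 w + c9 * N6 w) in
  rintegrable P Y /\
  Ex P Y = Ex P X0 - c1 * Ex P X1 - c2 * Ex P X2 - c3 * Ex P X3 - c4 * Ex P X4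
    + c5 * Ex P N1 + c6 * (Ex P N2 + Ex P N3) + c7 * Ex P N4
    + c0 * (c8 * Ex P N5 + c9 * Ex P N6).
Proof.
move=> i0 i1 i2 i3 i4 j1 j2 j3 j4 j5 j6 Y.
have z1 := rintegrableZ c1 i1; have z2 := rintegrableZ c2 i2.
have z3 := rintegrableZ c3 i3; have z4 := rintegrableZ c4 i4.
have y1 := rintegrableZ c5 j1; have y4 := rintegrableZ c7 j4.
have y23 := rintegrableD j2 j3; have y23' := rintegrableZ c6 y23.
have y5 := rintegrableZ c8 j5; have y6 := rintegrableZ c9 j6.
have y56 := rintegrableD y5 y6; have y56' := rintegrableZ c0 y56.
have s1 := rintegrableB i0 z1; have s2 := rintegrableB s1 z2.
have s3 := rintegrableB s2 z3; have s4 := rintegrableB s3 z4.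
have s5 := rintegrableD s4 y1; have s6 := rintegrableD s5 y23'.
have s7 := rintegrableD s6 y4; split; first exact: rintegrableD s7 y56'.
by rewrite /Y (ExD s7 y56') (ExD s6 y4) (ExD s5 y23') (ExD s4 y1) (ExB s3 z4) (ExB s2 z3)
  (ExB s1 z2) (ExB i0 z1) (ExZ _ y56) (ExD y5 y6) (ExZ _ y23) (ExD j2 j3) !ExZ.
Qed.

Lemma next_lyapunov_sampling (t : 'I_T) :
  rintegrable P (fun w => avg m (next_lyapunov t w)) /\
  Ex P (lyapunov t.+1) = Ex P (fun w => avg m (next_lyapunov t w)).
Proof.
have tT : (t <= T)%N by exact: ltnW.
have [ls lp lc la lk] := run_L2 tT.
have ll i k : (k <= K)%N -> vL2 P (lu t i k) /\ vL2 P (lv t i k) by apply: local_L2; split.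
have bq : draw_after t (inr t) by exact: leqnn.
have [[ms mp mc _] mac] := run_others bq; have [mloc mg] := round_others t.
have mN A : measurable_fun setT ((next_lyapunov t)^~ A : W (inr t) -> R).
  apply: (@potential_measurable _ (W (inr t)) A0 B0 _
    (fun i w => if i \in A then (1 - eta_v) *: personal (st t w) i + eta_v *: lv t i K w
            else personal (st t w) i)
    (fun i w => if i \in A then shared (st t w) else anc t i w)
    (fun i w => if i \in A then vmean (fun k : 'I_K => lgu t i k w) else cln t i w)).
  - apply: vmeasurableD; apply: vmeasurableZ => //; under eq_fun do rewrite big_mkcond.
    apply: vmeasurable_sum => i; case: (i \in A); last exact: vmeasurable_cst.
    exact: (mloc i K (leqnn K)).1.
  - move=> i; case: (i \in A) => //; apply: vmeasurableD; apply: vmeasurableZ => //.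
    exact: (mloc i K (leqnn K)).2.
  - by move=> i; case: (i \in A) => //; exact: (mac i).1.
  - move=> i; case: (i \in A); last exact: (mac i).2.
    by apply: vmeasurableZ; apply: vmeasurable_sum => k; have [] := mg i k.
have iN A : rintegrable P ((next_lyapunov t)^~ A).
  apply: (@potential_integrable A0 B0 _
    (fun i w => if i \in A then (1 - eta_v) *: personal (st t w) i + eta_v *: lv t i K w
            else personal (st t w) i)
    (fun i w => if i \in A then shared (st t w) else anc t i w)
    (fun i w => if i \in A then vmean (fun k : 'I_K => lgu t i k w) else cln t i w)).
  - apply: vL2D; apply: vL2Z => //; apply: vL2_sum => i; exact: (ll i K (leqnn K)).1.
  - move=> i; case: (i \in A) => //; apply: vL2D; apply: vL2Z => //.
    exact: (ll i K (leqnn K)).2.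
  - by move=> i; case: (i \in A).
  - move=> i; case: (i \in A) => //; apply: vL2_vmean => k.
    have [hu hv] := ll i k (ltnW (ltn_ord k)); exact: (vL2_grad i hu hv).1.
have [_ e] := client_sampling mN iN; split.
  by apply: rintegrableZ; apply: rintegrable_sum => A _.
by rewrite -e; apply: eq_Ex => w; exact: lyapunovS.
Qed.

(** Averaging over S_t turns the left side into the one of [lyapunov_round_le]; in expectation the
    three inner products vanish and each squared noise contributes at most L gamma^2 K sigma_u^2 / m
    or L gamma^2 K sigma_v^2 m/n up to a constant. *)
Lemma lyapunov_round_expectation (t : 'I_T) :
  Ex P (lyapunov t.+1) <= Ex P (lyapunov t) - s / 4 * Ex P (grad_sqn t)
    + 37 * (L * gamma ^+ 2 * K%:R) * (sigma_u ^+ 2 / m%:R + sigma_v ^+ 2 * (m%:R / n%:R)).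
Proof.
have tT : (t <= T)%N by exact: ltnW.
have [ls lp lc la lk] := run_L2 tT.
have lnu i : vL2 P (fun w => vmean (fun k : 'I_K => nu t i k w)).
  by apply: vL2_vmean => k; exact: (nu_L2 t i k).1.
have lom i : vL2 P (fun w => vmean (fun k : 'I_K => om t i k w)).
  by apply: vL2_vmean => k; exact: (nu_L2 t i k).2.
have lnub := vL2_vmean lnu.
pose gub w := vmean (fun i => grad_u (f i) (shared (st t w)) (personal (st t w) i)).
pose gv i w := grad_v (f i) (shared (st t w)) (personal (st t w) i).
pose db w := vmean (fun i => shared (st t w) - anc t i w).
have lgub : vL2 P gub by apply: vL2_vmean => i; exact: (vL2_grad i ls (lp i)).1.
have lgv i : vL2 P (gv i) by exact: (vL2_grad i ls (lp i)).2.
have ldb : vL2 P db by apply: vL2_vmean => i; exact: vL2B.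
have mx q : draw_after t q -> [/\ @vmeasurable R _ (W q) _ gub,
    forall i, @vmeasurable R _ (W q) _ (gv i) & @vmeasurable R _ (W q) _ db].
  move=> /run_others[[ms mp mc _] mac]; split.
  - apply: vmeasurableZ; apply: vmeasurable_sum => i.
    exact: (vmeasurable_lgrad df i ms (mp i)).1.
  - by move=> i; exact: (vmeasurable_lgrad df i ms (mp i)).2.
  - apply: vmeasurableZ; apply: vmeasurable_sum => i; apply: vmeasurableB => //.
    exact: (mac i).1.
have EM (x : Omega -> 'rV[R]_du) : (forall q, draw_after t q -> @vmeasurable R _ (W q) _ x) -> vL2 P x ->
    Ex P (fun w => edot (x w) (vmean (fun i => vmean (fun k : 'I_K => nu t i k w)))) = 0.
  move=> hx lx; rewrite (eq_Ex _ (Y := fun w => mean (fun i =>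
    edot (x w) (vmean (fun k : 'I_K => nu t i k w))))) => [|w]; last exact: edot_vmeanr.
  rewrite (Ex_mean (Y := fun i w => edot (x w) (vmean (fun k : 'I_K => nu t i k w)))) => [|i].
    rewrite /mean big1 ?mulr0 // => i _.
    apply: (@Ex_edot_noise t i x (fun=> 0) _ lx (vL2_cst P 0)).1 => q tq.
    by split; [exact: hx | exact: vmeasurable_cst].
  exact: rintegrable_edot.
have EM1 := EM gub (fun q tq => let: And3 h _ _ := mx q tq in h) lgub.
have EM3 := EM db (fun q tq => let: And3 _ _ h := mx q tq in h) ldb.
have EM2 : Ex P (fun w => mean (fun i => edot (gv i w) (vmean (fun k : 'I_K => om t i k w)))) = 0.
  rewrite (Ex_mean (Y := fun i w => edot (gv i w) (vmean (fun k : 'I_K => om t i k w)))) => [|i].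
    rewrite /mean big1 ?mulr0 // => i _.
    apply: (@Ex_edot_noise t i (fun=> 0) (gv i) _ (vL2_cst P 0) (lgv i)).2 => q tq.
    by split; [exact: vmeasurable_cst | have [_ h _] := mx q tq; exact: h].
  exact: rintegrable_edot.
have n0 : 0 < n%:R :> R by rewrite ltr0n.
have m0 : 0 < m%:R :> R by rewrite ltr0n; case/andP: mn.
have K0 : 0 < K%:R :> R by rewrite ltr0n.
have s0 : 0 < s by rewrite mulr_gt0.
pose N1 w := sqn (vmean (fun i => vmean (fun k : 'I_K => nu t i k w))).
pose N2 w := mean (fun i => sqn (vmean (fun k : 'I_K => nu t i k w))).
pose N3 w := mean (fun i => sqn (control (st t w) i - cln t i w)).
pose N4 w := mean (fun i => mean (fun k : 'I_K => sqn (\sum_(l < k) nu t i l w))).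
pose N5 w := mean (fun i => sqn (vmean (fun k : 'I_K => om t i k w))).
pose N6 w := mean (fun i => mean (fun k : 'I_K => sqn (\sum_(l < k) om t i l w))).
have lnul i (k : 'I_K) : vL2 P (fun w => \sum_(l < k) nu t i l w).
  apply: vL2_sum => l; exact: (nu_L2 t i (widen_ord (ltnW (ltn_ord k)) l)).1.
have loml i (k : 'I_K) : vL2 P (fun w => \sum_(l < k) om t i l w).
  apply: vL2_sum => l; exact: (nu_L2 t i (widen_ord (ltnW (ltn_ord k)) l)).2.
have iN1 : rintegrable P N1 by exact: rintegrable_edot.
have iN2' i : rintegrable P (fun w => sqn (vmean (fun k : 'I_K => nu t i k w))).
  exact: rintegrable_edot.
have iN2 : rintegrable P N2 by exact: rintegrable_mean iN2'.
have iN3' i : rintegrable P (fun w => sqn (control (st t w) i - cln t i w)).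
  by apply: rintegrable_edot; exact: vL2B.
have iN3 : rintegrable P N3 by exact: rintegrable_mean iN3'.
have iN4'' i (k : 'I_K) : rintegrable P (fun w => sqn (\sum_(l < k) nu t i l w)).
  exact: rintegrable_edot.
have iN4' i : rintegrable P (fun w => mean (fun k : 'I_K => sqn (\sum_(l < k) nu t i l w))).
  exact: rintegrable_mean (iN4'' i).
have iN4 : rintegrable P N4 by exact: rintegrable_mean iN4'.
have iN5' i : rintegrable P (fun w => sqn (vmean (fun k : 'I_K => om t i k w))).
  exact: rintegrable_edot.
have iN5 : rintegrable P N5 by exact: rintegrable_mean iN5'.
have iN6'' i (k : 'I_K) : rintegrable P (fun w => sqn (\sum_(l < k) om t i l w)).
  exact: rintegrable_edot.
have iN6' i : rintegrable P (fun w => mean (fun k : 'I_K => sqn (\sum_(l < k) om t i l w))).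
  exact: rintegrable_mean (iN6'' i).
have iN6 : rintegrable P N6 by exact: rintegrable_mean iN6'.
have mle k (Y : 'I_k -> R) c : (0 < k)%N -> (forall i, Y i <= c) -> mean Y <= c.
  by move=> k0 Yc; rewrite -[leRHS](mean_cst c k0); exact: ler_mean.
have EN1 : Ex P N1 <= sigma_u ^+ 2 / (n%:R * K%:R) by exact: noise_total_mean_le.
have EN2 : Ex P N2 <= sigma_u ^+ 2 / K%:R.
  by rewrite (Ex_mean iN2'); apply: (@mle n) => // i; exact: (noise_mean_le t i).1.
have EN3 : Ex P N3 <= sigma_u ^+ 2 / K%:R.
  by rewrite (Ex_mean iN3'); apply: (@mle n) => // i; exact: control_noise_le.
(* A prefix of k noises has second moment at most k sigma^2, weakened to K sigma^2 uniformly in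
   k. *)
have prefix (k : 'I_K) (c x : R) : 0 <= c -> x <= k%:R * c -> x <= K%:R * c.
  by move=> c0 /le_trans; apply; rewrite ler_wpM2r // ler_nat ltnW.
have EN4 : Ex P N4 <= K%:R * sigma_u ^+ 2.
  rewrite (Ex_mean iN4'); apply: (@mle n) => // i; rewrite (Ex_mean (iN4'' i)); apply: (@mle K) => // k.
  by apply: (prefix k); rewrite ?sqr_ge0 //; apply: (noise_prefix_le t i _).1; exact: ltnW.
have EN5 : Ex P N5 <= sigma_v ^+ 2 / K%:R.
  by rewrite (Ex_mean iN5'); apply: (@mle n) => // i; exact: (noise_mean_le t i).2.
have EN6 : Ex P N6 <= K%:R * sigma_v ^+ 2.
  rewrite (Ex_mean iN6'); apply: (@mle n) => // i; rewrite (Ex_mean (iN6'' i)); apply: (@mle K) => // k.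
  by apply: (prefix k); rewrite ?sqr_ge0 //; apply: (noise_prefix_le t i _).2; exact: ltnW.
have iM2 : rintegrable P (fun w => mean (fun i => edot (gv i w) (vmean (fun k : 'I_K => om t i k w)))).
  apply: (rintegrable_mean (Y := fun i w => edot (gv i w) (vmean (fun k : 'I_K => om t i k w)))) => i.
  exact: rintegrable_edot.
have [iY eY] := Ex_combination (m%:R / n%:R) (s / 4) s (s * (m%:R / n%:R)) (2 * A0 * s)
  (5 * L * s ^+ 2) (9 * L * s ^+ 2 * m%:R^-1) (L * gamma ^+ 2 * m%:R^-1) (5 * L * s ^+ 2)
  (L * gamma ^+ 2) (lyapunov_integrable tT) (grad_sqn_integrable tT)
  (rintegrable_edot lgub lnub) iM2 (rintegrable_edot ldb lnub) iN1 iN2 iN3 iN4 iN5 iN6.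
have [iN eN] := next_lyapunov_sampling t.
rewrite eN; apply: le_trans (le_Ex iN iY (lyapunov_round_le t)) _.
rewrite eY EM1 EM2 EM3 !mulr0 !subr0 -!addrA; rewrite lerD2l lerD2l.
(* The noise averaged over all clients has variance of order 1/n, which m <= n lets the 1/m term
   absorb. *)
have nm : n%:R^-1 <= m%:R^-1 :> R by rewrite lef_pV2 ?posrE // ler_nat; case/andP: mn.
have im0 : 0 < m%:R^-1 :> R by rewrite invr_gt0.
have r0 : 0 < m%:R / n%:R :> R by rewrite divr_gt0.
have Ls0 : 0 < L * s ^+ 2 by rewrite mulr_gt0 // exprn_gt0.
have Lg0 : 0 < L * gamma ^+ 2 by rewrite mulr_gt0 // exprn_gt0.
have sK : s ^+ 2 / K%:R = gamma ^+ 2 * K%:R by rewrite /s; field; rewrite KR.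
have q1 : L * s ^+ 2 * Ex P N1 <= L * gamma ^+ 2 * K%:R * (sigma_u ^+ 2 / m%:R).
  apply: le_trans (ler_wpM2l (ltW Ls0) EN1) _.
  rewrite (_ : L * s ^+ 2 * _ = L * gamma ^+ 2 * K%:R * (sigma_u ^+ 2 / n%:R)); last first.
    by rewrite /s; field; rewrite KR gt_eqF.
  apply: ler_wpM2l; first by rewrite mulr_ge0 // ltW.
  by rewrite ler_wpM2l ?sqr_ge0.
have q2 x : x <= sigma_u ^+ 2 / K%:R ->
    L * s ^+ 2 * m%:R^-1 * x <= L * gamma ^+ 2 * K%:R * (sigma_u ^+ 2 / m%:R).
  move=> hx; apply: le_trans (ler_wpM2l (ltW (mulr_gt0 Ls0 im0)) hx) _.
  by rewrite le_eqVlt; apply/orP; left; apply/eqP; rewrite /s; field; rewrite KR gt_eqF.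
have q4 : L * gamma ^+ 2 * m%:R^-1 * Ex P N4 <= L * gamma ^+ 2 * K%:R * (sigma_u ^+ 2 / m%:R).
  apply: le_trans (ler_wpM2l (ltW (mulr_gt0 Lg0 im0)) EN4) _.
  by rewrite le_eqVlt; apply/orP; left; apply/eqP; field; rewrite gt_eqF.
have q5 : m%:R / n%:R * (L * s ^+ 2 * Ex P N5)
    <= L * gamma ^+ 2 * K%:R * (sigma_v ^+ 2 * (m%:R / n%:R)).
  apply: le_trans (ler_wpM2l (ltW r0) (ler_wpM2l (ltW Ls0) EN5)) _.
  by rewrite le_eqVlt; apply/orP; left; apply/eqP; rewrite /s; field; rewrite KR gt_eqF.
have q6 : m%:R / n%:R * (L * gamma ^+ 2 * Ex P N6)
    <= L * gamma ^+ 2 * K%:R * (sigma_v ^+ 2 * (m%:R / n%:R)).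
  apply: le_trans (ler_wpM2l (ltW r0) (ler_wpM2l (ltW Lg0) EN6)) _.
  by rewrite le_eqVlt; apply/orP; left; apply/eqP; field; rewrite gt_eqF.
have q2' := q2 _ EN2; have q3' := q2 _ EN3.
have LgK0 : 0 <= L * gamma ^+ 2 * K%:R by rewrite mulr_ge0 // ltW.
have p1 : 0 <= L * gamma ^+ 2 * K%:R * (sigma_u ^+ 2 / m%:R).
  by rewrite mulr_ge0 // divr_ge0 ?sqr_ge0.
have p2 : 0 <= L * gamma ^+ 2 * K%:R * (sigma_v ^+ 2 * (m%:R / n%:R)).
  by rewrite mulr_ge0 // mulr_ge0 ?sqr_ge0 // ltW.
exact: noise_budget.
Qed.

Lemma gradients_L2 t : (t <= T)%N ->
  vL2 P (fun w => vmean (fun i => grad_u (f i) (shared (st t w)) (personal (st t w) i))) /\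
  forall i, vL2 P (fun w => grad_v (f i) (shared (st t w)) (personal (st t w) i)).
Proof.
move=> /run_L2[ls lp lc la lk]; split => [|i]; last exact: (vL2_grad i ls (lp i)).2.
by apply: vL2_vmean => i; exact: (vL2_grad i ls (lp i)).1.
Qed.

(** Telescoping. At time 0 the anchors are u0 and the clean controls are the true gradients, so both
    penalties vanish; at time T they are nonnegative, so [low] bounds the Lyapunov value from
    below. *)
Lemma lyapunov_descent (low : R) : (forall u v, low <= mean (fun i => f i u (v i))) ->
  s / 4 * \sum_(t < T) Ex P (grad_sqn t) <= mean (fun i => f i u0 (v0 i)) - low
    + T%:R * (37 * (L * gamma ^+ 2 * K%:R) * (sigma_u ^+ 2 / m%:R + sigma_v ^+ 2 * (m%:R / n%:R))).
Proof.
move=> hlow; set c := 37 * _ * _.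
have z e (x : 'I_n -> 'rV[R]_e) : mean (fun i => sqn (x i - x i)) = 0.
  by rewrite /mean big1 ?mulr0 // => i _; rewrite subrr sqn0.
have psi0 : Ex P (lyapunov 0%N) = mean (fun i => f i u0 (v0 i)).
  rewrite -[RHS](Ex_cst P); apply: eq_Ex => w; rewrite /lyapunov /potential /=.
  by rewrite (z _ (fun=> u0)) (z _ (fun i => grad_u (f i) u0 (v0 i))) !mulr0 !addr0.
have psiT : low <= Ex P (lyapunov T).
  rewrite -[leLHS](Ex_cst P); apply: le_Ex.
  - exact: rintegrable_cst.
  - exact: lyapunov_integrable.
  move=> w; apply: le_trans (hlow (shared (st T w)) (personal (st T w))) _.
  have n0 : 0 < n%:R :> R by rewrite ltr0n.
  have m0 : 0 < m%:R :> R by rewrite ltr0n; case/andP: mn.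
  have q0 : 0 <= n%:R / m%:R ^+ 2 :> R by rewrite divr_ge0 ?sqr_ge0 // ltW.
  have A00 : 0 <= A0 by rewrite /A0 !mulr_ge0 ?sqr_ge0 ?exprn_ge0 // ltW.
  have B00 : 0 <= B0 by rewrite /B0 !mulr_ge0 ?sqr_ge0 // ltW.
  rewrite /lyapunov /potential -addrA lerDl addr_ge0 // mulr_ge0 // mean_ge0 // => i;
    exact: sqn_ge0.
have step k : (k <= T)%N -> s / 4 * \sum_(t < k) Ex P (grad_sqn t)
    <= Ex P (lyapunov 0%N) - Ex P (lyapunov k) + k%:R * c.
  elim: k => [_|k IH kT]; first by rewrite big_ord0 mulr0 subrr mul0r addr0.
  have h := lyapunov_round_expectation (Ordinal kT); have {}IH := IH (ltnW kT).
  have ek : k.+1%:R = k%:R + 1 :> R by rewrite natr1.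
  rewrite big_ord_recr /= ek.
  exact: telescope_step h IH.
by apply: le_trans (step T (leqnn T)) _; rewrite psi0 lerD2r lerD2l lerN2.
Qed.

End Stochastic.

(** * Consequences of the step-size conditions *)

Section StepSizes.
Context {R : realType}.
Variables (n m K : nat) (L gamma : R).
Hypothesis mn : (1 <= m <= n)%N.
Hypothesis K_gt0 : (0 < K)%N.
Hypothesis L_gt0 : 0 < L.
Hypothesis gamma_gt0 : 0 < gamma.
Hypothesis step : gamma <= (72 * L * K%:R)^-1 * Num.min (m%:R / n%:R `^ (2 / 3)) 1.

(** With z = n^(2/3) the hypothesis reads y <= 1 and y z <= m. The cube of the latter is the third
    bound because z^3 = n^2; its square gives the second because z^2 = n^(4/3) >= n. *)
Lemma step_size_bounds : let y := 72 * (L * (gamma * K%:R)) in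
  [/\ y <= 1, y ^+ 2 * n%:R <= m%:R ^+ 2 & y ^+ 3 * n%:R ^+ 2 <= m%:R ^+ 3].
Proof.
move=> y.
have n0 : 0 < n%:R :> R by rewrite ltr0n; case/andP: mn => /leq_trans; apply.
have n1 : 1 <= n%:R :> R by rewrite ler1n; case/andP: mn => /leq_trans; apply.
have m0 : 0 < m%:R :> R by rewrite ltr0n; case/andP: mn.
have K0 : 0 < K%:R :> R by rewrite ltr0n.
have := step; set z := n%:R `^ (2 / 3) => st.
have z0 : 0 < z by rewrite powR_gt0.
have z3 : z ^+ 3 = n%:R ^+ 2.
  rewrite -powR_mulrn ?powR_ge0 // -powRrM mulfVK ?pnatr_eq0 //.
  by rewrite powR_mulrn // ltW.
have z1 : 1 <= z.
  rewrite -(@ler_pXn2r _ 3) ?nnegrE ?ler01 ?(ltW z0) // expr1n z3.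
  by rewrite exprn_ege1.
have z2 : n%:R <= z ^+ 2.
  rewrite -(@ler_pXn2r _ 2) ?nnegrE ?(ltW n0) ?sqr_ge0 // -z3 -exprM.
  by rewrite [leRHS](exprS z 3) ler_peMl // exprn_ge0 // ltW.
have y0 : 0 <= y by rewrite !mulr_ge0 // ltW.
have hy : y <= Num.min (m%:R / z) 1.
  have c0 : 0 < 72 * L * K%:R by rewrite !mulr_gt0.
  move: st; rewrite -(ler_pM2l c0) mulrA divff ?gt_eqF // mul1r.
  by rewrite (_ : _ * gamma = y) // /y; ring.
have [hyz y1] : y <= m%:R / z /\ y <= 1 by move: hy; rewrite le_min => /andP[].
have hyz' : y * z <= m%:R by rewrite -ler_pdivlMr.
have yz0 : 0 <= y * z by rewrite mulr_ge0 // ltW.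
split => //.
  apply: le_trans (_ : (y * z) ^+ 2 <= _); last by rewrite lerXn2r ?nnegrE // ltW.
  by rewrite [leRHS]exprMn ler_wpM2l // sqr_ge0.
by rewrite -z3 -exprMn lerXn2r ?nnegrE // ltW.
Qed.

(** Used with c = m for u and c = n/m for v: large server step sizes force small local ones once
    their product gamma is fixed. *)
Lemma ratio_sqr_le (g e c : R) : 0 < c -> Num.sqrt c <= e -> g ^+ 2 <= (g * e) ^+ 2 / c.
Proof.
move=> c0 ce; rewrite ler_pdivlMr // exprMn ler_wpM2l ?sqr_ge0 //.
have e0 : 0 <= e by apply: le_trans ce; rewrite sqrtr_ge0.
by rewrite -[leLHS](sqr_sqrtr (ltW c0)) lerXn2r ?nnegrE ?sqrtr_ge0.
Qed.

End StepSizes.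

(** * Gradient of the global loss and centring of the noise *)

Section ObjectiveGradient.
Context {R : realType} {dX : measure_display} {X : measurableType dX} {du dv n : nat}.
Variables (D : 'I_n -> probability X R) (F : X -> 'rV[R]_du -> 'rV[R]_dv -> R).
Notation f := (client_loss D F).

Lemma grad_loss u v : (forall i, partially_differentiable (f i)) ->
  grad (fun u => loss D F u v) u = vmean (fun i => grad_u (f i) u (v i)).
Proof.
move=> df; have der i j : derivable ((f i)^~ (v i)) u (delta_mx 0 j).
  by apply: diff_derivable; case: (df i u (v i)).
apply/rowP => j; rewrite !mxE summxE.
rewrite (_ : (fun u => loss D F u v) = n%:R^-1 \*: \sum_(i < n) (f i)^~ (v i)).
  rewrite deriveZ; last exact: derivable_sum.
  by rewrite derive_sum //; congr (_ *: _); apply: eq_bigr => i _; rewrite mxE.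
by apply/funext => u'; rewrite /loss /= fct_sumE.
Qed.

(** The variance bound supplies the integrability of g - c, hence of g, which is what permits
    subtracting c from the mean identity. *)
Lemma grad_noise_centered i e (g : X -> 'rV[R]_e) (c : 'rV[R]_e) (s2 : R) : vmeasurable g ->
  (forall j, 'E_(D i)[fun x => (g x 0 j)%R] = (c 0 j)%:E)%E ->
  ('E_(D i)[fun x => (enorm (g x - c) ^+ 2)%R] <= s2%:E)%E ->
  (\int[D i]_x (sqn (g x - c))%:E <= s2%:E)%E /\
  forall j, (\int[D i]_x ((g x - c) 0 j)%:E = 0)%E.
Proof.
move=> mg gc gv.
have mgc : vmeasurable (fun x => g x - c) by apply: vmeasurableB => //; exact: vmeasurable_cst.
have hv : (\int[D i]_x (sqn (g x - c))%:E <= s2%:E)%E.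
  by move: gv; rewrite unlock; under eq_integral do rewrite enorm_sqr.
split => // j.
have lgc : vL2 (D i) (fun x => g x - c).
  split => //; apply: rintegrable_ge0_le hv; first exact: measurable_edot.
  by move=> x; exact: sqn_ge0.
have ic := vL2_coord j lgc; rewrite (ExE ic).
have := gc j; rewrite unlock.
rewrite (eq_integral (fun x => ((g x - c) 0 j + c 0 j)%:E)) => [|x _]; last first.
  by rewrite !mxE subrK.
rewrite (ExE (rintegrableD ic (rintegrable_cst (D i) (c 0 j)))) => -[].
rewrite (ExD ic (rintegrable_cst _ _)) Ex_cst => h.
by congr (_%:E); apply: (addIr (c 0 j)); rewrite h add0r.
Qed.

End ObjectiveGradient.

(** * From the Lyapunov descent to the convergence rate *)

Theorem theorem4p5 (R : realType) (d dX : measure_display)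
    (Omega : measurableType d) (P : probability Omega R)
    (X : measurableType dX) (du dv n m T K : nat)
    (D : 'I_n -> probability X R)
    (F : X -> 'rV[R]_du -> 'rV[R]_dv -> R)
    (Lu Lv Luv Lvu sigma_u sigma_v : R)
    (gamma_u gamma_v eta_u eta_v gamma : R)
    (u0 : 'rV[R]_du) (v0 : 'I_n -> 'rV[R]_dv)
    (xi : nat -> 'I_n -> nat -> {RV P >-> X})
    (S : nat -> Omega -> {set 'I_n}) :
  let f := client_loss D F in
  let L := Num.max (Num.max Lu Lv) (Num.max Luv Lvu) in
  let run w :=
    scaffold_run F m K gamma_u gamma_v eta_u eta_v u0 v0
      (fun s i k => xi s i k w) (fun t => S t w) in
  let U t w := shared (run w t) in
  let V t w := personal (run w t) in
  let G_u t :=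
    'E_P[fun w => (enorm (grad (fun u => loss D F u (V t w)) (U t w)) ^+ 2)%R]%E in
  let hatG_v t :=
    ((m%:R / n%:R ^+ 2)%:E *
      \sum_(i < n) 'E_P[fun w => (enorm (grad_v (f i) (U t w) (V t w i)) ^+ 2)%R])%E in
  (1 <= m <= n)%N -> (1 <= T)%N -> (1 <= K)%N ->
  (* the loss and its expectation are well defined *)
  (forall x, partially_differentiable (F x)) ->
  (forall i u v, (D i).-integrable setT (fun x => (F x u v)%:E)) ->
  (* smoothness *)
  (forall i, partially_differentiable (f i)) ->
  (forall i v, elipschitz Lu (fun u => grad_u (f i) u v)) ->
  (forall i u, elipschitz Luv (fun v => grad_u (f i) u v)) ->
  (forall i u, elipschitz Lv (fun v => grad_v (f i) u v)) ->
  (forall i v, elipschitz Lvu (fun u => grad_v (f i) u v)) ->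
  0 < L ->
  (* stochastic gradients *)
  (forall i u v j,
     ('E_(D i)[fun x => (grad_u (F x) u v 0 j)%R]
      = (grad_u (f i) u v 0 j)%:E)%E) ->
  (forall i u v j,
     ('E_(D i)[fun x => (grad_v (F x) u v 0 j)%R]
      = (grad_v (f i) u v 0 j)%:E)%E) ->
  (forall i u v,
     ('E_(D i)[fun x =>
        (enorm (grad_u (F x) u v - grad_u (f i) u v) ^+ 2)%R]
      <= (sigma_u ^+ 2)%:E)%E) ->
  (forall i u v,
     ('E_(D i)[fun x =>
        (enorm (grad_v (F x) u v - grad_v (f i) u v) ^+ 2)%R]
      <= (sigma_v ^+ 2)%:E)%E) ->
  (* random inputs *)
  (forall (s : 'I_T.+1) i (k : 'I_K) A, measurable A ->
     distribution P (xi s i k) A = D i A) ->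
  (forall t : 'I_T, uniform_subset P m (S t)) ->
  mutually_independent P (@draw_events R d dX Omega X n P T K xi S) ->
  (* step sizes *)
  0 < gamma_u -> 0 < gamma_v -> 0 < eta_u -> 0 < eta_v ->
  gamma_u * eta_u = gamma -> gamma_v * eta_v = gamma ->
  Num.sqrt m%:R <= eta_u -> Num.sqrt (n%:R / m%:R) <= eta_v ->
  gamma <= (72 * L * K%:R)^-1 * Num.min (m%:R / n%:R `^ (2 / 3)) 1 ->
  ((T%:R^-1)%:E * \sum_(t < T) (G_u t + hatG_v t)
   <= (4 / (T%:R * K%:R * gamma))%:E * initial_gap D F u0 v0
      + (148 * (sigma_u ^+ 2 / m%:R + sigma_v ^+ 2 * m%:R / n%:R)
         * L * gamma)%:E)%E.
Proof.
move=> f L run U V G_u hatG_v mn T0 K0 dF iF df lu luv lv lvu L0 Eu Ev Vu Vv law unif ind.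
move=> gu0 gv0 eu0 ev0 gue gve hu hv step.
have n0 : (0 < n)%N by case/andP: mn => /leq_trans; apply.
have m0 : (0 < m)%N by case/andP: mn.
have nR : 0 < n%:R :> R by rewrite ltr0n.
have mR : 0 < m%:R :> R by rewrite ltr0n.
have KR : 0 < K%:R :> R by rewrite ltr0n.
have TR : 0 < T%:R :> R by rewrite ltr0n.
have g0 : 0 < gamma by rewrite -gue mulr_gt0.
have Lu_le : Lu <= L by rewrite /L !le_max lexx.
have Lv_le : Lv <= L by rewrite /L !le_max lexx orbT.
have Luv_le : Luv <= L by rewrite /L !le_max lexx !orbT.
have Lvu_le : Lvu <= L by rewrite /L !le_max lexx !orbT.
(* Measurability of the loss in the sample is extracted from its integrability under the law of one
   client, which exists because n > 0. *)
have mF u v : measurable_fun setT (fun x => F x u v).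
  by have /integrableP[/measurable_EFinP] := iF (Ordinal n0) u v.
have mg u v := vmeasurable_sgrad mF dF (@measurable_id _ X setT) (@vmeasurable_cst R _ X du u)
  (@vmeasurable_cst R _ X dv v).
have noise_u i u v := grad_noise_centered (mg u v).1 (Eu i u v) (Vu i u v).
have noise_v i u v := grad_noise_centered (mg u v).2 (Ev i u v) (Vv i u v).
have Gu i := grad_u_lipschitz (lu i) (luv i) L0 Lu_le Luv_le.
have Gv i := grad_v_lipschitz (lv i) (lvu i) L0 Lv_le Lvu_le.
have f_le i := two_block_upper (df i) (lu i) (luv i) (lv i) L0 Lu_le Lv_le Luv_le.
have [step1 step2 step3] := step_size_bounds mn K0 L0 g0 step.
have gu_le : gamma_u ^+ 2 <= gamma ^+ 2 / m%:R by rewrite -gue; exact: ratio_sqr_le.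
have gv_le : gamma_v ^+ 2 <= gamma ^+ 2 * (m%:R / n%:R).
  by rewrite -gve -[X in _ * X]invf_div; apply: ratio_sqr_le; rewrite ?divr_gt0.
have mean_u i u v := (noise_u i u v).2; have var_u i u v := (noise_u i u v).1.
have mean_v i u v := (noise_v i u v).2; have var_v i u v := (noise_v i u v).1.
have lossE u v : loss D F u v = mean (fun i => f i u (v i)) by [].
pose low := ereal_inf (range (fun p => (loss D F p.1 p.2)%:E)).
have low_le u v : (low <= (loss D F u v)%:E)%E.
  by apply: ereal_inf_lbound; exists (u, v).
set c1 := 4 / _; set c2 := 148 * _ * _ * _.
have c10 : 0 < c1 by rewrite divr_gt0 // !mulr_gt0.
rewrite /initial_gap -/low.
(* A finite infimum is the main case; +oo is impossible since the loss takes real values; -oo makes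
   the gap, hence the right side, +oo. *)
case lowE : low => [r| |].
- have hr u v : r <= mean (fun i => f i u (v i)) by have := low_le u v; rewrite lowE lee_fin.
  have H := lyapunov_descent u0 v0 mn K0 mF dF df f_le Gu Gv mean_u mean_v var_u var_v law
    unif ind L0 g0 gue gve gu_le gv_le step1 step2 step3 hr.
  set Gs := grad_sqn _ _ _ _ _ _ _ _ _ _ in H.
  (* Square integrability of the gradients makes both extended-real expectations finite, and m/n^2
     times a sum over clients is m/n times a mean. *)
  have GE (t : 'I_T) : (G_u t + hatG_v t = (Ex P (Gs t))%:E)%E.
    have [lgu lgv] := gradients_L2 gamma_u gamma_v eta_u eta_v u0 v0 mF dF df Gu Gv
      mean_u mean_v var_u var_v law unif ind (ltnW (ltn_ord t)).
    have isq i : rintegrable P (fun w => sqn (grad_v (f i) (U t w) (V t w i))).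
      exact: rintegrable_edot.
    have -> : G_u t = (Ex P (fun w => sqn (vmean (fun i => grad_u (f i) (U t w) (V t w i)))))%:E.
      rewrite /G_u unlock -ExE; last exact: rintegrable_edot.
      by apply: eq_integral => w _; rewrite enorm_sqr grad_loss.
    have -> : hatG_v t = (m%:R / n%:R * mean (fun i =>
        Ex P (fun w => sqn (grad_v (f i) (U t w) (V t w i)))))%:E.
      rewrite /hatG_v (eq_bigr (fun i => (Ex P (fun w => sqn (grad_v (f i) (U t w) (V t w i))))%:E)).
        rewrite sumEFin -EFinM /mean; congr (_%:E); rewrite mulrA; congr (_ * _).
        by field; rewrite gt_eqF.
      move=> i _; rewrite unlock -ExE //.
      by apply: eq_integral => w _; rewrite enorm_sqr.
    rewrite -EFinD; congr (_%:E); rewrite -(Ex_mean isq) -ExZ; last exact: rintegrable_mean.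
    rewrite -ExD //; first exact: rintegrable_edot.
    exact/rintegrableZ/rintegrable_mean.
  under eq_bigr do rewrite GE.
  rewrite sumEFin.  rewrite -EFinM -EFinB -EFinM -EFinD lee_fin lossE.
  move: (\sum_(t < T) _) H => x H.
  have s40 : 0 < 4 / (T%:R * K%:R * gamma) by [].
  (* The factor 4 / (T K gamma) turns s/4 into 1/T and T * 37 L gamma^2 K into 148 L gamma. *)
  have := ler_wpM2l (ltW s40) H.
  rewrite (_ : 4 / (T%:R * K%:R * gamma) * (gamma * K%:R / 4 * x) = T%:R^-1 * x); last first.
    by field; rewrite !gt_eqF.
  move=> /le_trans; apply; rewrite mulrDr lerD2l le_eqVlt; apply/orP; left; apply/eqP.
  by rewrite /c2; field; rewrite !gt_eqF.
- by have := low_le u0 v0; rewrite lowE leye_eq.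
- by rewrite /= mulry gtr0_sg // mul1e addye // leey.
Qed.
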